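(* Let $B=\{B_s\}_{s\ge 0}$ be a one-dimensional standard Brownian motion (with $B_0=0$), fix $t>0$, and for $\mu\in\mathbb{R}$ let $B^{(\mu)}=\{B^{(\mu)}_s:=B_s+\mu s\}_{s\ge 0}$. For every $\mu\in\mathbb{R}$, the $\mathbb{R}^3$-valued processes $$\left\{\bigl(B^{(\mu)}_s,\ \mathcal{M}(B^{(\mu)})(s),\ \mathcal{P}(B^{(\mu)})(s)\bigr)\right\}_{0\le s\le t}\quad\text{and}\quad \left\{\bigl(\mathcal{M}(B^{(-\mu)})(s),\ B^{(-\mu)}_s,\ \mathcal{P}(B^{(-\mu)})(s)\bigr)\right\}_{0\le s\le t}$$ have the same law, where $\mathcal{M}$ is applied to the restrictions of the paths to $[0,t]$.
   Context: $C([0,t];\mathbb{R})$ is the space of real-valued continuous functions on $[0,t]$ with the topology of uniform convergence and its Borel $\sigma$-algebra. The transformation $\mathcal{M}:C([0,t];\mathbb{R})\to C([0,t];\mathbb{R})$ is defined, for $0\le s\le t$, by $$\mathcal{M}(\phi)(s):=\phi_s-\phi_t-\Bigl|\phi_t+\max_{0\le u\le s}\phi_u-\max_{s\le u\le t}\phi_u\Bigr|+\Bigl|\max_{0\le u\le s}\phi_u-\max_{s\le u\le t}\phi_u\Bigr|.$$ Pitman's transformation $\mathcal{P}$ is defined on continuous paths by $\mathcal{P}(\phi)(s):=2\max_{0\le u\le s}\phi_u-\phi_s$. *)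

(* Defs.v *)
From mathcomp Require Export all_boot all_order all_algebra.
From mathcomp Require Export all_classical all_reals all_analysis.
Export Order.TTheory GRing.Theory Num.Theory numFieldNormedType.Exports.

Set Implicit Arguments.
Unset Strict Implicit.
Unset Printing Implicit Defensive.

Local Open Scope classical_set_scope.
Local Open Scope ring_scope.

Section PathTransformations.
Context {R : realType}.
Implicit Types (phi : R -> R) (a b s t : R).

(* For phi continuous on [a, b] with a <= b the supremum is attained, so this
   is the maximum of phi over [a, b]. *)
Definition path_max phi a b : R := sup [set phi u | u in `[a, b]].

Definition calM t phi s : R :=
  phi s - phi t
  - `|phi t + path_max phi 0 s - path_max phi s t|
  + `|path_max phi 0 s - path_max phi s t|.

Definition pitman phi s : R := 2 * path_max phi 0 s - phi s.

End PathTransformations.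

Section PathSpace.
Context {R : realType}.

(* C([0, t]; V) inside the space of all functions R -> V endowed with uniform
   convergence on [0, t]. Functions that agree on [0, t] are topologically
   indistinguishable there, so every set in [borel_path_space] depends only on
   the restrictions to [0, t]. *)
Definition path_space (t : R) (V : uniformType) : set {uniform` `[0, t] -> V} :=
  [set f | {within `[0, t], continuous (f : R -> V)}].
Arguments path_space : clear implicits.

(* Generated by the relatively open subsets of [path_space]. *)
Definition borel_path_space (t : R) (V : uniformType) :
    set_system {uniform` `[0, t] -> V} :=
  <<s path_space t V, [set U `&` path_space t V | U in open] >>.
Arguments borel_path_space : clear implicits.

Definition random_path d (T : measurableType d) (t : R) (V : uniformType)
    (X : T -> {uniform` `[0, t] -> V}) : Prop :=
  (forall w, path_space t V (X w)) /\
  (forall A, borel_path_space t V A -> measurable (X @^-1` A)).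

Definition same_law d (T : measurableType d) (P : probability T R)
    (t : R) (V : uniformType) (X Y : T -> {uniform` `[0, t] -> V}) : Prop :=
  [/\ random_path X, random_path Y &
      forall A, borel_path_space t V A -> P (X @^-1` A) = P (Y @^-1` A)].

End PathSpace.

Section BrownianMotion.
Context {R : realType} d (T : measurableType d) (P : probability T R).

(* Taking some of the A i to be the full space gives the product rule for
   subfamilies. *)
Definition mutually_independent n (X : 'I_n -> T -> R) : Prop :=
  forall A : 'I_n -> set R, (forall i, measurable (A i)) ->
    P (\bigcap_(i in [set: 'I_n]) (X i @^-1` A i)) =
    (\prod_(i < n) P (X i @^-1` A i))%E.

(* Only the times s >= 0 matter; the values of B at negative times are
   unconstrained. [normal_prob] takes the mean and the standard deviation. *)
Definition standard_brownian_motion (B : R -> {RV P >-> R}) : Prop :=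
  [/\ forall w, B 0 w = 0,
      forall w, {within `[0, +oo[, continuous (fun s => B s w)},
      forall (n : nat) (tau : nat -> R), 0 <= tau 0%N ->
        (forall i, (i < n)%N -> tau i <= tau i.+1) ->
        mutually_independent
          (fun i : 'I_n => B (tau i.+1) \- B (tau i))
    & forall r s : R, 0 <= r -> r < s ->
        forall A : set R, measurable A ->
          pushforward P (B s \- B r) A =
          normal_prob 0 (Num.sqrt (s - r)) A].

Definition drifted (B : R -> {RV P >-> R}) (mu : R) (w : T) (s : R) : R :=
  B s w + mu * s.

End BrownianMotion.

(* Main.v *)
Require Import Defs.
From HB Require Import structures.
From mathcomp Require Import measurable_realfun ring lra.

Set Implicit Arguments.
Unset Strict Implicit.
Unset Printing Implicit Defensive.

Local Open Scope classical_set_scope.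
Local Open Scope ring_scope.

(** Write [phi] for a continuous path on [0, t] started at 0, [S] for its running
    maximum and [p = 2 * S - phi] for its Pitman transform. The path can be
    recovered from [p] and from its terminal value: the running maximum at time
    [s] is the smaller of the overall maximum [(p t + phi t) / 2] and of the
    infimum of [p] over [s, t] ([path_from_pitman]). Expanding the absolute
    values shows that [calM t phi] is recovered by the same formula from [p] and
    [- phi t] ([calM_from_pitman]). Hence the first process of the theorem is a
    function of the pair (Pitman transform, terminal value) of the path with
    drift [mu], the second one is the same function of the pair (Pitman
    transform, opposite of the terminal value) of the path with drift [- mu],
    and it is enough to show that these two pairs have the same law.

    For a nearest-neighbour walk this is an exact identity. The states (maximum,
    position) with a given value of the transform form a level, one step sends
    each level bijectively onto the two adjacent ones, and weighted sums over
    levels are exchanged when the probabilities of the two steps are exchanged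
    and the position is reflected ([walk_symmetry]). The drift is carried by the
    weights, so no change of measure is needed.

    The walk is compared with Brownian motion in two stages. On a fixed grid of
    [0, t], each Brownian increment is replaced by the end of a long walk, by
    Lindeberg's method: an increment is a sum of many small independent
    increments, which are exchanged one at a time for walk steps with the same
    mean and variance ([clt_brownian], [path_value_approx]). This deals with the
    maximum over the grid, whereas the identity for walks needs the maximum over
    all steps; a fourth moment bound shows that the two are close when the mesh
    is small, uniformly in the number of steps ([walk_value_compare]). Letting the
    number of steps grow and then the mesh shrink gives the equality of the
    expectations of products of Lipschitz functions of the transform at finitely
    many times and of the terminal value ([grid_symmetry],
    [pitman_test_symmetry]), hence the equality of the laws of the two pairs
    ([law_from_tests]).

    It remains to see that a Borel set of continuous paths in dimension 3 is
    measurable in terms of the pair. A path is the uniform limit of step paths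
    with rounded values, which depend on countably many codes, so that an open
    set is described by countably many conditions on codes
    ([open_represented], [borel_represented]). *)

(** * The reflection symmetry of nearest-neighbour walks *)

Section Walk.
Context {R : realType}.
Implicit Types (p q h M x : R) (V G : R -> R -> R) (m n : nat).

Definition walk_step p h (f : R -> R) x := p * f (x + h) + (1 - p) * f (x - h).

(** Expected value of [V] at the pair (running maximum, position) after [m]
    steps, the maximum being updated at every step. *)
Fixpoint fine_block p h m V M x : R :=
  if m is m'.+1 then
    p * fine_block p h m' V (Num.max M (x + h)) (x + h)
    + (1 - p) * fine_block p h m' V (Num.max M (x - h)) (x - h)
  else V M x.

(** Same expectation when the maximum only sees the position after the [m]
    steps. *)
Definition coarse_block p h m V M x : R :=
  iter m (walk_step p h) (fun y => V (Num.max M y) y) x.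

(** Expectation of a product of tests. From the maximum [M] and the position
    [x], each entry of [fs] is evaluated at the transformed path [2 * M - x] and
    is followed by one block with transition operator [K]; [G] is evaluated at
    the end. *)
Fixpoint walk_value (K : (R -> R -> R) -> R -> R -> R) (fs : seq (R -> R)) G M x : R :=
  if fs is f :: fs' then f (2 * M - x) * K (walk_value K fs' G) M x else G M x.

(** When the transformed walk sits at [h * n], the maximum is [h * i] for some
    [i <= n] and the position is then [h * (2 * i - n)]. This is the sum of [V]
    over these states, weighted by the tilt between up and down steps. *)
Definition level_sum p q h V n : R :=
  \sum_(i < n.+1) p ^+ i * q ^+ (n - i) * V (h * i%:R) (h * (2 * i%:R - n%:R)).

(** From level [n] an up step leads to level [n - 1], unless the walk is at its
    maximum, where it leads to the top state of level [n + 1]; a down step leads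
    to every other state of level [n + 1]. Thus the states of a level are sent
    bijectively onto those of the two adjacent levels. This is the discrete form
    of the fact that, given the transformed path, the position is uniform (for
    the symmetric walk) over the values that the path allows. *)
Lemma level_sum_step p h V n : 0 < h ->
  level_sum p (1 - p) h (fine_block p h 1 V) n =
  (if n is n'.+1 then p * (1 - p) * level_sum p (1 - p) h V n' else 0)
  + level_sum p (1 - p) h V n.+1.
Proof.
move=> h0; set q := 1 - p.
have E (i : 'I_n.+1) :
  p ^+ i * q ^+ (n - i) * fine_block p h 1 V (h * i%:R) (h * (2 * i%:R - n%:R)) =
  p ^+ i.+1 * q ^+ (n - i) *
    V (Num.max (h * i%:R) (h * (2 * i%:R - n%:R + 1))) (h * (2 * i%:R - n%:R + 1))
  + p ^+ i * q ^+ (n.+1 - i) * V (h * i%:R) (h * (2 * i%:R - n.+1%:R)).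
  have iln : (i <= n)%N by rewrite -ltnS ltn_ord.
  rewrite /= -/q.
  have -> : h * (2 * i%:R - n%:R) + h = h * (2 * i%:R - n%:R + 1) by ring.
  have -> : h * (2 * i%:R - n%:R) - h = h * (2 * i%:R - n.+1%:R).
    by rewrite -natr1; ring.
  have -> : Num.max (h * i%:R) (h * (2 * i%:R - n.+1%:R)) = h * i%:R.
    apply/max_idPl; rewrite ler_pM2l//.
    have : (i%:R : R) <= n%:R by rewrite ler_nat.
    rewrite -natr1; lra.
  rewrite subSn// !exprS; ring.
rewrite {1}/level_sum (eq_bigr _ (fun i _ => E i)) big_split/=.
rewrite [in RHS]/level_sum [X in _ = _ + X]big_ord_recr/=.
rewrite [in LHS]big_ord_recr/= !subnn expr0.
have -> : h * (2 * n%:R - n%:R + 1) = h * n.+1%:R by rewrite -natr1; ring.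
have -> : h * (2 * n.+1%:R - n.+1%:R) = h * n.+1%:R by ring.
have -> : Num.max (h * n%:R) (h * n.+1%:R) = h * n.+1%:R.
  by apply/max_idPr; rewrite ler_pM2l// ler_nat.
have -> : \sum_(i < n) p ^+ i.+1 * q ^+ (n - i) *
   V (Num.max (h * i%:R) (h * (2 * i%:R - n%:R + 1))) (h * (2 * i%:R - n%:R + 1)) =
   (if n is n'.+1 then p * q * level_sum p q h V n' else 0).
  case: n {E} => [|n]; first by rewrite big_ord0.
  rewrite /level_sum mulr_sumr; apply: eq_bigr => i _.
  have iln : (i <= n)%N by rewrite -ltnS ltn_ord.
  have -> : h * (2 * i%:R - n.+1%:R + 1) = h * (2 * i%:R - n%:R).
    by rewrite -natr1; ring.
  have -> : Num.max (h * i%:R) (h * (2 * i%:R - n%:R)) = h * i%:R.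
    apply/max_idPl; rewrite ler_pM2l//.
    have : (i%:R : R) <= n%:R by rewrite ler_nat.
    by lra.
  rewrite subSn// !exprS; ring.
by rewrite -addrA; congr (_ + _); rewrite addrC.
Qed.

(** The two walks have opposite drifts, and [V'] plays the role of [V] with the
    position reflected. *)
Definition reflected p h V V' :=
  forall n, level_sum p (1 - p) h V n = level_sum (1 - p) p h V' n.

Lemma reflected_fine p h m V V' : 0 < h -> reflected p h V V' ->
  reflected p h (fine_block p h m V) (fine_block (1 - p) h m V').
Proof.
move=> h0; elim: m V V' => [//|m IH] V V' VV'.
have step W : fine_block p h m.+1 W = fine_block p h 1 (fine_block p h m W) by [].
have step' W : fine_block (1 - p) h m.+1 W = fine_block (1 - p) h 1 (fine_block (1 - p) h m W) by [].
move=> n; rewrite step step' level_sum_step//.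
have := level_sum_step (1 - p) (fine_block (1 - p) h m V') n h0.
have -> : 1 - (1 - p) = p by ring.
move=> ->; rewrite (IH _ _ VV' n.+1); congr (_ + _).
by case: n => // n; rewrite (IH _ _ VV' n); ring.
Qed.

Lemma reflected_walk_value p h m (fs : seq (R -> R)) G G' : 0 < h -> reflected p h G G' ->
  reflected p h (walk_value (fine_block p h m) fs G) (walk_value (fine_block (1 - p) h m) fs G').
Proof.
move=> h0 GG'; elim: fs => [//|f fs IH] n /=.
have D := reflected_fine m h0 IH n.
transitivity (f (h * n%:R) * level_sum p (1 - p) h (fine_block p h m (walk_value (fine_block p h m) fs G)) n).
  rewrite /level_sum mulr_sumr; apply: eq_bigr => i _.
  have -> : 2 * (h * i%:R) - h * (2 * i%:R - n%:R) = h * n%:R by ring.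
  by ring.
rewrite D /level_sum mulr_sumr; apply: eq_bigr => i _.
have -> : 2 * (h * i%:R) - h * (2 * i%:R - n%:R) = h * n%:R by ring.
by ring.
Qed.

Lemma reflected_end p h (f g : R -> R) :
  reflected p h (fun M x => f (2 * M - x) * g x) (fun M x => f (2 * M - x) * g (- x)).
Proof.
move=> n; rewrite /level_sum (reindex_inj rev_ord_inj)/=; apply: eq_bigr => i _.
have iln : (i <= n)%N by rewrite -ltnS ltn_ord.
rewrite subSS subKn// (natrB _ iln).
have -> : 2 * (h * (n%:R - i%:R)) - h * (2 * (n%:R - i%:R) - n%:R) = h * n%:R by ring.
have -> : 2 * (h * i%:R) - h * (2 * i%:R - n%:R) = h * n%:R by ring.
have -> : h * (2 * (n%:R - i%:R) - n%:R) = - (h * (2 * i%:R - n%:R)) by ring.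
by ring.
Qed.

(** Level [0] consists of the single state (0, 0), so the weighted sums reduce
    there to the expectations themselves. *)
Lemma walk_symmetry p h m (fs : seq (R -> R)) (f g : R -> R) : 0 < h ->
  walk_value (fine_block p h m) fs (fun M x => f (2 * M - x) * g x) 0 0 =
  walk_value (fine_block (1 - p) h m) fs (fun M x => f (2 * M - x) * g (- x)) 0 0.
Proof.
move=> h0; have /(_ 0) := reflected_walk_value m fs h0 (reflected_end p h f g).
by rewrite /level_sum !big_ord1 !expr0 !mul1r /= !(mulr0, subr0, mul1r).
Qed.

End Walk.

(** * Maxima on a coarse grid and along the full walk *)

Section Compare.
Context {R : realType}.
Implicit Types (p q h M x a b e l L : R) (V G : R -> R -> R) (m n : nat).

Definition unit_valued2 V := forall M x, 0 <= V M x <= 1.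

Definition unit_lip l (f : R -> R) :=
  [/\ 0 <= l, forall x, 0 <= f x <= 1 & forall x y, `|f x - f y| <= l * `|x - y|].

(** The constants are added up, so that a test equal to [1] costs nothing: the
    error bounds below then do not depend on the number of grid points. *)
Fixpoint unit_lips (fs : seq (R -> R)) L : Prop :=
  if fs is f :: fs' then exists l L', [/\ L = l + L', unit_lip l f & unit_lips fs' L']
  else L = 0.

Definition lipschitz2 L V := forall M x M' x' e,
  `|M - M'| <= e -> `|x - x'| <= e -> `|V M x - V M' x'| <= L * e.

Lemma unit_lips_ge0 fs L : unit_lips fs L -> 0 <= L.
Proof.
elim: fs L => [L ->//|f fs IH L /= [l [L' [-> [l0 _ _] /IH]]]]; exact: addr_ge0.
Qed.

Lemma unit_onem p : 0 <= p <= 1 -> 0 <= 1 - p <= 1.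
Proof. by move=> /andP[? ?]; apply/andP; split; lra. Qed.

Lemma convex_unit p u v : 0 <= p <= 1 -> 0 <= u <= 1 -> 0 <= v <= 1 ->
  0 <= p * u + (1 - p) * v <= 1.
Proof. nra. Qed.

Lemma convex_dist p u v u' v' e : 0 <= p <= 1 -> `|u - u'| <= e -> `|v - v'| <= e ->
  `|p * u + (1 - p) * v - (p * u' + (1 - p) * v')| <= e.
Proof.
move=> /andP[p0 p1] h1 h2.
have -> : p * u + (1 - p) * v - (p * u' + (1 - p) * v') =
  p * (u - u') + (1 - p) * (v - v') by ring.
apply: (le_trans (ler_normD _ _)); rewrite !normrM (ger0_norm p0).
rewrite (@ger0_norm _ (1 - p)) ?subr_ge0//.
nra.
Qed.

Lemma unit_dist (u v : R) : 0 <= u <= 1 -> 0 <= v <= 1 -> `|u - v| <= 1.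
Proof. by move=> /andP[? ?] /andP[? ?]; rewrite ler_norml; apply/andP; split; lra. Qed.

Lemma prod_dist (u v u' v' e e' : R) : 0 <= u <= 1 -> 0 <= v' <= 1 ->
  `|u - u'| <= e -> `|v - v'| <= e' -> `|u * v - u' * v'| <= e + e'.
Proof.
move=> /andP[u0 u1] /andP[v0 v1] h1 h2.
have -> : u * v - u' * v' = u * (v - v') + (u - u') * v' by ring.
apply: (le_trans (ler_normD _ _)); rewrite !normrM (ger0_norm u0) (ger0_norm v0).
have := normr_ge0 (v - v'); have := normr_ge0 (u - u'); nra.
Qed.

Section fixed_walk.
Variables (p h : R) (m : nat).
Hypothesis p01 : 0 <= p <= 1.

Lemma walk_step_iter_unit k (f : R -> R) : (forall x, 0 <= f x <= 1) ->
  forall x, 0 <= iter k (walk_step p h) f x <= 1.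
Proof.
by move=> f01; elim: k => [//|k IH] x; rewrite iterS; apply: convex_unit.
Qed.

Lemma walk_step_iter_dist k (f g : R -> R) (c c' e : R) :
  (forall z, `|f (c + z) - g (c' + z)| <= e) ->
  `|iter k (walk_step p h) f c - iter k (walk_step p h) g c'| <= e.
Proof.
elim: k c c' => [|k IH] c c' H; first by have := H 0; rewrite !addr0.
rewrite !iterS; apply: convex_dist => //; apply: IH => z.
  by rewrite -!addrA; exact: H.
by rewrite -!addrA; exact: H.
Qed.

Lemma fine_unit k V : unit_valued2 V -> unit_valued2 (fine_block p h k V).
Proof.
move=> V01; elim: k => [//|k IH] M x /=; exact: convex_unit.
Qed.

Lemma coarse_unit k V : unit_valued2 V -> unit_valued2 (coarse_block p h k V).
Proof. by move=> V01 M x; apply: walk_step_iter_unit. Qed.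

Lemma max_dist M M' x x' e : `|M - M'| <= e -> `|x - x'| <= e ->
  `|Num.max M x - Num.max M' x'| <= e.
Proof.
rewrite !ler_norml => /andP[? ?] /andP[? ?].
case: (leP M x) => ?; case: (leP M' x') => ?; apply/andP; split; lra.
Qed.

Lemma coarse_lip L k V : lipschitz2 L V -> lipschitz2 L (coarse_block p h k V).
Proof.
move=> VL M x M' x' e HM Hx; apply: walk_step_iter_dist => z.
have Hx' : `|x + z - (x' + z)| <= e by rewrite opprD addrACA subrr addr0.
by apply: VL => //; apply: max_dist.
Qed.

Lemma walk_value_coarse_unit fs L G : unit_lips fs L -> unit_valued2 G ->
  unit_valued2 (walk_value (coarse_block p h m) fs G).
Proof.
move=> + G01; elim: fs L => [//|f fs IH] L /= [l [L' [_ [_ f01 _] /IH H]]] M x.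
have /andP[? ?] := f01 (2 * M - x).
have /andP[? ?] := coarse_unit m H M x.
by rewrite mulr_ge0//= mulr_ile1.
Qed.

Lemma walk_value_fine_unit fs L G : unit_lips fs L -> unit_valued2 G ->
  unit_valued2 (walk_value (fine_block p h m) fs G).
Proof.
move=> + G01; elim: fs L => [//|f fs IH] L /= [l [L' [_ [_ f01 _] /IH H]]] M x.
have /andP[? ?] := f01 (2 * M - x).
have /andP[? ?] := fine_unit m H M x.
by rewrite mulr_ge0//= mulr_ile1.
Qed.

Lemma unit_lip_pitman l f M x M' x' e : unit_lip l f -> `|M - M'| <= e -> `|x - x'| <= e ->
  `|f (2 * M - x) - f (2 * M' - x')| <= 3 * l * e.
Proof.
move=> [l0 _ fl] H1 H2; apply: (le_trans (fl _ _)).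
rewrite [3 * l]mulrC -mulrA ler_wpM2l//.
have -> : 2 * M - x - (2 * M' - x') = 2 * (M - M') - (x - x') by ring.
apply: (le_trans (ler_normB _ _)); rewrite normrM ger0_norm//; lra.
Qed.

Lemma walk_value_coarse_lip fs L LG G : unit_lips fs L -> unit_valued2 G -> lipschitz2 LG G ->
  lipschitz2 (3 * L + LG) (walk_value (coarse_block p h m) fs G).
Proof.
move=> + G01 GL; elim: fs L => [L ->|f fs IH L /= [l [L' [-> tf T]]]] /=.
  by rewrite mulr0 add0r.
move=> M x M' x' e HM Hx.
have /andP[e1 e2] : (0 <= e) && (0 <= l).
  by rewrite (le_trans _ HM)//=; case: tf.
have -> : (3 * (l + L') + LG) * e = 3 * l * e + (3 * L' + LG) * e by ring.
apply: prod_dist.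
- by case: tf.
- exact/coarse_unit/(walk_value_coarse_unit T).
- exact: unit_lip_pitman.
- exact: (coarse_lip m (IH _ T)).
Qed.

(** A potential with [y ^+ 4 <= quartic k y] whose expectation after one step of
    the centred walk is at most [quartic k.+1 y]. It dominates the probability
    that the centred walk leaves an interval within [k] steps, as in the maximal
    inequality for the submartingale [y ^+ 4]. *)
Definition quartic (k : nat) (y : R) : R :=
  y ^+ 4 + 8 * k%:R * h ^+ 2 * y ^+ 2 + 12 * k%:R ^+ 2 * h ^+ 4.

Let d := (2 * p - 1) * h.

(** With [r = 4 p (1 - p)], the difference of the two sides is an explicit sum of
    nonnegative terms. *)
Lemma quartic_step k y :
  p * quartic k (y + h - d) + (1 - p) * quartic k (y - h - d) <= quartic k.+1 y.
Proof.
rewrite -subr_ge0; set r := 4 * p * (1 - p).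
have /andP[r0 r1] : 0 <= r <= 1.
  have /andP[p0 p1] := p01; apply/andP; split.
    by rewrite /r !mulr_ge0// subr_ge0.
  rewrite -subr_ge0; have -> : 1 - r = (1 - 2 * p) ^+ 2 by rewrite /r; ring.
  exact: sqr_ge0.
have -> : quartic k.+1 y -
    (p * quartic k (y + h - d) + (1 - p) * quartic k (y - h - d)) =
  h ^+ 2 * (2 * r * (y - 2 * (1 - 2 * p) * h) ^+ 2 + 8 * (1 - r) * y ^+ 2
   + (k%:R * (24 - 8 * r) + (12 - 12 * r + 11 * r ^+ 2)) * h ^+ 2).
  by rewrite /quartic /d /r -[k.+1]addn1 natrD; ring.
apply: mulr_ge0; first exact: sqr_ge0.
apply: addr_ge0; first apply: addr_ge0.
- by rewrite mulr_ge0 ?sqr_ge0// mulr_ge0.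
- by rewrite mulr_ge0 ?sqr_ge0// mulr_ge0// subr_ge0.
- rewrite mulr_ge0 ?sqr_ge0//; apply: addr_ge0; first by rewrite mulr_ge0//; lra.
  by apply: addr_ge0; [lra|rewrite mulr_ge0 ?sqr_ge0].
Qed.

Lemma quartic_ge k y : y ^+ 4 <= quartic k y.
Proof.
rewrite /quartic -addrA lerDl; apply: addr_ge0.
  exact: mulr_ge0 (mulr_ge0 (mulr_ge0 (ler0n _ 8) (ler0n _ k)) (sqr_ge0 h)) (sqr_ge0 y).
by apply: mulr_ge0 (mulr_ge0 (ler0n _ 12) (sqr_ge0 _)) _; rewrite exprn_even_ge0.
Qed.

Lemma quartic_ge0 k y : 0 <= quartic k y.
Proof. by apply: le_trans (quartic_ge k y); rewrite exprn_even_ge0. Qed.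

Lemma quartic_ge1 k y b : 0 < b -> b <= `|y| -> 1 <= quartic k y / b ^+ 4.
Proof.
move=> b0 by_; rewrite ler_pdivlMr ?exprn_gt0// mul1r.
have H : b ^+ 4 <= y ^+ 4.
  have -> : y ^+ 4 = `|y| ^+ 4 by rewrite -normrX ger0_norm// exprn_even_ge0.
  by rewrite lerXn2r// nnegrE ltW.
exact: le_trans (quartic_ge k y).
Qed.

(** As long as the centred walk stays within [b] of its starting point during
    the block, the position stays within [2 * b] of it, so the full maximum
    cannot exceed by more than [4 * b] the maximum that only sees the end of the
    block. A gap of [4 * b] between the two maxima is thus preserved, except on
    an event whose probability is controlled by [quartic]. *)
Lemma block_compare V Vc b e : 0 < b -> m%:R * `|d| <= b ->
  unit_valued2 V -> unit_valued2 Vc ->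
  (forall M Mc x, Mc <= M <= Mc + 4 * b -> x <= M -> `|V M x - Vc Mc x| <= e) ->
  forall M Mc x, Mc <= M <= Mc + 4 * b -> x <= M ->
  `|fine_block p h m V M x - coarse_block p h m Vc Mc x| <=
    e + 12 * (m%:R * h ^+ 2) ^+ 2 / b ^+ 4.
Proof.
move=> b0 db V01 Vc01 HV M0 Mc x0 /andP[HM1 HM2] Hx.
have e0 : 0 <= e.
  apply: le_trans (HV M0 Mc x0 _ Hx) => //; exact/andP.
have b4 : 0 < b ^+ 4 by rewrite exprn_gt0.
suff key k M x y : `|x - x0 - y| + k%:R * `|d| <= b ->
    (`|y| < b -> [/\ Mc <= M, x <= M & M <= Num.max (Mc + 4 * b) (x0 + 2 * b)]) ->
    `|fine_block p h k V M x - coarse_block p h k Vc Mc x| <= e + quartic k y / b ^+ 4.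
  have := key m M0 x0 0; rewrite !subrr normr0 add0r => /(_ db).
  have -> : quartic m 0 = 12 * (m%:R * h ^+ 2) ^+ 2.
    by rewrite /quartic; ring.
  by apply=> _; split=> //; rewrite le_max HM2.
elim: k M x y => [|k IH] M x y H1 H2.
  have [yb|yb] := leP b `|y|.
    apply: (le_trans (unit_dist (V01 _ _) (Vc01 _ _))).
    by apply: (le_trans (quartic_ge1 0 b0 yb)); rewrite lerDr.
  have [HMc xM HM] := H2 yb.
  apply: (@le_trans _ _ e); last by rewrite lerDl divr_ge0 ?quartic_ge0 ?ltW.
  apply: HV => //; apply/andP; split; first by rewrite ge_max HMc.
  apply: (le_trans HM); rewrite ge_max lerD2r le_max lexx/=.
  move: H1; rewrite mul0r addr0 => H1.
  have : x <= Num.max Mc x by rewrite le_max lexx orbT.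
  move: H1 yb; rewrite ler_norml ltr_norml => /andP[? ?] /andP[? ?]; lra.
have [yb|yb] := leP b `|y|.
  apply: (le_trans (unit_dist (fine_unit _ V01 _ _) (coarse_unit _ Vc01 _ _))).
  by apply: (le_trans (quartic_ge1 k.+1 b0 yb)); rewrite lerDr.
have [HMc xM HM] := H2 yb.
have step z : z = h \/ z = - h ->
    `|fine_block p h k V (Num.max M (x + z)) (x + z) - coarse_block p h k Vc Mc (x + z)| <=
    e + quartic k (y + z - d) / b ^+ 4.
  move=> _; apply: IH.
    have -> : x + z - x0 - (y + z - d) = (x - x0 - y) + d by ring.
    apply: le_trans H1; rewrite -natr1 mulrDl mul1r.
    by rewrite [_ * _ + _]addrC addrA lerD2r ler_normD.
  move=> ylt; split; [by rewrite le_max HMc|by rewrite le_max lexx orbT|].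
  rewrite ge_max HM/= le_max; apply/orP; right.
  have H3 : `|x - x0 - y| + `|d| <= b.
    apply: le_trans H1; rewrite lerD2l -natr1 mulrDl mul1r lerDr mulr_ge0//.
  have H4 := ler_norm (x - x0 - y); have H5 := ler_norm d.
  have H6 := ler_norm (y + z - d); lra.
rewrite /coarse_block iterS /= /walk_step -!/(coarse_block p h k Vc Mc _).
have /andP[p0 p1] := p01.
set A := fine_block _ _ _ _ _ _; set B := fine_block _ _ _ _ _ _.
have -> : forall u v u' v' : R, p * u + (1 - p) * v - (p * u' + (1 - p) * v') =
  p * (u - u') + (1 - p) * (v - v') by move=> *; ring.
apply: (le_trans (ler_normD _ _)); rewrite !normrM (ger0_norm p0).
rewrite (@ger0_norm _ (1 - p)) ?subr_ge0//.
have S1 := step h (or_introl erefl); have S2 := step (- h) (or_intror erefl).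
apply: (@le_trans _ _ (p * (e + quartic k (y + h - d) / b ^+ 4) +
   (1 - p) * (e + quartic k (y - h - d) / b ^+ 4))).
  by apply: lerD; apply: ler_wpM2l => //; rewrite subr_ge0.
have -> : p * (e + quartic k (y + h - d) / b ^+ 4) +
   (1 - p) * (e + quartic k (y - h - d) / b ^+ 4) =
   e + (p * quartic k (y + h - d) + (1 - p) * quartic k (y - h - d)) / b ^+ 4 by ring.
by rewrite lerD2l ler_wpM2r ?invr_ge0 ?(ltW b4)// quartic_step.
Qed.

(** The gap between the two maxima does not accumulate from block to block; only
    the exceptional events do, and the fourth power makes their total small when
    the blocks are short. *)
Lemma walk_value_compare fs L l (f g : R -> R) b : 0 < b -> m%:R * `|d| <= b ->
  unit_lips fs L -> unit_lip l f -> (forall x, 0 <= g x <= 1) ->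
  let G M x := f (2 * M - x) * g x in
  forall M Mc x, Mc <= M <= Mc + 4 * b -> x <= M ->
  `|walk_value (fine_block p h m) fs G M x - walk_value (coarse_block p h m) fs G Mc x| <=
    8 * b * (L + l) + (size fs)%:R * (12 * (m%:R * h ^+ 2) ^+ 2 / b ^+ 4).
Proof.
move=> b0 db + tf g01 G.
have G01 : unit_valued2 G.
  move=> M x; have [_ f01 _] := tf.
  have /andP[? ?] := f01 (2 * M - x); have /andP[? ?] := g01 x.
  by rewrite mulr_ge0//= mulr_ile1.
have fdist l' (f' : R -> R) M Mc x : unit_lip l' f' -> Mc <= M <= Mc + 4 * b ->
    `|f' (2 * M - x) - f' (2 * Mc - x)| <= 8 * b * l'.
  move=> [l0 _ fl] /andP[? ?]; apply: (le_trans (fl _ _)).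
  have -> : 2 * M - x - (2 * Mc - x) = 2 * (M - Mc) by ring.
  by rewrite [8 * b * _]mulrC ler_wpM2l// ger0_norm; lra.
elim: fs L => [L ->|f' fs IH L /= [l' [L' [-> tf' T]]]] M Mc x HM xM.
  rewrite /= add0r mul0r /G.
  apply: prod_dist => //; first by case: tf.
  exact: fdist.
  by rewrite subrr normr0.
have := IH _ T => {}IH.
apply: le_trans (prod_dist _ _ (fdist _ _ _ _ _ tf' HM)
  (block_compare b0 db (walk_value_fine_unit T G01) (walk_value_coarse_unit T G01) IH HM xM)) _.
- by case: tf'.
- exact: coarse_unit _ (walk_value_coarse_unit T G01) _ _.
by rewrite -natr1 le_eqVlt; apply/orP; left; apply/eqP; ring.
Qed.

End fixed_walk.
End Compare.

(** * Moments of the normal distribution *)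

Section Normal.
Context {R : realType}.
Notation mu := (@lebesgue_measure R).
Local Open Scope ereal_scope.
(** The Radon-Nikodym derivative of the normal law is almost everywhere its
    density. *)
Lemma integral_normal_prob (s : R) (f : _ -> \bar R) : measurable_fun setT f ->
  (forall x, 0 <= f x) ->
  \int[normal_prob 0 s]_x f x = \int[mu]_x (f x * (normal_pdf 0 s x)%:E).
Proof.
move=> mf f0.
rewrite -(Radon_Nikodym_SigmaFinite.change_of_variables (normal_prob_dominates 0 s))//=.
apply: ae_eq_integral => //.
- apply: emeasurable_funM => //; apply: (measurable_int mu).
  exact: Radon_Nikodym_SigmaFinite.f_integrable (normal_prob_dominates 0 s).
- apply: emeasurable_funM => //=; apply/measurableT_comp => //=.
  exact: measurable_normal_pdf.
- apply: ae_eqe_mul2l => /=.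
  apply: integral_ae_eq => //=.
  + exact: Radon_Nikodym_SigmaFinite.f_integrable (normal_prob_dominates 0 s).
  + by apply/measurableT_comp =>//; exact: measurable_normal_pdf.
  + move=> E E01 mE; rewrite -Radon_Nikodym_SigmaFinite.f_integral//=.
    exact: normal_prob_dominates.
Qed.
Local Close Scope ereal_scope.

(** Put [u = `|x| / (2 * s)]: then [u ^+ 3 <= 2 * expR (u ^+ 2)]. The right-hand
    side is the unnormalized normal density with variance [2 * s ^+ 2]. *)
Lemma cube_exp_bound (s x : R) : 0 < s ->
  `|x| ^+ 3 * expR (- (x ^+ 2 / (s ^+ 2 *+ 2))) <=
  16 * s ^+ 3 * expR (- (x ^+ 2 / ((Num.sqrt 2 * s) ^+ 2 *+ 2))).
Proof.
move=> s0.
pose u := `|x| / (2 * s); have u0 : 0 <= u by rewrite divr_ge0// mulr_ge0// ltW.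
have xu : `|x| = 2 * s * u by rewrite /u mulrCA divff ?mulr1// gt_eqF// mulr_gt0.
clearbody u.
have x2 : x ^+ 2 = 4 * s ^+ 2 * u ^+ 2.
  by rewrite -(real_normK (num_real x)) xu; ring.
have sn0 : s != 0 by rewrite gt_eqF.
have -> : x ^+ 2 / (s ^+ 2 *+ 2) = u ^+ 2 + u ^+ 2 by rewrite x2; field.
have -> : x ^+ 2 / ((Num.sqrt 2 * s) ^+ 2 *+ 2) = u ^+ 2.
  by rewrite x2 exprMn sqr_sqrtr//; field.
rewrite opprD expRD mulrA ler_pM2r ?expR_gt0// xu.
have -> : (2 * s * u) ^+ 3 * expR (- u ^+ 2) = 8 * s ^+ 3 * (u ^+ 3 * expR (- u ^+ 2)).
  by ring.
have -> : 16 * s ^+ 3 = 8 * s ^+ 3 * 2 by ring.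
rewrite ler_wpM2l ?mulr_ge0 ?exprn_ge0 ?(ltW s0)// expRN ler_pdivrMr ?expR_gt0//.
have := expR_ge1Dxn 1 (sqr_ge0 u).
have := expR_ge1Dxn 0 (sqr_ge0 u).
have -> : (1`!)%:R = 1 :> R by [].
have -> : (2`!)%:R = 2 :> R by [].
have -> : (u ^+ 2) ^+ 2 = u ^+ 4 by ring.
rewrite expr1 divr1 => H1 H2.
have : u ^+ 3 <= (u ^+ 2 + u ^+ 4) / 2.
  rewrite ler_pdivlMr// -subr_ge0.
  have -> : u ^+ 2 + u ^+ 4 - u ^+ 3 * 2 = (u * (u - 1)) ^+ 2 by ring.
  exact: sqr_ge0.
have : 0 <= u ^+ 2 by exact: sqr_ge0.
have : 0 <= u ^+ 4 by rewrite exprn_ge0.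
lra.
Qed.

Lemma normal_moment3 (s : R) : 0 < s ->
  (\int[normal_prob 0 s]_x (`|x| ^+ 3)%:E <= (32 * s ^+ 3)%:E)%E.
Proof.
move=> s0.
have m3 : measurable_fun setT (fun x : R => `|x| ^+ 3).
  by apply: measurable_funX; exact: normr_measurable.
have s20 : Num.sqrt 2 * s != 0 :> R by rewrite gt_eqF// mulr_gt0// sqrtr_gt0.
rewrite integral_normal_prob//; last exact/measurable_EFinP.
apply: (@le_trans _ _ (\int[mu]_x ((32 * s ^+ 3)%:E * (normal_pdf 0 (Num.sqrt 2 * s) x)%:E))%E).
  apply: ge0_le_integral => //=.
  - move=> x _; rewrite -EFinM lee_fin.
    by apply: mulr_ge0; [exact: exprn_ge0|exact: normal_pdf_ge0].
  - by apply: emeasurable_funM; apply/measurable_EFinP => //; exact: measurable_normal_pdf.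
  - by apply: emeasurable_funM; apply/measurable_EFinP => //; exact: measurable_normal_pdf.
  - move=> x _; rewrite -!EFinM lee_fin !normal_pdfE ?(gt_eqF s0)// /normal_fun !subr0.
    rewrite !mulNr.
    have H := cube_exp_bound x s0.
    have peak : normal_peak s = Num.sqrt 2 * normal_peak (Num.sqrt 2 * s).
      have E : (Num.sqrt 2 * s) ^+ 2 * pi *+ 2 = 2 * (s ^+ 2 * pi *+ 2).
        by rewrite exprMn sqr_sqrtr//; ring.
      rewrite /normal_peak E sqrtrM// invfM.
      by rewrite mulrA divff ?mul1r// gt_eqF// sqrtr_gt0.
    rewrite mulrCA; apply: (@le_trans _ _ (normal_peak s * (16 * s ^+ 3 * 
       expR (- (x ^+ 2 / ((Num.sqrt 2 * s) ^+ 2 *+ 2)))))).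
      by rewrite ler_wpM2l ?normal_peak_ge0.
    rewrite peak.
    set P := normal_peak _; set E := expR _.
    have -> : Num.sqrt 2 * P * (16 * s ^+ 3 * E) = (16 * s ^+ 3 * (P * E)) * Num.sqrt 2.
      by ring.
    have -> : 32 * s ^+ 3 * (P * E) = (16 * s ^+ 3 * (P * E)) * 2 by ring.
    rewrite ler_wpM2l//.
      by rewrite !mulr_ge0 ?exprn_ge0 ?normal_peak_ge0 ?expR_ge0 ?ltW.
    rewrite -[leRHS]ger0_norm// -sqrtr_sqr ler_wsqrtr// expr2; lra.
rewrite ge0_integralZl//=.
- by rewrite integral_normal_pdf mule1.
- by apply/measurable_EFinP; exact: measurable_normal_pdf.
- by move=> x _; rewrite lee_fin normal_pdf_ge0.
- by rewrite lee_fin mulr_ge0// exprn_ge0// ltW.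
Qed.

Lemma normal_mean (s : R) : s != 0 ->
  (\int[normal_prob 0 s]_x (Num.max x 0)%:E =
   \int[normal_prob 0 s]_x (Num.max (- x) 0)%:E)%E.
Proof.
move=> s0.
pose g (x : R) := Num.max x 0 * normal_pdf 0 s x.
have cmax : continuous (fun x : R => Num.max x 0).
  by move=> x; apply: continuous_max; [exact: cvg_id|exact: cvg_cst].
have cg : continuous g.
  by move=> x; apply: cvgM; [exact: cmax|exact: continuous_normal_pdf].
have g0 x : 0 <= g x by rewrite mulr_ge0 ?normal_pdf_ge0// le_max lexx orbT.
have mg : measurable_fun setT g by exact: continuous_measurable_fun.
have cgN : continuous (g \o -%R).
  by move=> x; apply: continuous_comp; [exact: opp_continuous|exact: cg].
have mgN : measurable_fun setT (g \o -%R) by exact: continuous_measurable_fun.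
have pdfN x : normal_pdf 0 s (- x) = normal_pdf 0 s x.
  by rewrite !normal_pdfE// /normal_fun !subr0 sqrrN.
have mmax : measurable_fun setT (fun x : R => Num.max x 0).
  exact: continuous_measurable_fun.
rewrite !integral_normal_prob//.
transitivity (\int[mu]_x (g x)%:E)%E; first by apply: eq_integral => x _; rewrite EFinM.
transitivity (\int[mu]_x ((g \o -%R) x)%:E)%E; last first.
  by apply: eq_integral => x _; rewrite /= /g pdfN EFinM.
transitivity (\int[mu]_(x in `[0%R, +oo[) (g x)%:E)%E.
  rewrite [RHS]integral_mkcond; apply: eq_integral => x _.
  rewrite patchE; case: ifPn => //; rewrite notin_setE/= in_itv/= andbT => /negP.
  by rewrite -ltNge /g => x0; rewrite (max_idPr (ltW x0)) mul0r.
transitivity (\int[mu]_(x in `]-oo, 0%R]) ((g \o -%R) x)%:E)%E; last first.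
  rewrite [LHS]integral_mkcond; apply: eq_integral => x _.
  rewrite patchE; case: ifPn => //; rewrite notin_setE/= in_itv/= => /negP.
  rewrite -ltNge /g /= => x0; rewrite (max_idPr _) ?mul0r//.
  by rewrite oppr_le0 ltW.
have := @ge0_integration_by_substitutionNy R (g \o -%R) 0.
rewrite oppr0 => ->.
- by apply: eq_integral => x _; rewrite /= opprK.
- exact: continuous_subspaceT.
- by move=> x _; exact: g0.
- apply/measurable_EFinP; apply: (measurableT_comp mmax); exact: oppr_measurable.
- by move=> x; rewrite lee_fin le_max lexx orbT.
- exact/measurable_EFinP.
- by move=> x; rewrite lee_fin le_max lexx orbT.
Qed.

(** The density is at most [(s * Num.sqrt (2 * pi))^-1] and [2 <= pi]. *)
Lemma normal_center (s : R) : 0 < s ->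
  (normal_prob 0 s `[(- (s / 2))%R, (s / 2)%R] <= (2^-1)%:E)%E.
Proof.
move=> s0; rewrite /normal_prob.
apply: (@le_trans _ _ (\int[mu]_(x in `[(- (s / 2))%R, (s / 2)%R]) (normal_peak s)%:E)%E).
  apply: ge0_le_integral => //=.
  - by move=> x _; rewrite lee_fin normal_pdf_ge0.
  - by apply/measurable_EFinP; apply: measurable_funTS; exact: measurable_normal_pdf.
  - by move=> x _; rewrite lee_fin normal_pdf_ub// gt_eqF.
rewrite integral_cst//= lebesgue_measure_itv/= lte_fin ifT; last by lra.
rewrite -EFinB -EFinM lee_fin.
have -> : s / 2 - - (s / 2) = s by field.
rewrite /normal_peak -mulrnAr sqrtrM ?sqr_ge0// sqrtr_sqr gtr0_norm//.
rewrite invfM mulrAC mulVf ?gt_eqF// mul1r.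
rewrite lef_pV2 ?posrE ?sqrtr_gt0//; last by rewrite pmulrn_lgt0// pi_gt0.
have -> : 2 = Num.sqrt 4 :> R.
  have -> : 4 = 2 ^+ 2 :> R by ring.
  by rewrite sqrtr_sqr ger0_norm.
rewrite ler_wsqrtr// -mulr_natr; have := pi_ge2 R; lra.
Qed.

(** At least half of the mass lies at distance [s / 2] or more from the origin. *)
Lemma normal_var_ge (s : R) : 0 < s ->
  ((s ^+ 2 / 8)%:E <= \int[normal_prob 0 s]_x (x ^+ 2)%:E)%E.
Proof.
move=> s0.
set I := `[(- (s / 2))%R, (s / 2)%R]%classic.
have mI : measurable I by exact: measurable_itv.
apply: (@le_trans _ _ (\int[normal_prob 0 s]_x ((s ^+ 2 / 4)%:E * (\1_(~` I) x)%:E))%E); last first.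
  apply: ge0_le_integral => //=.
  - by move=> x _; rewrite -EFinM lee_fin mulr_ge0// divr_ge0 ?sqr_ge0.
  - apply: emeasurable_funM => //; apply/measurable_EFinP.
    by apply: measurable_indic; exact: measurableC.
  - by apply/measurable_EFinP; apply: measurable_funX.
  - move=> x _; rewrite -EFinM lee_fin indicE.
    have [|] := boolP (x \in ~` I); last by rewrite mulr0 sqr_ge0.
    rewrite inE /I /= in_itv/= => /negP; rewrite negb_and -!ltNge mulr1 => H.
    have -> : s ^+ 2 / 4 = (s / 2) ^+ 2 by field.
    rewrite -[x ^+ 2](real_normK (num_real x)) lerXn2r ?nnegrE ?divr_ge0 ?(ltW s0)//.
    by rewrite ler_normr; case/orP: H => /ltW H; apply/orP; [right|left] => //; lra.
rewrite ge0_integralZl//=.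
- rewrite integral_indic//=; last exact: measurableC.
  rewrite setIT probability_setC// -(fineK (fin_num_measure (normal_prob 0 s) _ mI)).
  rewrite -EFinB -EFinM lee_fin.
  have H : fine (normal_prob 0 s I) <= 2^-1.
    by rewrite -lee_fin fineK ?fin_num_measure// normal_center.
  have := sqr_ge0 s; nra.
- by apply/measurable_EFinP; apply: measurable_indic; exact: measurableC.
- by rewrite lee_fin divr_ge0 ?sqr_ge0.
Qed.

End Normal.

(** * Smoothing by second differences of primitives *)

Section Taylor.
Context {R : realType}.
Implicit Types (f g F : R -> R) (x y z L : R).
Notation mu := (@lebesgue_measure R).

Lemma is_derive_conv F g x (a b : R) :
  is_derive x (1 : R) F a -> F = g -> a = b -> is_derive x (1 : R) g b.
Proof. by move=> ? <- <-. Qed.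

(** A function that vanishes on the left is integrable on every left half-line,
    so the integral from minus infinity is a primitive on the whole line. *)
Lemma antiderivative_right f : continuous f -> (forall x, x <= 0 -> f x = 0) ->
  exists F, forall x, is_derive x (1 : R) F (f x).
Proof.
move=> cf f0.
have intf u : mu.-integrable [set` `]-oo, u]] (EFin \o f).
  have I0 : mu.-integrable `[0, Num.max 0 u] (EFin \o f).
    apply: continuous_compact_integrable; first exact: segment_compact.
    exact: continuous_subspaceT.
  have I1 : mu.-integrable setT ((EFin \o f) \_ `[0, Num.max 0 u]).
    by apply: (proj1 (@integrable_mkcond _ _ _ mu _ (EFin \o f) _) I0); exact: measurable_itv.
  have I2 : mu.-integrable `]-oo, u] ((EFin \o f) \_ `[0, Num.max 0 u]).
    exact: integrableS I1.
  apply: eq_integrable I2 => // x.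
  rewrite inE /= in_itv/= => xu; rewrite patchE; case: ifPn => //.
  rewrite notin_setE/= in_itv/= => /negP; rewrite negb_and -!ltNge.
  case/orP => [x0|]; first by rewrite /= f0// ltW.
  by rewrite gt_max => /andP[_]; rewrite ltNge xu.
exists (fun y => \int[mu]_(t in [set` `]-oo, y]]) f t) => x.
have x1 : x < x + 1 by rewrite ltrDl.
have [dF F'] := @continuous_FTC1 R f -oo%O x (x + 1) x1 (intf _) (ltNyr _) (cf x).
apply: DeriveDef; [exact: dF|by rewrite -derive1E].
Qed.

(** Up to a constant, [f] is the sum of a function carried by the right half-line
    and of one carried by the left half-line. *)
Lemma antiderivative f : continuous f ->
  exists F, forall x, is_derive x (1 : R) F (f x).
Proof.
move=> cf.
pose fp x := f (Num.max x 0) - f 0.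
pose fn x := f (- Num.max x 0) - f 0.
have cmax : continuous (fun x : R => Num.max x 0).
  by move=> x; apply: continuous_max; [exact: cvg_id|exact: cvg_cst].
have [F1 dF1] : exists F, forall x, is_derive x (1 : R) F (fp x).
  apply: antiderivative_right => [x|x x0]; last by rewrite /fp (max_idPr x0) subrr.
  apply: cvgB; last exact: cvg_cst.
  by apply: (continuous_comp (f := fun x => Num.max x 0)); [exact: cmax|exact: cf].
have [F2 dF2] : exists F, forall x, is_derive x (1 : R) F (fn x).
  apply: antiderivative_right => [x|x x0]; last by rewrite /fn (max_idPr x0) oppr0 subrr.
  apply: cvgB; last exact: cvg_cst.
  apply: (continuous_comp (f := fun x => - Num.max x 0)); last exact: cf.
  by apply: continuousN; exact: cmax.
exists (fun x => F1 x - F2 (- x) + x * f 0) => x.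
have D2 : is_derive x (1 : R) (fun x => F2 (- x)) (fn (- x) * - 1).
  have dN : is_derive x (1 : R) (fun x : R => - x) (- 1).
    by apply: is_deriveN.
  have := @is_derive1_comp _ F2 (fun x : R => - x) x _ _ (dF2 (- x)) dN.
  by [].
have -> : f x = fp x - fn (- x) * - 1 + f 0.
  rewrite /fp /fn; have [x0|x0] := leP x 0.
    by rewrite (max_idPl _) ?oppr_ge0// opprK; ring.
  by rewrite (max_idPr _) ?oppr0 ?oppr_le0 ?(ltW x0)//; ring.
have D3 : is_derive x (1 : R) (fun x => x * f 0) (f 0).
  have H := @is_deriveM R R id (cst (f 0)) x 1 _ _ (is_derive_id x 1) (is_derive_cst (f 0) x 1).
  have H' : is_derive x (1 : R) (fun x => x * f 0) (x *: 0 + f 0 *: 1) by exact H.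
  by apply: (is_derive_eq H'); rewrite scaler0 add0r; exact: mulr1.
have H := @is_deriveD R R R _ _ x 1 _ _ (@is_deriveB R R R _ _ x 1 _ _ (dF1 x) D2) D3.
by exact H.
Qed.

Lemma derive_bound (G g : R -> R) z c : G 0 = 0 ->
  (forall x, is_derive x (1 : R) G (g x)) -> (forall w, `|w| <= `|z| -> `|g w| <= c) ->
  `|G z| <= c * `|z|.
Proof.
move=> G0 dG gc.
have cG : continuous G.
  by move=> x; apply: differentiable_continuous; apply/derivable1_diffP; exact: ex_derive.
have [z0|z0] := leP 0 z.
  have [w wI] := @MVT_segment _ G g 0 z z0 (fun x _ => dG x) (continuous_subspaceT cG).
  rewrite G0 !subr0 => ->; rewrite normrM ler_wpM2r// gc//.
  by move: wI; rewrite in_itv/= => /andP[? ?]; rewrite !ger0_norm.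
have [w wI] := @MVT_segment _ G g z 0 (ltW z0) (fun x _ => dG x) (continuous_subspaceT cG).
rewrite G0 !sub0r => GE; rewrite -normrN GE mulrN normrN normrM ler_wpM2r// gc//.
move: wI; rewrite in_itv/= => /andP[? w0]; rewrite ler0_norm// ltr0_norm//; lra.
Qed.

(** A second-order expansion with uniform cubic remainder. Unlike a bound on
    derivatives, it is visibly preserved by translations and by convex
    combinations, hence by [walk_step]. *)
Definition taylor3 C f f1 f2 := forall x z,
  `|f (x + z) - f x - z * f1 x - z ^+ 2 / 2 * f2 x| <= C * `|z| ^+ 3.

Lemma taylor_second_primitive f F1 F2 L : 0 <= L ->
  (forall x y, `|f x - f y| <= L * `|x - y|) ->
  (forall x, is_derive x (1 : R) F1 (f x)) ->
  (forall x, is_derive x (1 : R) F2 (F1 x)) -> taylor3 L F2 F1 f.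
Proof.
move=> L0 fL dF1 dF2 x z.
have dshift (F g : R -> R) w : (forall x, is_derive x (1 : R) F (g x)) ->
    is_derive w (1 : R) (fun v => F (x + v)) (g (x + w)).
  move=> dF.
  have dS : is_derive w (1 : R) (fun v : R => x + v) 1.
    have H := @is_deriveD R R R (cst x) id w 1 _ _ (is_derive_cst x w 1) (is_derive_id w 1).
    by apply: (is_derive_conv H erefl); rewrite add0r.
  have H := @is_derive1_comp R F (fun v => x + v) w _ _ (dF (x + w)) dS.
  by apply: (is_derive_conv H erefl); rewrite mulr1.
have dlin (a w : R) : is_derive w (1 : R) (fun v => v * a) a.
  have H := @is_deriveM R R id (cst a) w 1 _ _ (is_derive_id w 1) (is_derive_cst a w 1).
  have H' : is_derive w (1 : R) (fun v => v * a) (w *: 0 + a *: 1) by exact H.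
  by apply: (is_derive_eq H'); rewrite scaler0 add0r; exact: mulr1.
have dquad (a w : R) : is_derive w (1 : R) (fun v => v ^+ 2 / 2 * a) (w * a).
  have H := @is_deriveM R R id id w 1 _ _ (is_derive_id w 1) (is_derive_id w 1).
  have H2 := @is_deriveM R R _ (cst (a / 2)) w 1 _ _ H (is_derive_cst (a / 2) w 1).
  have E : (fun v => v ^+ 2 / 2 * a) = (id * id) * cst (a / 2) :> (R -> R).
    by apply/funext => y; rewrite !fctE /=; field.
  by rewrite E; apply: (is_derive_eq H2); rewrite scaler0 add0r /= /GRing.scale/= !mulr1; field.
pose G1 w := F1 (x + w) - F1 x - w * f x.
have dG1 w : is_derive w (1 : R) G1 (f (x + w) - f x).
  have H := @is_deriveB R R R _ _ w 1 _ _ (@is_deriveB R R R _ _ w 1 _ _ (dshift _ _ w dF1) (is_derive_cst (F1 x) w 1)) (dlin (f x) w).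
  by apply: (is_derive_conv H erefl); rewrite subr0.
pose G2 w := F2 (x + w) - F2 x - w * F1 x - w ^+ 2 / 2 * f x.
have dG2 w : is_derive w (1 : R) G2 (G1 w).
  have H := @is_deriveB R R R _ _ w 1 _ _ (@is_deriveB R R R _ _ w 1 _ _ (@is_deriveB R R R _ _ w 1 _ _ (dshift _ _ w dF2) (is_derive_cst (F2 x) w 1)) (dlin (F1 x) w)) (dquad (f x) w).
  by apply: (is_derive_conv H erefl); rewrite subr0.
have B1 w : `|w| <= `|z| -> `|G1 w| <= L * `|z| ^+ 2.
  move=> wz; apply: (@le_trans _ _ (L * `|w| * `|w|)).
    apply: (derive_bound (g := fun v => f (x + v) - f x)) => //.
      by rewrite /G1 addr0 mul0r !subrr.
    move=> y yw; apply: (le_trans (fL _ _)).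
    by rewrite [x + y]addrC addrK ler_wpM2l.
  by rewrite -mulrA -expr2 ler_wpM2l// lerXn2r// nnegrE.
have -> : L * `|z| ^+ 3 = L * `|z| ^+ 2 * `|z| by ring.
apply: (derive_bound (G := G2) (g := G1)) => //.
by rewrite /G2 addr0 expr0n/= !mul0r !subrr.
Qed.

Lemma derivable_continuous F f : (forall x, is_derive x (1 : R) F (f x)) -> continuous F.
Proof.
move=> dF x; apply: differentiable_continuous; apply/derivable1_diffP.
exact: ex_derive.
Qed.

Lemma lipschitz_continuous f L :
  (forall x y, `|f x - f y| <= L * `|x - y|) -> continuous f.
Proof.
move=> fL x; apply/cvgrPdist_le => e e0.
have M0 : 0 < `|L| + 1 by rewrite ltr_wpDl.
near=> y.
apply: (le_trans (fL _ _)); apply: (@le_trans _ _ ((`|L| + 1) * `|x - y|)).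
  by rewrite ler_wpM2r// (le_trans (ler_norm _))// lerDl.
rewrite mulrC -ler_pdivlMr//.
near: y; apply: cvgr_dist_le; first exact: cvg_id.
exact: divr_gt0.
Unshelve. all: by end_near. Qed.

Lemma taylor3_comb C1 C2 (a b : R) f f1 f2 g g1 g2 :
  taylor3 C1 f f1 f2 -> taylor3 C2 g g1 g2 ->
  taylor3 (`|a| * C1 + `|b| * C2) (fun x => a * f x + b * g x)
    (fun x => a * f1 x + b * g1 x) (fun x => a * f2 x + b * g2 x).
Proof.
move=> tf tg x z.
have -> : a * f (x + z) + b * g (x + z) - (a * f x + b * g x) -
   z * (a * f1 x + b * g1 x) - z ^+ 2 / 2 * (a * f2 x + b * g2 x) =
   a * (f (x + z) - f x - z * f1 x - z ^+ 2 / 2 * f2 x) +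
   b * (g (x + z) - g x - z * g1 x - z ^+ 2 / 2 * g2 x) by ring.
apply: (le_trans (ler_normD _ _)); rewrite !normrM [leRHS]mulrDl.
by apply: lerD; rewrite -[leRHS]mulrA; apply: ler_wpM2l.
Qed.

Lemma taylor3_shift C c f f1 f2 : taylor3 C f f1 f2 ->
  taylor3 C (fun x => f (x + c)) (fun x => f1 (x + c)) (fun x => f2 (x + c)).
Proof. by move=> tf x z /=; rewrite (addrAC x z c); exact: tf. Qed.

Lemma taylor3_walk_step p h C f f1 f2 : 0 <= p <= 1 -> taylor3 C f f1 f2 ->
  taylor3 C (walk_step p h f) (walk_step p h f1) (walk_step p h f2).
Proof.
move=> /andP[p0 p1] tf.
have := taylor3_comb p (1 - p) (taylor3_shift h tf) (taylor3_shift (- h) tf).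
by rewrite ger0_norm// ger0_norm ?subr_ge0// -mulrDl subrKC mul1r.
Qed.

(** Divided by [e ^+ 2] and applied to a second primitive of [f], this is the
    convolution of [f] with a triangular kernel of width [2 * e]. *)
Definition diff2 e f x := f (x + e + e) - 2 * f (x + e) + f x.

Lemma smooth_approx L f e : 0 < e -> unit_lip L f ->
  exists g g1 g2, [/\ continuous g, forall x, 0 <= g x <= 1, taylor3 (4 * L / e ^+ 2) g g1 g2,
    forall x, `|g x - f x| <= 10 * L * e & forall x, `|g2 x| <= 2 / e ^+ 2].
Proof.
move=> e0 [L0 f01 fL].
have [F1 dF1] := antiderivative (lipschitz_continuous fL).
have [F2 dF2] := antiderivative (derivable_continuous dF1).
have T := taylor_second_primitive L0 fL dF1 dF2.
have e2 : 0 < e ^+ 2 by rewrite exprn_gt0.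
have cF2 := derivable_continuous dF2.
exists (fun x => diff2 e F2 x / e ^+ 2), (fun x => diff2 e F1 x / e ^+ 2),
  (fun x => diff2 e f x / e ^+ 2); split.
- move=> x; apply: cvgM; last exact: cvg_cst.
  have cs c : {for x, continuous (fun x => F2 (x + c))}.
    apply: (@continuous_comp _ _ _ (fun x => x + c)); last exact: cF2.
    by apply: cvgD; [exact: cvg_id|exact: cvg_cst].
  apply: cvgD; last exact: cF2.
  apply: cvgB.
    have -> : (fun y => F2 (y + e + e)) = (fun y => F2 (y + (e + e))).
      by apply/funext => y; rewrite addrA.
    by rewrite -(addrA x e e); exact: cs.
  by apply: cvgM; [exact: cvg_cst|exact: cs].
- move=> x.
  pose phi y := F2 (y + e) - F2 y.
  have dphi y : is_derive y (1 : R) phi (F1 (y + e) - F1 y).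
    have dS : is_derive y (1 : R) (fun v : R => v + e) 1.
      have H := @is_deriveD R R R id (cst e) y 1 _ _ (is_derive_id y 1) (is_derive_cst e y 1).
      by apply: (is_derive_conv H erefl); rewrite addr0.
    have H := @is_derive1_comp R F2 (fun v => v + e) y _ _ (dF2 (y + e)) dS.
    have H' := @is_deriveB R R R _ _ y 1 _ _ H (dF2 y).
    by apply: (is_derive_conv H' erefl); rewrite mulr1.
  have xe y : y <= y + e by rewrite lerDl ltW.
  have [u _ uE] := @MVT_segment _ phi _ x (x + e) (xe x) (fun y _ => dphi y)
    (continuous_subspaceT (derivable_continuous dphi)).
  have [v _ vE] := @MVT_segment _ F1 f u (u + e) (xe u) (fun y _ => dF1 y)
    (continuous_subspaceT (derivable_continuous dF1)).
  have -> : diff2 e F2 x / e ^+ 2 = f v.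
    have -> : diff2 e F2 x = phi (x + e) - phi x by rewrite /diff2 /phi; ring.
    by rewrite uE vE; field; rewrite gt_eqF.
  exact: f01.
- have T1 := taylor3_comb (- 2) 1 (taylor3_shift e T) T.
  have T2 := taylor3_comb 1 1 (taylor3_shift (e + e) T) T1.
  have T3 := taylor3_comb (e ^+ 2)^-1 0 T2 T.
  move=> x z; have := T3 x z.
  rewrite !normr0 !mul0r !addr0 normr1 normrN !normr_nat !mul1r.
  rewrite (gtr0_norm (_ : 0 < (e ^+ 2)^-1)) ?invr_gt0//.
  have -> : (e ^+ 2)^-1 * (L + (2 * L + L)) = 4 * L / e ^+ 2 by ring.
  apply: le_trans; rewrite le_eqVlt; apply/orP; left; apply/eqP; congr `|_|.
  by rewrite /diff2 !addrA; ring.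
- move=> x.
  have -> : diff2 e F2 x / e ^+ 2 - f x =
     ((F2 (x + (e + e)) - F2 x - (e + e) * F1 x - (e + e) ^+ 2 / 2 * f x)
     - 2 * (F2 (x + e) - F2 x - e * F1 x - e ^+ 2 / 2 * f x)) / e ^+ 2.
    by rewrite /diff2 !addrA; field; rewrite gt_eqF.
  rewrite normrM (gtr0_norm (_ : 0 < (e ^+ 2)^-1)) ?invr_gt0// ler_pdivrMr//.
  apply: (le_trans (ler_normB _ _)); rewrite normrM normr_nat.
  have := T x (e + e); have := T x e.
  rewrite (gtr0_norm e0) (gtr0_norm (addr_gt0 e0 e0)) => H1 H2.
  have -> : 10 * L * e * e ^+ 2 = L * (e + e) ^+ 3 + 2 * (L * e ^+ 3) by ring.
  by apply: lerD => //; rewrite ler_wpM2l.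
- move=> x; rewrite normrM (gtr0_norm (_ : 0 < (e ^+ 2)^-1)) ?invr_gt0//.
  rewrite ler_wpM2r ?invr_ge0 ?(ltW e2)// /diff2 ler_norml.
  have /andP[? ?] := f01 (x + e + e); have /andP[? ?] := f01 (x + e).
  by have /andP[? ?] := f01 x; apply/andP; split; lra.
Qed.

End Taylor.

(** * Freezing the past *)

Section UnitExpectation.
Context {R : realType} d (T : measurableType d) (P : probability T R).
Implicit Types f g : T -> R.

Lemma fine_setT : fine (P setT) = 1.
Proof. by have -> : P setT = 1%E by exact: probability_setT. Qed.

Lemma unit_integrable f : measurable_fun setT f -> (forall w, 0 <= f w <= 1) ->
  P.-integrable setT (EFin \o f).
Proof.
move=> mf f01; apply: measurable_bounded_integrable => //.
  by rewrite /= probability_setT ltry.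
exists 1; split; first exact: num_real.
move=> x x1 w _; have /andP[? ?] := f01 w.
by rewrite /= ger0_norm// (le_trans _ (ltW x1)).
Qed.

Lemma unit_Rintegral f : measurable_fun setT f -> (forall w, 0 <= f w <= 1) ->
  0 <= \int[P]_w f w <= 1.
Proof.
move=> mf f01; apply/andP; split.
  by apply: Rintegral_ge0 => w _; have /andP[] := f01 w.
have -> : 1 = \int[P]_w (cst 1 w) :> R.
  by rewrite Rintegral_cst// fine_setT mulr1.
apply: le_Rintegral => //; [exact: unit_integrable| |].
  by apply: unit_integrable => // w; rewrite ler01 lexx.
by move=> w _; have /andP[] := f01 w.
Qed.

Lemma unit_Rintegral_dist f g e :
  measurable_fun setT f -> (forall w, 0 <= f w <= 1) ->
  measurable_fun setT g -> (forall w, 0 <= g w <= 1) ->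
  (forall w, `|f w - g w| <= e) -> `|\int[P]_w f w - \int[P]_w g w| <= e.
Proof.
move=> mf f01 mg g01 H.
have iF := unit_integrable mf f01; have ig := unit_integrable mg g01.
rewrite -RintegralB//.
have iB : P.-integrable setT (EFin \o (fun w => f w - g w)).
  by have := integrableB measurableT iF ig; apply: eq_integrable.
apply: (le_trans (le_normr_Rintegral _ _)) => //.
have -> : e = \int[P]_w (cst e w) by rewrite Rintegral_cst// fine_setT mulr1.
apply: le_Rintegral => //.
- exact: (integrable_norm iB).
- exact: finite_measure_integrable_cst.
Qed.

End UnitExpectation.

(** [G] is a pi-system of events, the past, and [D] is a random variable of law
    [nu] that is independent of it. *)
Section Freeze.
Context {R : realType} d (T : measurableType d) (P : probability T R).
Variables (G : set (set T)).
Hypotheses (mG : G `<=` measurable) (GI : setI_closed G) (GT : G setT).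
Let TG := g_sigma_algebraType G.

Lemma sigma_sub_measurable : <<s G >> `<=` (@measurable _ T).
Proof. by apply: smallest_sub; [exact: sigma_algebra_measurable|exact: mG]. Qed.

Lemma past_measurable d' (U : measurableType d') (f : T -> U) :
  measurable_fun (setT : set TG) (f : TG -> U) -> measurable_fun setT f.
Proof. by move=> mf _ B mB; apply: sigma_sub_measurable; exact: mf. Qed.

Variables (D : T -> R) (nu : probability (measurableTypeR R) R).
Hypotheses (mD : measurable_fun setT D)
  (Dnu : forall A : set R, measurable A -> P (D @^-1` A) = nu A)
  (GD : forall S (A : set R), G S -> measurable A ->
     P (S `&` D @^-1` A) = (P S * P (D @^-1` A))%E).

Lemma independent_sigma S (A : set R) : <<s G >> S -> measurable A ->
  P (S `&` D @^-1` A) = (P S * P (D @^-1` A))%E.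
Proof.
move=> GS mA.
have mE : measurable (D @^-1` A) by rewrite -[D @^-1` A]setTI; exact: mD.
have c0 : (0 <= fine (P (D @^-1` A)))%R by apply: fine_ge0; exact: measure_ge0.
have : mrestr P mE S = mscale (NngNum c0) P S.
  apply: (@g_sigma_algebra_measure_unique _ R T G mG (fun=> setT) (fun=> GT) _
   (mrestr P mE) (mscale (NngNum c0) P) GI) => //.
  - by rewrite bigcup_const//; exists 0%N.
  - move=> B GB.
    change (P (B `&` D @^-1` A) = (fine (P (D @^-1` A)))%:E * P B)%E.
    by rewrite fineK ?fin_num_measure// muleC; exact: GD.
  - move=> k; change (P (setT `&` D @^-1` A) < +oo)%E.
    by rewrite ltey_eq fin_num_measure//; exact: measurableI.
move=> E; change (mrestr P mE S = P S * P (D @^-1` A))%E; rewrite E.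
change ((fine (P (D @^-1` A)))%:E * P S = P S * P (D @^-1` A))%E.
by rewrite fineK ?fin_num_measure// muleC.
Qed.

Local Open Scope ereal_scope.

(** The law of the pair formed by the outcome, seen through the past, and [D] is
    the product of its marginals; Tonelli's theorem then applies. *)
Lemma freeze (Phi : T -> R -> R) :
  measurable_fun setT (fun z : TG * measurableTypeR R => Phi z.1 z.2) ->
  (forall w z, (0 <= Phi w z)%R) ->
  \int[P]_w (Phi w (D w))%:E = \int[P]_w \int[nu]_z (Phi w z)%:E.
Proof.
move=> mPhi Phi0.
have mid : measurable_fun setT (idfun : T -> TG).
  by move=> _ B mB; rewrite setTI; exact: sigma_sub_measurable.
pose idT : {mfun T >-> TG} := HB.pack (idfun : T -> TG) (isMeasurableFun.Build _ _ _ _ _ mid).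
have mpair : measurable_fun setT (fun w => (w, D w) : TG * measurableTypeR R).
  exact: measurable_fun_pair.
pose X : {mfun T >-> (TG * measurableTypeR R)%type} :=
  HB.pack (fun w => (w, D w) : TG * measurableTypeR R) (isMeasurableFun.Build _ _ _ _ _ mpair).
pose PG := distribution P idT.
have E (Z : set (TG * measurableTypeR R)) : measurable Z -> (PG \x nu) Z = distribution P X Z.
  apply: product_measure_unique => B C mB mC.
  change (P (B `&` D @^-1` C) = P B * nu C).
  by rewrite independent_sigma// Dnu.
pose f (z : TG * measurableTypeR R) := (Phi z.1 z.2)%:E.
have mf : measurable_fun setT f by exact/measurable_EFinP.
have f0 z : 0 <= f z by rewrite lee_fin.
transitivity (\int[distribution P X]_z f z).
  by rewrite ge0_integral_distribution.
transitivity (\int[PG \x nu]_z f z).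
  by apply: eq_measure_integral => Z mZ _; symmetry; exact: E.
rewrite fubini_tonelli1// /PG ge0_integral_distribution//.
- exact: measurable_fun_fubini_tonelli_F.
- by move=> x; apply: integral_ge0.
Qed.

Local Close Scope ereal_scope.

(** The form used below: an approximation of the inner integral, uniform in the
    past, gives an approximation of the expectation. *)
Lemma freeze_approx (Phi : T -> R -> R) (u : T -> R) e :
  measurable_fun setT (fun z : TG * measurableTypeR R => Phi z.1 z.2) ->
  (forall w z, 0 <= Phi w z <= 1) ->
  measurable_fun setT u -> (forall w, 0 <= u w <= 1) ->
  (forall w, `|\int[nu]_z Phi w z - u w| <= e) ->
  `|\int[P]_w Phi w (D w) - \int[P]_w u w| <= e.
Proof.
move=> mPhi Phi01 mu u01 H.
have Phi0 w z : 0 <= Phi w z by have /andP[] := Phi01 w z.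
pose f (z : TG * measurableTypeR R) := (Phi z.1 z.2)%:E.
have mf : measurable_fun setT f by exact/measurable_EFinP.
have f0 z : (0 <= f z)%E by rewrite lee_fin.
have m_sec w : measurable_fun setT (Phi w).
  have Hw := measurableT_comp mPhi (@pair1_measurable _ _ TG (measurableTypeR R) w).
  by exact Hw.
have -> : \int[P]_w Phi w (D w) = \int[P]_w \int[nu]_z Phi w z.
  rewrite /Rintegral freeze//; congr (fine _); apply: eq_integral => w _.
  rewrite fineK//; apply: integrable_fin_num => //.
  have H1 := @unit_integrable R _ (measurableTypeR R) nu (Phi w) (m_sec w) (Phi01 w). exact H1.
have mv : measurable_fun setT (fun w => \int[nu]_z Phi w z).
  apply: past_measurable; apply: measurableT_comp => //.
  exact: (@measurable_fun_fubini_tonelli_F _ _ TG (measurableTypeR R) R nu f mf f0).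
apply: unit_Rintegral_dist => //.
by move=> w; have H1 := @unit_Rintegral R _ (measurableTypeR R) nu (Phi w) (m_sec w) (Phi01 w); exact H1.
Qed.

End Freeze.

(** * Replacing Gaussian increments by walk steps *)

Section Moments.
Context {R : realType}.
Implicit Types (nu : probability (measurableTypeR R) R).

(** The variance is kept as a parameter: the scale of the walk is fitted to it,
    so that its exact value does not matter. *)
Definition moments nu v k :=
  [/\ nu.-integrable setT (fun z : measurableTypeR R => (`|z| ^+ 3)%:E),
      \int[nu]_z (z : R) = 0, \int[nu]_z ((z : R) ^+ 2) = v
    & \int[nu]_z (`|z : R| ^+ 3) <= k].

Lemma moments_integrable nu v k (f : measurableTypeR R -> R) : moments nu v k ->
  measurable_fun setT f -> (forall z, `|f z| <= 1 + `|z| ^+ 3) ->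
  nu.-integrable setT (EFin \o f).
Proof.
move=> [i3 _ _ _] mf H.
have I : nu.-integrable setT (fun z : measurableTypeR R => (1 + `|z| ^+ 3)%:E).
  have := integrableD measurableT (finite_measure_integrable_cst nu 1 measurableT) i3.
  by apply: eq_integrable.
apply: (le_integrable measurableT _ _ I).
  exact/measurable_EFinP.
by move=> z _; rewrite /= lee_fin (le_trans (H z))// ler_norm.
Qed.

Lemma cube_ge (a : R) : 0 <= a -> a <= 1 + a ^+ 3 /\ a ^+ 2 <= 1 + a ^+ 3.
Proof.
move=> a0; have [a1|a1] := leP a 1.
  have : 0 <= a ^+ 3 by rewrite exprn_ge0.
  have : a ^+ 2 <= 1 by rewrite exprn_ile1.
  by move=> ? ?; split; lra.
have H : a <= a ^+ 2 by rewrite expr2 ler_peMr// ltW.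
have H' : a ^+ 2 <= a ^+ 3 by rewrite [leRHS]exprSr ler_peMr ?exprn_ge0// ltW.
by split; lra.
Qed.

Lemma moments_quadratic nu v k (a b c : R) : moments nu v k ->
  nu.-integrable setT (EFin \o (fun z : measurableTypeR R => a + z * b + z ^+ 2 * c)) /\
  \int[nu]_z (a + z * b + z ^+ 2 * c) = a + v * c.
Proof.
move=> mo; have [i3 m0 mv _] := mo.
have i1 : nu.-integrable setT (EFin \o (fun z : measurableTypeR R => z : R)).
  apply: (moments_integrable mo) => // z.
  by have [] := cube_ge (normr_ge0 (z : R)).
have i2 : nu.-integrable setT (EFin \o (fun z : measurableTypeR R => (z : R) ^+ 2)).
  apply: (moments_integrable mo) => [|z].
    by apply: measurable_funX.
  by have [_] := cube_ge (normr_ge0 (z : R)); rewrite normrX.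
have ia : nu.-integrable setT (EFin \o (fun _ : measurableTypeR R => a)).
  exact: finite_measure_integrable_cst.
have i1b : nu.-integrable setT (EFin \o (fun z : measurableTypeR R => (z : R) * b)).
  by have := integrableZr measurableT b i1; apply: eq_integrable.
have i2c : nu.-integrable setT (EFin \o (fun z : measurableTypeR R => (z : R) ^+ 2 * c)).
  by have := integrableZr measurableT c i2; apply: eq_integrable.
have iab : nu.-integrable setT (EFin \o (fun z : measurableTypeR R => a + (z : R) * b)).
  by have := integrableD measurableT ia i1b; apply: eq_integrable.
split; first by have := integrableD measurableT iab i2c; apply: eq_integrable.
rewrite RintegralD// RintegralD//.
rewrite !RintegralZr// m0 mv mul0r addr0; congr (_ + _).
rewrite Rintegral_cst// -[RHS]mulr1; congr (_ * _); exact: (fine_setT nu).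
Qed.

(** The variance lies between [s ^+ 2 / 8] and [33 * s ^+ 2]; since [h] is the
    square root of the variance, this is enough to compare the step [h] of the
    walk with [s]. *)
Lemma normal_moments (s : R) : 0 < s -> exists v,
  [/\ moments (normal_prob 0 s) v (32 * s ^+ 3), s ^+ 2 / 8 <= v & v <= 33 * s ^+ 2].
Proof.
move=> s0.
pose nu : probability (measurableTypeR R) R := normal_prob 0 s.
have m3 : measurable_fun setT (fun z : measurableTypeR R => `|z| ^+ 3 : R).
  by apply: measurable_funX; exact: normr_measurable.
have M3 := normal_moment3 s0.
have i3 : nu.-integrable setT (fun z : measurableTypeR R => (`|z| ^+ 3)%:E).
  apply/integrableP; split; first exact/measurable_EFinP.
  under eq_integral do rewrite gee0_abs ?lee_fin ?exprn_ge0//.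
  by apply: (le_lt_trans M3); rewrite ltry.
have R3 : \int[nu]_z (`|z : R| ^+ 3) <= 32 * s ^+ 3.
  by rewrite -lee_fin /Rintegral fineK// integrable_fin_num.
have imax (f : R -> R) : measurable_fun setT f -> (forall z, `|f z| <= `|z|) ->
    nu.-integrable setT (EFin \o (fun z : measurableTypeR R => f z)).
  move=> mf fz.
  have I : nu.-integrable setT (fun z : measurableTypeR R => (1 + `|z| ^+ 3)%:E).
    have := integrableD measurableT (finite_measure_integrable_cst nu 1 measurableT) i3.
    by apply: eq_integrable.
  apply: (le_integrable measurableT _ _ I); first exact/measurable_EFinP.
  move=> z _; rewrite /= lee_fin (le_trans (fz z))//.
  by have [H _] := cube_ge (normr_ge0 (z : R)); rewrite (le_trans H)// ler_norm.
have m0 : \int[nu]_z (z : R) = 0.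
  have -> : \int[nu]_z (z : R) = \int[nu]_z (Num.max (z : R) 0 - Num.max (- (z : R)) 0).
    apply: eq_Rintegral => z _; have [z0|z0] := leP (z : R) 0.
      by rewrite (max_idPl _) ?oppr_ge0// sub0r opprK.
    by rewrite (max_idPr _) ?subr0// oppr_le0 ltW.
  rewrite RintegralB//.
  - by rewrite /Rintegral normal_mean ?subrr// gt_eqF.
  - apply: (imax (fun z => Num.max z 0)).
      exact: measurable_maxr.
    move=> z; have [z0|z0] := leP z 0; first by rewrite normr0.
    by [].
  - apply: (imax (fun z => Num.max (- z) 0)).
      by apply: measurable_maxr.
    move=> z; have [z0|z0] := leP (- z) 0; first by rewrite normr0.
    by rewrite normrN.
have mo : moments nu (\int[nu]_z ((z : R) ^+ 2)) (32 * s ^+ 3) by split.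
have i2 : nu.-integrable setT (EFin \o (fun z : measurableTypeR R => (z : R) ^+ 2)).
  apply: (moments_integrable mo) => [|z].
    by apply: measurable_funX.
  by have [_] := cube_ge (normr_ge0 (z : R)); rewrite normrX.
exists (\int[nu]_z ((z : R) ^+ 2)); split => //.
  by rewrite -lee_fin /Rintegral fineK; [exact: normal_var_ge|exact: integrable_fin_num].
have ia : nu.-integrable setT (EFin \o (fun _ : measurableTypeR R => s ^+ 2)).
  exact: finite_measure_integrable_cst.
have ic : nu.-integrable setT (EFin \o (fun z : measurableTypeR R => `|z| ^+ 3 / s)).
  by have := integrableZr measurableT (s^-1) i3; apply: eq_integrable.
apply: (@le_trans _ _ (\int[nu]_z (s ^+ 2 + `|z : R| ^+ 3 / s))).
  apply: le_Rintegral => //.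
    by have := integrableD measurableT ia ic; apply: eq_integrable.
  move=> z _; rewrite -(real_normK (num_real (z : R))).
  rewrite -(ler_pM2r s0) mulrDl divfK ?gt_eqF//.
  set a := `|_|; have a0 : 0 <= a by exact: normr_ge0.
  have [as_|sa] := leP a s.
    have H : a ^+ 2 <= s ^+ 2 by rewrite lerXn2r// nnegrE ltW.
    by rewrite ler_wpDr ?exprn_ge0// ler_wpM2r// ltW.
  rewrite ler_wpDl ?mulr_ge0 ?exprn_ge0 ?(ltW s0)//.
  by rewrite [leRHS]exprSr ler_wpM2l ?exprn_ge0// ltW.
have E1 : fine (nu setT) = 1 by exact: (fine_setT nu).
have E2 : \int[nu]_z (s ^+ 2) = s ^+ 2.
  by rewrite Rintegral_cst// -[RHS]mulr1; congr (_ * _).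
have E3 : \int[nu]_z (`|z : R| ^+ 3 / s) = \int[nu]_z (`|z : R| ^+ 3) / s.
  by rewrite RintegralZr.
rewrite RintegralD// E2 E3.
have : \int[nu]_z (`|z : R| ^+ 3) / s <= 32 * s ^+ 2.
  by rewrite ler_pdivrMr// -mulrA -exprSr.
by lra.
Qed.

End Moments.

Section OneStep.
Context {R : realType}.
Implicit Types (nu : probability (measurableTypeR R) R).

Lemma cube_normD (a b : R) : `|a + b| ^+ 3 <= 4 * (`|a| ^+ 3 + `|b| ^+ 3).
Proof.
apply: (@le_trans _ _ ((`|a| + `|b|) ^+ 3)).
  by rewrite lerXn2r ?nnegrE ?addr_ge0// ler_normD.
rewrite -subr_ge0.
have -> : 4 * (`|a| ^+ 3 + `|b| ^+ 3) - (`|a| + `|b|) ^+ 3 =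
  3 * ((`|a| + `|b|) * (`|a| - `|b|) ^+ 2) by ring.
by rewrite mulr_ge0// mulr_ge0 ?sqr_ge0// addr_ge0.
Qed.

(** Both sides are computed from the expansion of [G] at [x]: the laws of the
    drifted increment and of the walk step have the same mean, and their second
    moments differ by [c ^+ 2]. *)
Lemma one_step nu v k C (G G1 G2 : R -> R) c h p K2 x : moments nu v k ->
  continuous G -> (forall x, 0 <= G x <= 1) -> taylor3 C G G1 G2 -> 0 <= C ->
  (forall x, `|G2 x| <= K2) -> 0 <= h -> h ^+ 2 = v -> (2 * p - 1) * h = c ->
  0 <= p <= 1 ->
  `|\int[nu]_z G (x + ((z : R) + c)) - walk_step p h G x| <=
    c ^+ 2 / 2 * K2 + C * (4 * `|c| ^+ 3 + 4 * k + h ^+ 3).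
Proof.
move=> mo cG G01 tG C0 G2K h0 hv hc /andP[p0 p1].
have [i3 _ _ k3] := mo.
pose a := G x + c * G1 x + c ^+ 2 / 2 * G2 x.
pose b := G1 x + c * G2 x.
have [iQ EQ] := moments_quadratic a b (G2 x / 2) mo.
have mGx : measurable_fun setT (fun z : measurableTypeR R => G (x + ((z : R) + c))).
  apply: (measurableT_comp (continuous_measurable_fun cG)).
  by apply: measurable_funD => //; apply: measurable_funD.
have iG : nu.-integrable setT (EFin \o (fun z : measurableTypeR R => G (x + ((z : R) + c)))).
  by have H := @unit_integrable R _ (measurableTypeR R) nu _ mGx (fun=> G01 _); exact H.
have B1 : `|\int[nu]_z G (x + ((z : R) + c)) - (a + v * (G2 x / 2))| <=
    C * (4 * `|c| ^+ 3 + 4 * k).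
  rewrite -EQ -RintegralB//.
  have iB : nu.-integrable setT (EFin \o (fun z : measurableTypeR R =>
      G (x + ((z : R) + c)) - (a + z * b + z ^+ 2 * (G2 x / 2)))).
    by have := integrableB measurableT iG iQ; apply: eq_integrable.
  apply: (le_trans (le_normr_Rintegral _ _)) => //.
  have ic : nu.-integrable setT (EFin \o (fun _ : measurableTypeR R => C * (4 * `|c| ^+ 3))).
    exact: finite_measure_integrable_cst.
  have i4 : nu.-integrable setT (EFin \o (fun z : measurableTypeR R => 4 * C * `|z| ^+ 3)).
    by have := integrableZl measurableT (4 * C) i3; apply: eq_integrable.
  have i5 : nu.-integrable setT (EFin \o (fun z : measurableTypeR R =>
      C * (4 * `|c| ^+ 3) + 4 * C * `|z| ^+ 3)).
    by have := integrableD measurableT ic i4; apply: eq_integrable.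
  apply: (@le_trans _ _ (\int[nu]_z (C * (4 * `|c| ^+ 3) + 4 * C * `|z : R| ^+ 3))).
    apply: le_Rintegral => //; first exact: (integrable_norm iB).
    move=> z _.
    have -> : G (x + ((z : R) + c)) - (a + z * b + z ^+ 2 * (G2 x / 2)) =
      G (x + (z + c)) - G x - (z + c) * G1 x - (z + c) ^+ 2 / 2 * G2 x.
      by rewrite /a /b; field.
    apply: (le_trans (tG x _)).
    have -> : C * (4 * `|c| ^+ 3) + 4 * C * `|z| ^+ 3 = C * (4 * (`|z| ^+ 3 + `|c| ^+ 3)).
      by ring.
    by rewrite ler_wpM2l// cube_normD.
  have -> : \int[nu]_z (C * (4 * `|c| ^+ 3) + 4 * C * `|z : R| ^+ 3) =
      C * (4 * `|c| ^+ 3) + 4 * C * \int[nu]_z (`|z : R| ^+ 3).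
    rewrite RintegralD//; congr (_ + _); last by rewrite RintegralZl.
    by rewrite Rintegral_cst// -[RHS]mulr1; congr (_ * _); exact: (fine_setT nu).
  rewrite mulrDr lerD2l.
  have -> : C * (4 * k) = 4 * C * k by ring.
  by rewrite ler_wpM2l// mulr_ge0.
have B2 : `|G x + c * G1 x + v / 2 * G2 x - walk_step p h G x| <= C * h ^+ 3.
  have H1 := tG x h; have H2 := tG x (- h).
  rewrite normrN (ger0_norm h0) in H1 H2.
  have -> : G x + c * G1 x + v / 2 * G2 x - walk_step p h G x =
    - (p * (G (x + h) - G x - h * G1 x - h ^+ 2 / 2 * G2 x)
    + (1 - p) * (G (x - h) - G x - (- h) * G1 x - (- h) ^+ 2 / 2 * G2 x)).
    by rewrite /walk_step -hv -hc; field.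
  rewrite normrN; apply: (le_trans (ler_normD _ _)).
  rewrite !normrM (ger0_norm p0) (@ger0_norm _ (1 - p)) ?subr_ge0//.
  have -> : C * h ^+ 3 = p * (C * h ^+ 3) + (1 - p) * (C * h ^+ 3) by ring.
  by apply: lerD; rewrite ler_wpM2l// subr_ge0.
have B3 : `|c ^+ 2 / 2 * G2 x| <= c ^+ 2 / 2 * K2.
  by rewrite normrM ger0_norm ?divr_ge0 ?sqr_ge0// ler_wpM2l// divr_ge0 ?sqr_ge0.
have -> : \int[nu]_z G (x + ((z : R) + c)) - walk_step p h G x =
  (\int[nu]_z G (x + ((z : R) + c)) - (a + v * (G2 x / 2)))
  + (G x + c * G1 x + v / 2 * G2 x - walk_step p h G x) + c ^+ 2 / 2 * G2 x.
  by rewrite /a; ring.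
apply: (le_trans (ler_normD _ _)); rewrite addrC lerD//.
by apply: (le_trans (ler_normD _ _)); rewrite (mulrDr C) lerD.
Qed.

End OneStep.

Section IndependentSequence.
Context {R : realType} d (T : measurableType d) (P : probability T R).
Variables (D : nat -> T -> R) (nu : probability (measurableTypeR R) R).
Hypotheses (mD : forall j, measurable_fun setT (D j))
  (Dnu : forall j (A : set R), measurable A -> P (D j @^-1` A) = nu A)
  (indD : forall n, mutually_independent P (fun i : 'I_n => D i)).

(** The rectangles generating the sigma-algebra of the first [k] variables. *)
Definition past k : set (set T) :=
  [set \bigcap_(i in [set: 'I_k]) (D i @^-1` A i) |
     A in [set A : nat -> set R | forall i, measurable (A i)]].

Lemma past_sub k : past k `<=` measurable.
Proof.
move=> _ [A mA <-]; apply: fin_bigcap_measurable => // i _.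
by rewrite -[X in measurable X]setTI; exact: mD.
Qed.

Lemma past_setI k : setI_closed (past k).
Proof.
move=> _ _ [A mA <-] [B mB <-]; exists (fun i => A i `&` B i).
  by move=> i; exact: measurableI.
by rewrite -bigcapI.
Qed.

Lemma past_setT k : past k setT.
Proof.
exists (fun=> setT) => //.
by apply/seteqP; split => // w _ i _.
Qed.

Lemma past_indep k S (A : set R) : past k S -> measurable A ->
  P (S `&` D k @^-1` A) = (P S * P (D k @^-1` A))%E.
Proof.
move=> [B mB <-] mA.
rewrite (indD (A := B))//.
have := indD (n := k.+1) (A := fun i => if (i < k)%N then B i else A).
rewrite big_ord_recr/= ltnn => E.
have -> : \bigcap_(i in [set: 'I_k]) (D i @^-1` B i) `&` D k @^-1` A =
  \bigcap_(i in [set: 'I_k.+1]) (D i @^-1` (if (i < k)%N then B i else A)).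
  apply/seteqP; split => w.
    move=> [H1 H2] i _ /=; case: ifPn => ik; first exact: (H1 (Ordinal ik) I).
    have -> : (i = k :> nat) by apply/eqP; rewrite eqn_leq -ltnS ltn_ord/= leqNgt.
    exact: H2.
  move=> H; split => [i _|]; last by have := H ord_max I; rewrite /= ltnn.
  by have := H (widen_ord (leqnSn k) i) I; rewrite /= ltn_ord.
rewrite E; last by move=> i; case: ifP.
by congr (_ * _)%E; apply: eq_bigr => i _; rewrite ltn_ord.
Qed.

Lemma past_measurable_incr k j : (j < k)%N ->
  measurable_fun (setT : set (g_sigma_algebraType (past k))) (D j : g_sigma_algebraType (past k) -> R).
Proof.
move=> jk _ A mA; rewrite setTI; apply: sub_sigma_algebra.
exists (fun i => if i == j then A else setT).
  by move=> i; case: ifP.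
apply/seteqP; split => w; first by move=> /(_ (Ordinal jk) I); rewrite /= eqxx.
by move=> Aw i _ /=; case: ifP => // /eqP ->.
Qed.

End IndependentSequence.

Section Measurable2.
Context {R : realType}.

Definition measurable2 (V : R -> R -> R) := forall d (X : measurableType d) (M x : X -> R),
  measurable_fun setT M -> measurable_fun setT x -> measurable_fun setT (fun w => V (M w) (x w)).

Lemma measurable2_coarse (p h : R) m (V : R -> R -> R) : measurable2 V -> measurable2 (coarse_block p h m V).
Proof.
move=> mV d X M x mM mx; rewrite /coarse_block.
elim: m x mx => [|m IH] x mx; first by apply: mV => //; exact: measurable_maxr.
apply: measurable_funD; apply: measurable_funM => //; apply: IH.
  exact: measurable_funD.
exact: measurable_funB.
Qed.

Lemma measurable2_pitman f (d : measure_display) (X : measurableType d) (M x : X -> R) :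
  measurable_fun setT f ->
  measurable_fun setT M -> measurable_fun setT x ->
  measurable_fun setT (fun w => f (2 * M w - x w) : R).
Proof.
move=> mf mM mx; apply: (measurableT_comp mf).
by apply: measurable_funB => //; exact: measurable_funM.
Qed.

Lemma unit_lip_measurable l (f : R -> R) : unit_lip l f -> measurable_fun setT f.
Proof.
by move=> [_ _ fl]; apply: continuous_measurable_fun; exact: lipschitz_continuous fl.
Qed.

Lemma unit_lip_weaken l l' (f : R -> R) : l <= l' -> unit_lip l f -> unit_lip l' f.
Proof.
move=> ll' [l0 f01 fl]; split => //; first exact: le_trans ll'.
by move=> x y; apply: (le_trans (fl x y)); rewrite ler_wpM2r.
Qed.

Lemma measurable2_walk_value (p h : R) m (fs : seq (R -> R)) L G : unit_lips fs L -> measurable2 G ->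
  measurable2 (walk_value (coarse_block p h m) fs G).
Proof.
move=> + mG; elim: fs L => [//|f fs IH] L /= [l [L' [_ tf /IH mV]]].
move=> d X M x mM mx; apply: measurable_funM.
  exact: measurable2_pitman (unit_lip_measurable tf) mM mx.
exact: measurable2_coarse.
Qed.

Lemma lipschitz2_section (L : R) (V : R -> R -> R) M : 0 <= L -> unit_valued2 V -> lipschitz2 L V ->
  unit_lip L (fun y => V (Num.max M y) y).
Proof.
move=> L0 V01 VL; split => // x y; apply: VL => //.
by apply: max_dist => //; rewrite subrr normr0.
Qed.

End Measurable2.

Section CLT.
Context {R : realType} d (T : measurableType d) (P : probability T R).
Variables (D : nat -> T -> R) (nu : probability (measurableTypeR R) R).
Hypotheses (mD : forall j, measurable_fun setT (D j))
  (Dnu : forall j (A : set R), measurable A -> P (D j @^-1` A) = nu A)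
  (indD : forall n, mutually_independent P (fun i : 'I_n => D i)).
Notation TG k := (g_sigma_algebraType (past D k)).

Definition drift_sum c m (w : T) := \sum_(j < m) (D j w + c).

Lemma drift_sum_past c k :
  measurable_fun (setT : set (TG k)) (drift_sum c k : TG k -> R).
Proof.
apply: measurable_sum => j; apply: measurable_funD => //.
exact: past_measurable_incr.
Qed.

Lemma past_freeze k (Phi : T -> R -> R) (u : T -> R) e :
  measurable_fun setT (fun z : TG k * measurableTypeR R => Phi z.1 z.2) ->
  (forall w z, 0 <= Phi w z <= 1) ->
  measurable_fun (setT : set (TG k)) (u : TG k -> R) -> (forall w, 0 <= u w <= 1) ->
  (forall w, `|\int[nu]_z Phi w z - u w| <= e) ->
  `|\int[P]_w Phi w (D k w) - \int[P]_w u w| <= e.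
Proof.
move=> mPhi Phi01 mu u01 H.
apply: (freeze_approx (past_sub mD (k := k)) (@past_setI _ _ _ D k)
  (@past_setT _ _ _ D k) (mD k) (Dnu k) (@past_indep _ _ _ P D indD k) mPhi) => //.
exact: (past_measurable (past_sub mD (k := k))).
Qed.

Section walk_parameters.
Variables (v k c h p : R).
Hypotheses (mo : moments nu v k) (h0 : 0 <= h) (hv : h ^+ 2 = v)
  (hc : (2 * p - 1) * h = c) (p01 : 0 <= p <= 1).

(** Lindeberg's replacement: exchange the increments for walk steps one at a
    time, starting from the last one. *)
Lemma clt_smooth C K2 m (G G1 G2 : R -> R) x :
  continuous G -> (forall x, 0 <= G x <= 1) -> taylor3 C G G1 G2 -> 0 <= C ->
  (forall x, `|G2 x| <= K2) ->
  `|\int[P]_w G (x + drift_sum c m w) - iter m (walk_step p h) G x| <=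
    m%:R * (c ^+ 2 / 2 * K2 + C * (4 * `|c| ^+ 3 + 4 * k + h ^+ 3)).
Proof.
elim: m G G1 G2 => [|m IH] G G1 G2 cG G01 tG C0 G2K.
  rewrite /= mul0r.
  have -> : \int[P]_w G (x + drift_sum c 0 w) = \int[P]_w (G x).
    by apply: eq_Rintegral => w _; rewrite /drift_sum big_ord0 addr0.
  rewrite Rintegral_cst// [X in _ * X]fine_setT mulr1 subrr normr0//.
have cU : continuous (walk_step p h G).
  have cs a : continuous (fun x => G (x + a)).
    move=> y; apply: (@continuous_comp _ _ _ (fun x => x + a)); last exact: cG.
    by apply: cvgD; [exact: cvg_id|exact: cvg_cst].
  move=> y; apply: cvgD; apply: cvgM; try exact: cvg_cst; exact: cs.
have U01 y : 0 <= walk_step p h G y <= 1 by apply: convex_unit.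
have U2 y : `|walk_step p h G2 y| <= K2.
  have := convex_dist (v := G2 (y - h)) (u' := 0) (v' := 0) p01 (u := G2 (y + h)) (e := K2).
  by rewrite !subr0 !mulr0 addr0 subr0; apply.
have := IH _ _ _ cU U01 (taylor3_walk_step h p01 tG) C0 U2.
rewrite -iterSr => H1.
set K := c ^+ 2 / 2 * K2 + _ in H1 *.
have mG := continuous_measurable_fun cG.
have H2 : `|\int[P]_w G (x + drift_sum c m.+1 w) - \int[P]_w walk_step p h G (x + drift_sum c m w)| <= K.
  have -> : \int[P]_w G (x + drift_sum c m.+1 w) =
      \int[P]_w G (x + drift_sum c m w + (D m w + c)).
    by apply: eq_Rintegral => w _; rewrite /drift_sum big_ord_recr/= addrA.
  apply: (past_freeze (Phi := fun w z => G (x + drift_sum c m w + (z + c)))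
    (u := fun w => walk_step p h G (x + drift_sum c m w))) => //.
  - apply: (measurableT_comp mG); apply: measurable_funD.
      apply: measurable_funD => //.
      apply: (measurableT_comp (@drift_sum_past c m)); exact: measurable_fst.
    by apply: measurable_funD => //; exact: measurable_snd.
  - apply: (measurableT_comp (continuous_measurable_fun cU)).
    by apply: measurable_funD => //; exact: drift_sum_past.
  - by move=> w; apply: (one_step _ mo cG G01 tG).
rewrite -natr1 mulrDl mul1r [leRHS]addrC.
have -> : \int[P]_w G (x + drift_sum c m.+1 w) - iter m.+1 (walk_step p h) G x =
  (\int[P]_w G (x + drift_sum c m.+1 w) - \int[P]_w walk_step p h G (x + drift_sum c m w)) +
  (\int[P]_w walk_step p h G (x + drift_sum c m w) - iter m.+1 (walk_step p h) G x) by ring.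
by apply: (le_trans (ler_normD _ _)); rewrite lerD.
Qed.

(** Smooth at scale [e], which costs [20 * L * e], and apply [clt_smooth]. With [e]
    fixed, the other error becomes small as the block is cut into more steps. *)
Lemma clt_unit_lip L e m (f : R -> R) x : 0 < e -> unit_lip L f ->
  `|\int[P]_w f (x + drift_sum c m w) - iter m (walk_step p h) f x| <=
   20 * L * e +
    m%:R * (c ^+ 2 / 2 * (2 / e ^+ 2)
            + 4 * L / e ^+ 2 * (4 * `|c| ^+ 3 + 4 * k + h ^+ 3)).
Proof.
move=> e0 tf; have [g [g1 [g2 [cg g01 tg gf g2K]]]] := smooth_approx e0 tf.
have [L0 f01 fL] := tf.
have C0 : 0 <= 4 * L / e ^+ 2 by rewrite divr_ge0 ?sqr_ge0// mulr_ge0.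
have H := clt_smooth m x cg g01 tg C0 g2K.
have mX : measurable_fun setT (fun w => x + drift_sum c m w).
  apply: measurable_funD => //; apply: measurable_sum => j.
  exact: measurable_funD.
have H1 : `|\int[P]_w f (x + drift_sum c m w) - \int[P]_w g (x + drift_sum c m w)| <= 10 * L * e.
  apply: unit_Rintegral_dist => //.
  - by apply: (measurableT_comp _ mX); exact: unit_lip_measurable tf.
  - by apply: (measurableT_comp _ mX); exact: continuous_measurable_fun.
  - by move=> w; rewrite distrC.
have H2 : `|iter m (walk_step p h) g x - iter m (walk_step p h) f x| <= 10 * L * e.
  by apply: walk_step_iter_dist.
have -> : \int[P]_w f (x + drift_sum c m w) - iter m (walk_step p h) f x =
  (\int[P]_w f (x + drift_sum c m w) - \int[P]_w g (x + drift_sum c m w)) +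
  (\int[P]_w g (x + drift_sum c m w) - iter m (walk_step p h) g x) +
  (iter m (walk_step p h) g x - iter m (walk_step p h) f x) by ring.
have -> : 20 * L * e = 10 * L * e + 10 * L * e by ring.
rewrite -addrA [leRHS]addrAC -addrA.
by do 2 (apply: (le_trans (ler_normD _ _)); apply: lerD => //).
Qed.

End walk_parameters.

(** The counterpart of [walk_value] along a path with increments [y], starting
    at time [k]. *)
Fixpoint path_value (fs : seq (R -> R)) (G : R -> R -> R) (y : nat -> R) k M x : R :=
  if fs is f :: fs' then
    f (2 * M - x) * path_value fs' G y k.+1 (Num.max M (x + y k)) (x + y k)
  else G M x.

Lemma past_widen k (f : T -> R) : measurable_fun (setT : set (TG k)) (f : TG k -> R) ->
  measurable_fun (setT : set (TG k.+1)) (f : TG k.+1 -> R).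
Proof.
move=> mf _ A mA.
suff sub : <<s past D k >> `<=` <<s past D k.+1 >> by apply: sub; exact: mf.
apply: smallest_sub; first exact: smallest_sigma_algebra.
move=> _ [B mB <-]; apply: sub_sigma_algebra.
exists (fun i => if (i < k)%N then B i else setT).
  by move=> i; case: ifP.
apply/seteqP; split => w Hw i _.
  by have := Hw (widen_ord (leqnSn k) i) I; rewrite /= ltn_ord.
by rewrite /=; case: ifPn => // ik; exact: (Hw (Ordinal ik) I).
Qed.

(** The same replacement at the scale of blocks. Here the functions integrated
    are only Lipschitz, because of the maximum, and the approximation [eta] of a
    single block, uniform over such functions, is the central limit theorem
    above. *)
Lemma path_value_approx p h m c Lf eta LG G : 0 <= p <= 1 ->
  (forall f x, unit_lip Lf f ->
    `|\int[nu]_z f (x + ((z : R) + c)) - iter m (walk_step p h) f x| <= eta) ->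
  unit_valued2 G -> lipschitz2 LG G -> measurable2 G -> 0 <= LG ->
  forall (fs : seq (R -> R)) L k (W M x : T -> R), unit_lips fs L -> 3 * L + LG <= Lf ->
  measurable_fun (setT : set (TG k)) (W : TG k -> R) -> (forall w, 0 <= W w <= 1) ->
  measurable_fun (setT : set (TG k)) (M : TG k -> R) ->
  measurable_fun (setT : set (TG k)) (x : TG k -> R) ->
  `|\int[P]_w (W w * path_value fs G (fun j => D j w + c) k (M w) (x w)) -
    \int[P]_w (W w * walk_value (coarse_block p h m) fs G (M w) (x w))| <= (size fs)%:R * eta.
Proof.
move=> p01 H G01 GL mG LG0; elim => [|f fs IH] L k W M x.
  by move=> *; rewrite /= subrr normr0 mul0r.
move=> /= [l [L' [LE tf T']]] LLf mW W01 mM mx.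
have [l0 f01 fl] := tf.
have L'0 := unit_lips_ge0 T'.
pose W' w := W w * f (2 * M w - x w).
have mW' : measurable_fun (setT : set (TG k)) (W' : TG k -> R).
  by apply: measurable_funM => //; apply: (measurable2_pitman (unit_lip_measurable tf)).
have W'01 w : 0 <= W' w <= 1.
  have /andP[? ?] := W01 w; have /andP[? ?] := f01 (2 * M w - x w).
  by rewrite mulr_ge0//= mulr_ile1.
pose x' w := x w + (D k w + c).
have mx' : measurable_fun (setT : set (TG k.+1)) (x' : TG k.+1 -> R).
  apply: measurable_funD; first exact: past_widen.
  by apply: measurable_funD => //; exact: past_measurable_incr.
pose M' w := Num.max (M w) (x' w).
have mM' : measurable_fun (setT : set (TG k.+1)) (M' : TG k.+1 -> R).
  by apply: measurable_maxr => //; exact: past_widen.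
have LL' : 3 * L' + LG <= Lf by apply: le_trans LLf; rewrite LE; lra.
have := IH L' k.+1 W' M' x' T' LL' (past_widen mW') W'01 mM' mx'.
set V := walk_value (coarse_block p h m) fs G.
have V01 : unit_valued2 V by exact: walk_value_coarse_unit T' G01.
have VL : lipschitz2 (3 * L' + LG) V by exact: walk_value_coarse_lip T' G01 GL.
have mV : measurable2 V by exact: measurable2_walk_value T' mG.
have -> : \int[P]_w (W' w * path_value fs G (fun j => D j w + c) k.+1 (M' w) (x' w)) =
  \int[P]_w (W w * (f (2 * M w - x w) * path_value fs G (fun j => D j w + c) k.+1 (M' w) (x' w))).
  by apply: eq_Rintegral => w _; rewrite /W' mulrA.
move=> H1.
have H2 : `|\int[P]_w (W' w * V (M' w) (x' w)) -
   \int[P]_w (W w * (f (2 * M w - x w) * coarse_block p h m V (M w) (x w)))| <= eta.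
  have mC := measurable2_coarse p h m mV.
  have C01 := coarse_unit h p01 m V01.
  apply: (past_freeze (k := k)
    (Phi := fun w z => W' w * V (Num.max (M w) (x w + (z + c))) (x w + (z + c)))
    (u := fun w => W w * (f (2 * M w - x w) * coarse_block p h m V (M w) (x w)))).
  - have m1 (g : TG k -> R) : measurable_fun setT g ->
      measurable_fun setT (fun z : TG k * measurableTypeR R => g z.1).
      by move=> mg; apply: (measurableT_comp mg); exact: measurable_fst.
    have mz : measurable_fun setT (fun z : TG k * measurableTypeR R => x z.1 + ((z.2 : R) + c)).
      apply: measurable_funD; first exact: (m1 x).
      by apply: measurable_funD => //; exact: measurable_snd.
    apply: measurable_funM; first exact: (m1 W').
    apply: mV => //; apply: measurable_maxr => //; exact: (m1 M).
  - move=> w z; have /andP[? ?] := W'01 w.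
    have /andP[? ?] := V01 (Num.max (M w) (x w + (z + c))) (x w + (z + c)).
    by rewrite mulr_ge0//= mulr_ile1.
  - apply: measurable_funM => //; apply: measurable_funM.
      exact: (measurable2_pitman (unit_lip_measurable tf)).
    exact: mC.
  - move=> w; have /andP[? ?] := W01 w; have /andP[? ?] := f01 (2 * M w - x w).
    have /andP[? ?] := C01 (M w) (x w).
    by rewrite mulr_ge0 ?mulr_ge0//= mulr_ile1 ?mulr_ge0// mulr_ile1.
  - move=> w; have tV : unit_lip Lf (fun y => V (Num.max (M w) y) y).
      apply: (unit_lip_weaken LL'); apply: lipschitz2_section => //.
      by rewrite addr_ge0// mulr_ge0.
    have := H _ (x w) tV; rewrite -/(coarse_block p h m V (M w) (x w)) => Hw.
    have mVz : measurable_fun setT (fun z : measurableTypeR R =>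
        V (Num.max (M w) (x w + ((z : R) + c))) (x w + ((z : R) + c))).
      apply: (measurableT_comp (unit_lip_measurable tV)).
      by apply: measurable_funD => //; apply: measurable_funD.
    rewrite RintegralZl//; last first.
      by have H3 := @unit_integrable R _ (measurableTypeR R) nu _ mVz (fun=> V01 _ _); exact H3.
    rewrite mulrA -mulrBr normrM.
    have /andP[w0 w1] := W'01 w; rewrite (ger0_norm w0).
    by apply: (le_trans _ Hw); rewrite ler_piMl.
have tri (a b e u v : R) : `|a - e| <= u -> `|e - b| <= v -> `|a - b| <= u + v.
  by move=> ? ?; rewrite (le_trans (ler_distD e _ _))// lerD.
by rewrite -[(size fs).+1%:R]natr1 mulrDl mul1r; exact: (tri _ _ _ _ _ H1 H2).
Qed.

End CLT.

(** * Brownian increments *)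

Section Brownian.
Context {R : realType} d (T : measurableType d) (P : probability T R).
Variables (B : R -> {RV P >-> R}).
Hypothesis hB : standard_brownian_motion B.

Definition incr (delta : R) (j : nat) (w : T) : R :=
  B (j.+1%:R * delta) w - B (j%:R * delta) w.

Lemma incr_measurable delta j : measurable_fun setT (incr delta j).
Proof. exact: measurable_funB. Qed.

Lemma incr_law (delta : R) j (A : set R) : 0 < delta -> measurable A ->
  P (incr delta j @^-1` A) = normal_prob 0 (Num.sqrt delta) A.
Proof.
move=> d0 mA; have [_ _ _ H] := hB.
have := H (j%:R * delta) (j.+1%:R * delta) _ _ A mA.
have -> : j.+1%:R * delta - j%:R * delta = delta by rewrite -natr1; ring.
apply; first by rewrite mulr_ge0// ltW.
by rewrite ltr_pM2r// ltr_nat.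
Qed.

Lemma incr_indep (delta : R) n : 0 < delta ->
  mutually_independent P (fun i : 'I_n => incr delta i).
Proof.
move=> d0; have [_ _ H _] := hB.
apply: (H n (fun i => i%:R * delta)); first by rewrite mul0r.
by move=> i _; rewrite ler_pM2r// ler_nat.
Qed.

Lemma drift_sum_incr delta c m w :
  drift_sum (incr delta) c m w = B (m%:R * delta) w + m%:R * c.
Proof.
have [B0 _ _ _] := hB.
rewrite /drift_sum big_split/= sumr_const card_ord -[c *+ m]mulr_natl; congr (_ + _).
elim: m => [|m IH]; first by rewrite big_ord0 mul0r B0.
by rewrite big_ord_recr/= IH /incr; ring.
Qed.

(** A Brownian increment over [delta] is the sum of [m] increments over
    [delta / m]; this is how the normal law at the large scale is related to the
    one at the small scale. *)
Lemma integral_increment (delta c : R) m (f : R -> R) x : 0 < delta -> (0 < m)%N ->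
  measurable_fun setT f -> (forall x, 0 <= f x <= 1) ->
  \int[P]_w f (x + drift_sum (incr (delta / m%:R)) (c / m%:R) m w) =
  \int[normal_prob 0 (Num.sqrt delta)]_z f (x + ((z : R) + c)).
Proof.
move=> d0 m0 mf f01.
have mn0 : m%:R != 0 :> R by rewrite pnatr_eq0 -lt0n.
have [B0 _ _ _] := hB.
have E w : drift_sum (incr (delta / m%:R)) (c / m%:R) m w = B delta w + c.
  by rewrite drift_sum_incr [m%:R * _]mulrC divfK// [m%:R * _]mulrC divfK.
under eq_Rintegral do rewrite E.
have mg : measurable_fun setT (fun z : measurableTypeR R => f (x + ((z : R) + c))).
  apply: (measurableT_comp mf); apply: measurable_funD => //; exact: measurable_funD.
rewrite /Rintegral; congr fine.
have mB : measurable_fun (setT : set T) (B delta : T -> measurableTypeR R) by have H := measurable_funPT (B delta); exact H.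
pose X : {mfun T >-> measurableTypeR R} :=
  HB.pack (B delta : T -> measurableTypeR R) (isMeasurableFun.Build _ _ _ _ _ mB).
have Dlaw (A : set R) : measurable A -> distribution P X A = normal_prob 0 (Num.sqrt delta) A.
  move=> mA; rewrite -(incr_law 0 d0 mA) /distribution /pushforward.
  congr (P _); apply/seteqP; split => w /=; rewrite /incr mul1r mul0r B0 subr0//.
transitivity (\int[distribution P X]_z (f (x + ((z : R) + c)))%:E)%E.
  by rewrite ge0_integral_distribution//=; [exact/measurable_EFinP|
    move=> z; rewrite lee_fin; have /andP[] := f01 (x + ((z : R) + c))].
by apply: eq_measure_integral => A mA _; exact: Dlaw.
Qed.

(** With [s ^+ 2 = delta / m], the step [h] is of order [s], the drift per step
    is [mu * s ^+ 2], and [m] replacements of cost of order [s ^+ 3] add up to a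
    quantity of order [delta * s]. The same step and complementary probabilities
    serve the two opposite drifts. *)
Lemma clt_brownian (delta mu L eta : R) : 0 < delta -> 0 <= L -> 0 < eta -> exists m (h p : R),
  [/\ 0 < h, 0 <= p <= 1, m%:R * ((2 * p - 1) * h) = mu * delta,
      m%:R * h ^+ 2 <= 33 * delta &
      (forall f x, unit_lip L f ->
       `|\int[normal_prob 0 (Num.sqrt delta)]_z f (x + ((z : R) + mu * delta))
         - iter m (walk_step p h) f x| <= eta)
      /\
      (forall f x, unit_lip L f ->
       `|\int[normal_prob 0 (Num.sqrt delta)]_z f (x + ((z : R) + - mu * delta))
         - iter m (walk_step (1 - p) h) f x| <= eta)].
Proof.
move=> d0 L0 eta0.
pose e := eta / (40 * (L + 1)).
have L1 : 0 < 40 * (L + 1) by rewrite mulr_gt0// ltr_wpDl.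
have e0 : 0 < e by rewrite divr_gt0.
have e2 : 0 < e ^+ 2 by rewrite exprn_gt0.
pose K0 := mu ^+ 2 / e ^+ 2 + 4 * L / e ^+ 2 * (4 * `|mu| ^+ 3 + 344).
have K00 : 0 <= K0.
  apply: addr_ge0; first exact: divr_ge0 (sqr_ge0 _) (sqr_ge0 _).
  apply: mulr_ge0; first exact: divr_ge0 (mulr_ge0 (ler0n _ 4) L0) (sqr_ge0 _).
  exact: addr_ge0 (mulr_ge0 (ler0n _ 4) (exprn_ge0 _ (normr_ge0 _))) (ler0n _ 344).
pose s0 := Num.min (Num.min 1 (1 / (3 * (`|mu| + 1)))) (eta / (2 * (K0 * delta + 1))).
have mu1 : 0 < 3 * (`|mu| + 1) by rewrite mulr_gt0// ltr_wpDl.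
have K1 : 0 < 2 * (K0 * delta + 1) by rewrite mulr_gt0// ltr_wpDl// mulr_ge0// ltW.
have s00 : 0 < s0 by rewrite !lt_min ltr01/= !divr_gt0.
pose m := (Num.bound (delta / s0 ^+ 2)).+1.
have m0 : 0 < m%:R :> R by rewrite ltr0n.
have mn0 : m%:R != 0 :> R by rewrite gt_eqF.
have dm0 : 0 < delta / m%:R by rewrite divr_gt0.
pose s := Num.sqrt (delta / m%:R).
have s_gt0 : 0 < s by rewrite sqrtr_gt0.
have s2 : s ^+ 2 = delta / m%:R by rewrite sqr_sqrtr// ltW.
have ss0 : s <= s0.
  rewrite -(ler_pXn2r (ltn0Sn 1)) ?nnegrE ?(ltW s_gt0) ?(ltW s00)// s2.
  rewrite ler_pdivrMr// mulrC -ler_pdivrMr ?exprn_gt0//.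
  apply: (@le_trans _ _ (Num.bound (delta / s0 ^+ 2))%:R); last by rewrite ler_nat.
  by apply/ltW/archi_boundP; rewrite divr_ge0 ?sqr_ge0// ltW.
have [s1 smu sK] : [/\ s <= 1, s <= 1 / (3 * (`|mu| + 1)) & s <= eta / (2 * (K0 * delta + 1))].
  by move: ss0; rewrite !le_min => /andP[/andP[]].
have {}smu : `|mu| * s <= 1 / 3.
  move: smu; rewrite ler_pdivlMr// => smu.
  have : 0 <= s by exact: ltW.
  have := normr_ge0 mu; nra.
have {}sK : K0 * delta * s <= eta / 2.
  move: sK; rewrite ler_pdivlMr// => sK; lra.
have [v [mo v1 v2]] := normal_moments s_gt0.
pose h := Num.sqrt v.
have v0 : 0 < v by apply: lt_le_trans v1; rewrite divr_gt0// exprn_gt0.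
have h0 : 0 < h by rewrite sqrtr_gt0.
have h2 : h ^+ 2 = v by rewrite sqr_sqrtr// ltW.
have h6 : h <= 6 * s.
  rewrite -(ler_pXn2r (ltn0Sn 1)) ?nnegrE ?mulr_ge0 ?(ltW s_gt0) ?(ltW h0)// h2.
  by apply: (le_trans v2); rewrite exprMn; have := sqr_ge0 s; lra.
have h3 : s / 3 <= h.
  rewrite -(ler_pXn2r (ltn0Sn 1)) ?nnegrE ?divr_ge0 ?(ltW s_gt0) ?(ltW h0)// h2.
  apply: le_trans v1; rewrite expr_div_n.
  have := sqr_ge0 s; lra.
pose c := mu * delta / m%:R.
have cE : c = mu * s ^+ 2 by rewrite s2 mulrA.
have ch : `|c| <= h.
  rewrite cE normrM (ger0_norm (sqr_ge0 s)).
  apply: le_trans h3; rewrite expr2 mulrA.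
  have : 0 <= s by exact: ltW.
  nra.
pose p := (1 + c / h) / 2.
have hc : (2 * p - 1) * h = c.
  by rewrite /p; field; rewrite gt_eqF.
have p01 : 0 <= p <= 1.
  have : `|c / h| <= 1 by rewrite normrM normfV (gtr0_norm h0) ler_pdivrMr// mul1r.
  by rewrite ler_norml /p => /andP[? ?]; apply/andP; split; lra.
exists m, h, p.
have mlaw j (A : set R) : measurable A ->
    P (incr (delta / m%:R) j @^-1` A) = (normal_prob 0 s : probability (measurableTypeR R) R) A.
  by move=> mA; exact: incr_law.
have mind n : mutually_independent P (fun i : 'I_n => incr (delta / m%:R) i).
  exact: incr_indep.
have bound c' : `|c'| = `|c| ->
  20 * L * e + m%:R * (c' ^+ 2 / 2 * (2 / e ^+ 2)
            + 4 * L / e ^+ 2 * (4 * `|c'| ^+ 3 + 4 * (32 * s ^+ 3) + h ^+ 3)) <= eta.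
  move=> cc'.
  have B1 : 20 * L * e <= eta / 2.
    have -> : 20 * L * e = (eta / 2) * (L / (L + 1)).
      by rewrite /e; field; rewrite gt_eqF// ltr_wpDl.
    rewrite ler_piMr ?divr_ge0 ?ltW//.
    by rewrite ltr_pdivrMr ?ltr_wpDl// mul1r ltrDl.
  have c2 : c' ^+ 2 <= mu ^+ 2 * s ^+ 3.
    rewrite -(real_normK (num_real c')) cc' (real_normK (num_real c)) cE exprMn.
    by rewrite ler_wpM2l ?sqr_ge0// -exprM ler_wiXn2l// ltW.
  have c3 : `|c'| ^+ 3 <= `|mu| ^+ 3 * s ^+ 3.
    rewrite cc' cE normrM (ger0_norm (sqr_ge0 s)) exprMn ler_wpM2l ?exprn_ge0//.
    by rewrite -exprM ler_wiXn2l// ltW.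
  have h33 : h ^+ 3 <= 216 * s ^+ 3.
    have -> : 216 * s ^+ 3 = (6 * s) ^+ 3 by ring.
    by rewrite lerXn2r// nnegrE ?mulr_ge0// ltW.
  have -> : eta = eta / 2 + eta / 2 by field.
  apply: lerD => //; apply: le_trans sK.
  have -> : K0 * delta * s = m%:R * (K0 * s ^+ 3).
    have -> : delta = m%:R * s ^+ 2 by rewrite s2 mulrC divfK.
    ring.
  rewrite ler_pM2l// /K0 [leRHS]mulrDl.
  have -> : c' ^+ 2 / 2 * (2 / e ^+ 2) = c' ^+ 2 / e ^+ 2 by field; rewrite gt_eqF.
  apply: lerD.
    by rewrite [leRHS]mulrAC ler_wpM2r// invr_ge0 ltW.
  rewrite -[leRHS]mulrA; apply: ler_wpM2l.
    exact: (divr_ge0 (mulr_ge0 (ler0n _ 4) L0) (sqr_ge0 e)).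
  by lra.
have mnat : (0 < m)%N by [].
split => //.
- by rewrite hc /c mulrC divfK.
- rewrite h2; have -> : 33 * delta = m%:R * (33 * s ^+ 2).
    by rewrite s2 mulrCA [m%:R * _]mulrC divfK.
  by rewrite ler_pM2l.
- split => f x tf; have [_ f01 _] := tf; have mf := unit_lip_measurable tf.
  + rewrite -(integral_increment (mu * delta) x d0 mnat)//.
    apply: (le_trans (clt_unit_lip (incr_measurable _) mlaw mind mo (ltW h0) h2 hc p01 m x e0 tf)).
    exact: bound.
  + rewrite -(integral_increment (- mu * delta) x d0 mnat)//.
    have hc' : (2 * (1 - p) - 1) * h = - mu * delta / m%:R.
      have -> : (2 * (1 - p) - 1) * h = - ((2 * p - 1) * h) by ring.
      by rewrite hc /c !mulNr.
    have p01' := unit_onem p01.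
    apply: (le_trans (clt_unit_lip (incr_measurable _) mlaw mind mo (ltW h0) h2 hc' p01' m x e0 tf)).
    by apply: bound; rewrite /c !mulNr normrN.
Qed.

End Brownian.

Section GridSymmetry.
Context {R : realType} d (T : measurableType d) (P : probability T R).
Variables (B : R -> {RV P >-> R}).
Hypothesis hB : standard_brownian_motion B.

Definition pitman_end (f g : R -> R) (M x : R) := f (2 * M - x) * g x.

Lemma pitman_end_unit l lg f g : unit_lip l f -> unit_lip lg g -> unit_valued2 (pitman_end f g).
Proof.
move=> [_ f01 _] [_ g01 _] M x.
have /andP[? ?] := f01 (2 * M - x); have /andP[? ?] := g01 x.
by rewrite /pitman_end mulr_ge0//= mulr_ile1.
Qed.

Lemma pitman_end_lip l lg f g : unit_lip l f -> unit_lip lg g ->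
  lipschitz2 (3 * l + lg) (pitman_end f g).
Proof.
move=> tf tg M x M' x' e HM Hx; rewrite /pitman_end [leRHS]mulrDl.
have [_ f01 _] := tf; have [lg0 g01 gl] := tg.
apply: prod_dist => //; first exact: (unit_lip_pitman tf).
by apply: (le_trans (gl _ _)); rewrite ler_wpM2l.
Qed.

Lemma pitman_end_measurable l lg f g : unit_lip l f -> unit_lip lg g ->
  measurable2 (pitman_end f g).
Proof.
move=> tf tg d' X M x mM mx; apply: measurable_funM.
  exact: (measurable2_pitman (unit_lip_measurable tf)).
exact: (measurableT_comp (unit_lip_measurable tg)).
Qed.

Lemma unit_lip_opp (l : R) g : unit_lip l g -> unit_lip l (fun x => g (- x)).
Proof.
move=> [l0 g01 gl]; split => // x y; apply: (le_trans (gl _ _)).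
have -> : - x - - y = - (x - y) by ring.
by rewrite normrN.
Qed.

Variables (t mu : R) (N : nat).
Hypotheses (t0 : 0 < t) (N0 : (0 < N)%N).

Definition grid_step := t / N%:R.

Definition grid_mean fs f g (mu : R) :=
  \int[P]_w path_value fs (pitman_end f g) (fun j => incr B grid_step j w + mu * grid_step) 0 0 0.

(** Replace the Brownian increments by long walks, pass from the maximum over
    the grid to the maximum over the walk, apply the symmetry of the walk, and
    go back. The error of the first replacement vanishes for a fixed grid as the
    number of walk steps grows; the bound that remains comes from the second one
    and tends to [0] with the mesh, for every fixed [b]. *)
Lemma grid_symmetry (b L l lg : R) fs f g : 0 < b -> `|mu| * grid_step <= b ->
  unit_lips fs L -> size fs = N -> unit_lip l f -> unit_lip lg g ->
  `|grid_mean fs f g mu - grid_mean fs f (fun x => g (- x)) (- mu)| <=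
    16 * b * (L + l) + 24 * 33 ^+ 2 * t ^+ 2 / (N%:R * b ^+ 4).
Proof.
move=> b0 mub T' sz tf tg.
have Nn0 : 0 < N%:R :> R by rewrite ltr0n.
have s0 : 0 < grid_step by rewrite divr_gt0.
have l0 : 0 <= l by case: tf.
have lg0 : 0 <= lg by case: tg.
have L0 := unit_lips_ge0 T'.
apply/ler_addgt0Pr => e e0.
pose eta := e / (2 * N%:R).
have eta0 : 0 < eta by rewrite divr_gt0// mulr_gt0.
pose LG := 3 * l + lg.
have LG0 : 0 <= LG by rewrite addr_ge0// mulr_ge0.
pose Lf := 3 * L + LG.
have Lf0 : 0 <= Lf by rewrite addr_ge0// mulr_ge0.
have [m [h [p [h0 p01 mh mh2 [H1 H2]]]]] := clt_brownian hB mu s0 Lf0 eta0.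
have p01' := unit_onem p01.
have tg' := unit_lip_opp tg.
have mlaw j (A : set R) : measurable A ->
    P (incr B grid_step j @^-1` A) =
    (normal_prob 0 (Num.sqrt grid_step) : probability (measurableTypeR R) R) A.
  by move=> mA; exact: incr_law.
have mind n : mutually_independent P (fun i : 'I_n => incr B grid_step i).
  exact: incr_indep.
have approx c q g' : unit_lip lg g' -> 0 <= q <= 1 ->
    (forall f x, unit_lip Lf f ->
       `|\int[normal_prob 0 (Num.sqrt grid_step)]_z f (x + ((z : R) + c))
         - iter m (walk_step q h) f x| <= eta) ->
    `|\int[P]_w path_value fs (pitman_end f g') (fun j => incr B grid_step j w + c) 0 0 0 -
      walk_value (coarse_block q h m) fs (pitman_end f g') 0 0| <= e / 2.
  move=> tg1 q01 H.
  have := path_value_approx (incr_measurable (P := P) B grid_step) mlaw mind q01 H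
    (pitman_end_unit tf tg1) (pitman_end_lip tf tg1) (pitman_end_measurable tf tg1) LG0
    (k := 0) (W := fun=> 1) (M := fun=> 0) (x := fun=> 0) T' (lexx _).
  rewrite sz.
  have -> : N%:R * eta = e / 2 by rewrite /eta; field; rewrite gt_eqF.
  have -> : \int[P]_w (1 * path_value fs (pitman_end f g') (fun j => incr B grid_step j w + c) 0 0 0) =
     \int[P]_w path_value fs (pitman_end f g') (fun j => incr B grid_step j w + c) 0 0 0.
    by apply: eq_Rintegral => w _; rewrite mul1r.
  have -> : \int[P]_w (1 * walk_value (coarse_block q h m) fs (pitman_end f g') 0 0) =
      walk_value (coarse_block q h m) fs (pitman_end f g') 0 0.
    by rewrite Rintegral_cst// [X in _ * X]fine_setT mulr1 mul1r.
  by apply => //; move=> _; rewrite ler01 lexx.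
have cmp q g' : unit_lip lg g' -> 0 <= q <= 1 -> m%:R * `|(2 * q - 1) * h| <= b ->
   `|walk_value (fine_block q h m) fs (pitman_end f g') 0 0 -
     walk_value (coarse_block q h m) fs (pitman_end f g') 0 0| <=
   8 * b * (L + l) + 12 * 33 ^+ 2 * t ^+ 2 / (N%:R * b ^+ 4).
  move=> [_ g01 _] q01 qb.
  have := walk_value_compare q01 b0 qb T' tf g01 (M := 0) (Mc := 0) (x := 0).
  rewrite sz lexx add0r mulr_ge0 ?(ltW b0)//= => /(_ isT isT).
  move=> H; apply: (le_trans H); rewrite lerD2l.
  have -> : 12 * 33 ^+ 2 * t ^+ 2 / (N%:R * b ^+ 4) =
      N%:R * (12 * (33 * grid_step) ^+ 2 / b ^+ 4).
    by rewrite /grid_step; field; rewrite !gt_eqF.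
  rewrite ler_wpM2l// ler_wpM2r ?invr_ge0 ?exprn_ge0 ?(ltW b0)// ler_wpM2l//.
  have A0 : 0 <= m%:R * h ^+ 2 := mulr_ge0 (ler0n _ m) (sqr_ge0 h).
  by rewrite !expr2; apply: ler_pM.
have qb : m%:R * `|(2 * p - 1) * h| <= b.
  have -> : m%:R * `|(2 * p - 1) * h| = `|m%:R * ((2 * p - 1) * h)|.
    by rewrite [RHS]normrM normr_nat.
  by rewrite mh normrM (gtr0_norm s0).
have qb' : m%:R * `|(2 * (1 - p) - 1) * h| <= b.
  have -> : (2 * (1 - p) - 1) * h = - ((2 * p - 1) * h) by ring.
  by rewrite normrN.
have A1 := approx _ _ _ tg p01 H1.
have A2 := approx _ _ _ tg' p01' H2.
have C1 := cmp _ _ tg p01 qb.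
have C2 := cmp _ _ tg' p01' qb'.
have S := walk_symmetry p m fs f g h0.
rewrite -/(pitman_end f g) -/(pitman_end f (fun x => g (- x))) in S.
rewrite -S in C2.
rewrite -/(grid_mean fs f g mu) in A1.
rewrite -/(grid_mean fs f (fun x => g (- x)) (- mu)) in A2.
have -> : 16 * b * (L + l) + 24 * 33 ^+ 2 * t ^+ 2 / (N%:R * b ^+ 4) + e =
  (e / 2 + (8 * b * (L + l) + 12 * 33 ^+ 2 * t ^+ 2 / (N%:R * b ^+ 4))) +
  ((8 * b * (L + l) + 12 * 33 ^+ 2 * t ^+ 2 / (N%:R * b ^+ 4)) + e / 2) by field; rewrite !gt_eqF.
have tri (u v w c c' : R) : `|u - w| <= c -> `|w - v| <= c' -> `|u - v| <= c + c'.
  by move=> ? ?; rewrite (le_trans (ler_distD w _ _))// lerD.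
apply: (tri _ _ (walk_value (fine_block p h m) fs (pitman_end f g) 0 0)).
  apply: (tri _ _ _ _ _ A1); by rewrite distrC.
apply: (tri _ _ _ _ _ C2); by rewrite distrC.
Qed.

End GridSymmetry.

(** * Running maxima of a continuous path *)

Section Paths.
Context {R : realType}.
Implicit Types (phi psi : R -> R) (a b s t u v e : R).

Definition unif_cont t phi := forall e, 0 < e -> exists2 eta, 0 < eta &
  forall u v, 0 <= u <= t -> 0 <= v <= t -> `|u - v| <= eta -> `|phi u - phi v| <= e.

(** Compactness of the segment, in its near-covering form. *)
Lemma within_unif_cont t phi : {within `[0, t], continuous phi} -> unif_cont t phi.
Proof.
move=> /subspace_continuousP cphi e e0.
have := @segment_compact R 0 t; rewrite compact_near_coveringP -near_covering_withinP.
move=> /(_ R (0^'+) (fun eta u => forall v, 0 <= v <= t -> `|u - v| <= eta -> `|phi u - phi v| <= e)).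
move=> /(_ _).
have e2 : 0 < e / 2 by rewrite divr_gt0.
case.
  move=> x Kx; have /cvgrPdist_le /(_ _ e2) := cphi x Kx.
  rewrite near_withinE => -[r /= r0 rx].
  exists (ball x (r / 2), [set eta : R | 0 < eta < r / 2]).
    split; first by apply: nbhsx_ballx; rewrite divr_gt0.
    exists (r / 2) => /=; first by rewrite divr_gt0.
    by move=> y /=; rewrite sub0r normrN => yr y0; rewrite y0 (le_lt_trans (ler_norm _) yr).
  move=> [u eta] /= [xu /andP[eta0 eta2]] Ku v v0 uv.
  have Kv : `[0, t]%classic v by rewrite /= in_itv.
  have xu' : `|x - u| < r / 2 by exact: xu.
  have H1 : `|phi x - phi u| <= e / 2.
    by apply: rx => //=; rewrite /ball_/= (lt_le_trans xu')// ler_pdivrMr// ler_peMr ?ltW//; lra.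
  have H2 : `|phi x - phi v| <= e / 2.
    apply: rx => //=; rewrite /ball_/=; apply: (le_lt_trans (ler_distD u _ _)).
    by apply: (@lt_le_trans _ _ (r / 2 + r / 2)); [rewrite ltr_leD// (le_trans uv)// ltW|lra].
  apply: (le_trans (ler_distD (phi x) _ _)); rewrite distrC.
  by apply: (le_trans (lerD H1 H2)); lra.
move=> r /= r0 H.
exists (r / 2); first by rewrite divr_gt0.
move=> u v u0 v0 uv.
apply: (H (r / 2)) => //=.
- by rewrite sub0r normrN gtr0_norm ?divr_gt0//; lra.
- by rewrite divr_gt0.
Qed.

Lemma unif_cont_within t phi : unif_cont t phi -> {within `[0, t], continuous phi}.
Proof.
move=> up; apply/subspace_continuousP => x Kx; apply/cvgrPdist_le => e e0.
have [eta eta0 H] := up e e0.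
rewrite near_withinE; exists eta => //= y /= xy Ky.
by apply: H; rewrite ?(ltW xy)//; move: Kx Ky; rewrite /= !in_itv.
Qed.

Lemma unif_cont_subinterval t phi a b : 0 <= a -> b <= t -> unif_cont t phi ->
  {within `[a, b], continuous phi}.
Proof.
move=> a0 bt /unif_cont_within; apply: continuous_subspaceW => x /=.
by rewrite !in_itv/= => /andP[ax xb]; rewrite (le_trans a0)//= (le_trans xb).
Qed.

Lemma unif_contD t phi psi : unif_cont t phi -> unif_cont t psi ->
  unif_cont t (fun s => phi s + psi s).
Proof.
move=> H1 H2 e e0; have e2 : 0 < e / 2 by rewrite divr_gt0.
have [n1 n10 {}H1] := H1 _ e2; have [n2 n20 {}H2] := H2 _ e2.
exists (Num.min n1 n2); first by rewrite lt_min n10.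
move=> u v u0 v0; rewrite le_min => /andP[uv1 uv2].
rewrite opprD addrACA; apply: (le_trans (ler_normD _ _)).
by apply: (le_trans (lerD (H1 _ _ u0 v0 uv1) (H2 _ _ u0 v0 uv2))); lra.
Qed.

Lemma unif_cont_lip t phi psi c : 0 < c -> unif_cont t phi ->
  (forall u v, `|psi u - psi v| <= c * `|phi u - phi v|) -> unif_cont t psi.
Proof.
move=> c0 H1 H e e0; have ec : 0 < e / c by rewrite divr_gt0.
have [n1 n10 {}H1] := H1 _ ec; exists n1 => // u v u0 v0 uv.
by apply: (le_trans (H _ _)); rewrite mulrC -ler_pdivlMr//; exact: H1.
Qed.

Lemma unif_contN t phi : unif_cont t phi -> unif_cont t (fun s => - phi s).
Proof.
move=> H; apply: (unif_cont_lip ltr01 H) => u v.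
by rewrite mul1r -opprD normrN.
Qed.

Lemma unif_contM2 t phi : unif_cont t phi -> unif_cont t (fun s => 2 * phi s).
Proof.
move=> H; apply: (unif_cont_lip (ltr0n _ 2) H) => u v.
by rewrite -mulrBr normrM ger0_norm.
Qed.

Lemma unif_cont_norm t phi : unif_cont t phi -> unif_cont t (fun s => `|phi s|).
Proof.
move=> H; apply: (unif_cont_lip ltr01 H) => u v.
by rewrite mul1r; exact: ler_dist_dist.
Qed.

Lemma unif_cont_cst t c : unif_cont t (fun=> c).
Proof. by move=> e e0; exists 1 => // *; rewrite subrr normr0 ltW. Qed.

Section one_path.
Variables (t : R) (phi : R -> R).
Hypothesis up : unif_cont t phi.

Lemma path_max_attained a b : 0 <= a -> a <= b -> b <= t ->
  exists2 c, a <= c <= b & path_max phi a b = phi c.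
Proof.
move=> a0 ab bt.
have [c cab H] := EVT_max ab (unif_cont_subinterval a0 bt up).
exists c; first by move: cab; rewrite in_itv.
have ub : ubound [set phi u | u in `[a, b]] (phi c).
  by move=> _ [u uab <-]; exact: H.
apply/eqP; rewrite eq_le; apply/andP; split.
  by apply: ge_sup => //; exists (phi c); exists c.
by apply: ub_le_sup; [exists (phi c)|exists c].
Qed.

Lemma path_max_ge a b u : 0 <= a -> b <= t -> a <= u <= b -> phi u <= path_max phi a b.
Proof.
move=> a0 bt /andP[au ub]; have ab := le_trans au ub.
have [c cab H] := EVT_max ab (unif_cont_subinterval a0 bt up).
apply: ub_le_sup; last by exists u => //=; rewrite in_itv/= au.
by exists (phi c) => _ [v vab <-]; exact: H.
Qed.

Lemma path_max_le a b c : 0 <= a -> a <= b -> b <= t ->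
  (forall u, a <= u <= b -> phi u <= c) -> path_max phi a b <= c.
Proof.
by move=> a0 ab bt H; have [u uab ->] := path_max_attained a0 ab bt; exact: H.
Qed.

Lemma path_max_mono a b a' b' : 0 <= a' -> a' <= a -> a <= b -> b <= b' -> b' <= t ->
  path_max phi a b <= path_max phi a' b'.
Proof.
move=> a0 aa ab bb bt; apply: path_max_le => //; [exact: le_trans aa|exact: le_trans bt|].
by move=> u /andP[? ?]; apply: path_max_ge => //; apply/andP; split; lra.
Qed.

(** By symmetry it is enough to compare a time with an earlier one; the modulus
    of continuity of [phi] is handed to the proof. *)
Lemma unif_cont_from_left (psi : R -> R) :
  (forall e eta, 0 < e -> 0 < eta ->
    (forall u v, 0 <= u <= t -> 0 <= v <= t -> `|u - v| <= eta -> `|phi u - phi v| <= e) ->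
    forall u v, 0 <= u -> u <= v -> v <= t -> v - u <= eta -> `|psi u - psi v| <= e) ->
  unif_cont t psi.
Proof.
move=> H e e0; have [eta eta0 K] := up e0; exists eta => // u v /andP[u0 ut] /andP[v0 vt] uv.
have [uv'|vu] := leP u v.
  by apply: (H e eta) => //; move: uv; rewrite distrC ger0_norm ?subr_ge0.
rewrite distrC; apply: (H e eta) => //; first exact: ltW.
by move: uv; rewrite ger0_norm ?subr_ge0// ltW.
Qed.

Lemma unif_cont_max_before : unif_cont t (path_max phi 0).
Proof.
apply: unif_cont_from_left => e eta e0 eta0 H u v u0 uv vt vu.
have ut := le_trans uv vt.
have M := @path_max_mono 0 u 0 v (lexx _) (lexx _) u0 uv vt.
rewrite distrC ger0_norm ?subr_ge0// lerBlDr.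
apply: path_max_le => //; first exact: le_trans uv.
move=> w /andP[w0 wv]; have [wu|uw] := leP w u.
  by rewrite ler_wpDl ?(ltW e0)// path_max_ge// w0.
have H1 : phi u <= path_max phi 0 u by rewrite path_max_ge// u0 lexx.
have := H w u; rewrite w0 u0 ut (le_trans wv vt) => /(_ isT isT).
rewrite ger0_norm ?subr_ge0 ?(ltW uw)// => /(_ _).
by rewrite ler_norml => K; have /andP[] := K ltac:(lra); lra.
Qed.

Lemma unif_cont_max_after : unif_cont t (path_max phi ^~ t).
Proof.
apply: unif_cont_from_left => e eta e0 eta0 H u v u0 uv vt vu.
have v0 := le_trans u0 uv.
have M := @path_max_mono v t u t u0 uv vt (lexx _) (lexx _).
rewrite ger0_norm ?subr_ge0// lerBlDr.
apply: path_max_le => //; first exact: le_trans vt.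
move=> w /andP[uw wt]; have [wv|vw] := leP v w.
  by rewrite ler_wpDl ?(ltW e0)// path_max_ge// wv.
have H1 : phi v <= path_max phi v t by rewrite path_max_ge// lexx.
have := H w v; rewrite v0 vt wt (le_trans u0 uw) => /(_ isT isT).
rewrite distrC ger0_norm ?subr_ge0 ?(ltW vw)// => /(_ _).
by rewrite ler_norml => K; have /andP[] := K ltac:(lra); lra.
Qed.

Lemma unif_cont_pitman : unif_cont t (pitman phi).
Proof.
apply: (unif_contD (phi := fun s => 2 * path_max phi 0 s) (psi := fun s => - phi s)).
  by apply: unif_contM2; exact: unif_cont_max_before.
exact: unif_contN.
Qed.

Lemma unif_cont_calM : unif_cont t (calM t phi).
Proof.
have U1 := unif_contD unif_cont_max_before (unif_contN unif_cont_max_after).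
have U2 := unif_contD (@unif_cont_cst t (phi t)) U1.
have U3 := unif_contD (unif_contD up (@unif_cont_cst t (- phi t)))
  (unif_contN (unif_cont_norm U2)).
have U4 := unif_contD U3 (unif_cont_norm U1).
apply: (unif_cont_lip ltr01 U4) => u v.
by rewrite mul1r /calM !addrA.
Qed.

End one_path.

Lemma path_max_split t phi s : unif_cont t phi -> 0 <= s <= t ->
  path_max phi 0 t = Num.max (path_max phi 0 s) (path_max phi s t).
Proof.
move=> up /andP[s0 st]; apply/eqP; rewrite eq_le; apply/andP; split; last first.
  by rewrite ge_max !(path_max_mono up)// (le_trans s0).
apply: (path_max_le up) => //; first exact: le_trans st.
move=> u /andP[u0 ut]; rewrite le_max; have [us|su] := leP u s.
  by rewrite (path_max_ge up)// u0.
by rewrite [X in _ || X](path_max_ge up) ?orbT// (ltW su).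
Qed.

(** If the running maximum at time [s] is not yet the overall one, then later on
    the transformed path [2 * S - phi >= S] comes back arbitrarily close to its
    value at the times where [phi] equals its running maximum, which happens at
    every level just above the maximum at time [s]. Otherwise [S] is constant
    after [s] and the infimum is read off directly. *)
Lemma pitman_future_inf t phi s : unif_cont t phi -> 0 <= s <= t ->
  let I := - path_max (fun u => - pitman phi u) s t in
  [\/ path_max phi 0 s = path_max phi 0 t /\ I = 2 * path_max phi 0 t - path_max phi s t
    | [/\ path_max phi 0 s < path_max phi 0 t, path_max phi s t = path_max phi 0 t &
          I = path_max phi 0 s]].
Proof.
move=> up s0t I; have /andP[s0 st] := s0t.
have uP : unif_cont t (fun u => - pitman phi u) by exact/unif_contN/unif_cont_pitman.
have max_le u : s <= u <= t -> path_max phi 0 s <= path_max phi 0 u <= path_max phi 0 t.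
  move=> /andP[su ut]; have u0 := le_trans s0 su.
  by rewrite !(path_max_mono up).
have [Hlt|Hge] := ltP (path_max phi 0 s) (path_max phi 0 t); last first.
  left; have E : path_max phi 0 s = path_max phi 0 t.
    by apply/eqP; rewrite eq_le Hge (path_max_mono up).
  have Eu u : s <= u <= t -> path_max phi 0 u = path_max phi 0 t.
    by move=> /max_le; rewrite E -eq_le => /eqP.
  split=> //; rewrite /I; apply/eqP; rewrite eqr_oppLR opprB eq_le; apply/andP; split.
    have [u us ->] := path_max_attained uP s0 st (lexx t).
    rewrite /pitman Eu// opprB lerD2r.
    by apply: (path_max_ge up).
  have [u us ->] := path_max_attained up s0 st (lexx t).
  rewrite -(Eu _ us); have := path_max_ge uP s0 (lexx t) us.
  by rewrite /pitman opprB.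
right; split => //.
  have := path_max_split up s0t; case: (leP (path_max phi 0 s) (path_max phi s t)) => _ //.
  by move=> E; move: Hlt; rewrite E ltxx.
rewrite /I; apply/eqP; rewrite eqr_oppLR eq_le; apply/andP; split.
  have [u us ->] := path_max_attained uP s0 st (lexx t).
  have /andP[H1 _] := max_le _ us.
  have /andP[su ut] := us.
  have H2 : phi u <= path_max phi 0 u by rewrite (path_max_ge up)// lexx (le_trans s0 su).
  by rewrite lerN2 /pitman; lra.
apply/ler_addgt0Pr => e e0.
pose lev := Num.min (path_max phi 0 s + e) (path_max phi 0 t).
have lev1 : path_max phi 0 s < lev by rewrite lt_min ltrDl e0.
have cS := unif_cont_subinterval s0 (lexx t) (unif_cont_max_before up).
have [|u us Eu] := @IVT R (path_max phi 0) s t lev st cS.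
  by rewrite (min_idPl (ltW Hlt)) (max_idPr (ltW Hlt)) (ltW lev1) ge_min lexx orbT.
have {us} /andP[su ut] : s <= u <= t by move: us; rewrite in_itv.
have [v /andP[v0 vu] Ev] := path_max_attained up (lexx 0) (le_trans s0 su) ut.
have vt := le_trans vu ut.
have sv : s <= v.
  rewrite leNgt; apply/negP => vs.
  have : phi v <= path_max phi 0 s by rewrite (path_max_ge up)// v0 ltW.
  by rewrite -Ev Eu leNgt lev1.
have Sv : path_max phi 0 v = lev.
  apply/eqP; rewrite eq_le; apply/andP; split.
    by rewrite -Eu (path_max_mono up).
  by rewrite -Eu Ev (path_max_ge up)// v0 lexx.
have := path_max_ge uP s0 (lexx t) (introT andP (conj sv vt)).
rewrite /pitman Sv -Ev Eu => H.
have : lev <= path_max phi 0 s + e by rewrite ge_min lexx.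
lra.
Qed.

(** The path with transform [p] and terminal value [b]: its running maximum at
    time [s] is the smaller of the overall maximum [(p t + b) / 2] and of the
    future infimum of [p]. *)
Definition from_pitman t (p : R -> R) b s : R :=
  2 * Num.min ((p t + b) / 2) (- path_max (fun u => - p u) s t) - p s.

Lemma path_from_pitman t phi s : unif_cont t phi -> 0 <= s <= t ->
  phi s = from_pitman t (pitman phi) (phi t) s.
Proof.
move=> up st; rewrite /from_pitman.
have -> : (pitman phi t + phi t) / 2 = path_max phi 0 t by rewrite /pitman; field.
have [[E ->]|[Hlt _ ->]] := pitman_future_inf up st.
  have H : path_max phi s t <= path_max phi 0 t.
    by rewrite (path_max_split up st) le_max lexx orbT.
  by rewrite (min_idPl _); [rewrite /pitman E; ring|lra].
by rewrite (min_idPr (ltW Hlt)) /pitman; ring.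
Qed.

(** The key identity: [calM t phi] is the path with the same Pitman transform as
    [phi] and the opposite terminal value. *)
Lemma calM_from_pitman t phi s : unif_cont t phi -> 0 <= s <= t ->
  calM t phi s = from_pitman t (pitman phi) (- phi t) s.
Proof.
move=> up st; rewrite /from_pitman /calM.
have -> : (pitman phi t - phi t) / 2 = path_max phi 0 t - phi t by rewrite /pitman; field.
have [[E ->]|[Hlt E ->]] := pitman_future_inf up st.
  have H : path_max phi s t <= path_max phi 0 t.
    by rewrite (path_max_split up st) le_max lexx orbT.
  rewrite /pitman E (@ger0_norm _ (path_max phi 0 t - path_max phi s t)) ?subr_ge0//.
  case: leP => H1.
    by rewrite ger0_norm; [ring|lra].
  by rewrite ltr0_norm; [ring|lra].
rewrite E /pitman (@ltr0_norm _ (path_max phi 0 s - path_max phi 0 t)) ?subr_lt0//.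
case: leP => H1.
  by rewrite ger0_norm; [ring|lra].
by rewrite ltr0_norm; [ring|lra].
Qed.

Fixpoint grid_max psi a step n : R :=
  if n is n'.+1 then Num.max (grid_max psi a step n') (psi (a + n%:R * step)) else psi a.

Lemma grid_max_close t psi a b step n e eta : unif_cont t psi ->
  (forall u v, 0 <= u <= t -> 0 <= v <= t -> `|u - v| <= eta -> `|psi u - psi v| <= e) ->
  0 <= a -> 0 <= step -> step <= eta -> a + n%:R * step <= b -> b <= t ->
  b <= a + n%:R * step + eta ->
  `|grid_max psi a step n - path_max psi a b| <= e.
Proof.
move=> up mod a0 st0 steta nb bt bn.
have e0 : 0 <= e.
  have aa : 0 <= a <= t.
    by rewrite a0 (le_trans _ bt)// (le_trans _ nb)// lerDl mulr_ge0.
  have := mod a a aa aa; rewrite !subrr normr0; apply.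
  exact: le_trans steta.
have ab : a <= b by rewrite (le_trans _ nb)// lerDl mulr_ge0.
have pt k : (k <= n)%N -> a <= a + k%:R * step <= b.
  move=> kn; rewrite lerDl mulr_ge0//= (le_trans _ nb)// lerD2l ler_wpM2r// ler_nat//.
have H1 k : (k <= n)%N -> grid_max psi a step k <= path_max psi a b.
  elim: k => [|k IH] kn /=; first by rewrite (path_max_ge up)// lexx.
  by rewrite ge_max IH ?(ltnW kn)//= (path_max_ge up)// pt.
have H2 k : (k <= n)%N -> forall u, a <= u -> u <= b -> u <= a + k%:R * step + eta ->
    psi u <= grid_max psi a step k + e.
  have near x u : a <= x -> x <= b -> a <= u -> u <= b -> `|u - x| <= eta -> psi u <= psi x + e.
    move=> ax xb au ub ux.
    have := mod u x; rewrite (le_trans a0 au) (le_trans ub bt) (le_trans a0 ax) (le_trans xb bt).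
    by move=> /(_ isT isT ux); rewrite ler_norml => /andP[_]; lra.
  elim: k => [|k IH] kn u au ub.
    rewrite mul0r addr0 => ua; apply: near => //.
    by rewrite ger0_norm ?subr_ge0//; lra.
  move=> uk /=; have [u1|u1] := leP u (a + k%:R * step + eta).
    by apply: (le_trans (IH (ltnW kn) u au ub u1)); rewrite lerD2r le_max lexx.
  have /andP[p1 p2] := pt _ kn.
  have : psi u <= psi (a + k.+1%:R * step) + e.
    apply: near => //; rewrite ler_norml; apply/andP; split; last by lra.
    move: u1; rewrite -natr1; lra.
  by move=> H; apply: (le_trans H); rewrite lerD2r le_max lexx orbT.
rewrite ler_norml; apply/andP; split.
  have [u /andP[au ub] ->] := path_max_attained up a0 ab bt.
  have := H2 n (leqnn n) u au ub (le_trans ub bn); lra.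
have := H1 n (leqnn n); lra.
Qed.

End Paths.

(** * Functionals of the transformed path at finitely many times *)

Section TestFunctionals.
Context {R : realType}.
Implicit Types (phi : R -> R) (F : nat -> R -> R) (tests : seq (R * (R -> R))).

Lemma path_value_grid phi delta F G k n :
  path_value [seq F i | i <- iota k n] G (fun j => phi (j.+1%:R * delta) - phi (j%:R * delta))
    k (grid_max phi 0 delta k) (phi (k%:R * delta)) =
  (\prod_(k <= i < k + n) F i (2 * grid_max phi 0 delta i - phi (i%:R * delta)))
  * G (grid_max phi 0 delta (k + n)) (phi ((k + n)%:R * delta)).
Proof.
elim: n k => [|n IH] k; first by rewrite /= addn0 big_geq// mul1r.
rewrite /= subrKC; have := IH k.+1.
rewrite /= add0r addSn addnS => ->.
by rewrite [in RHS]big_ltn ?ltnS ?leq_addr// mulrA.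
Qed.

Lemma unit_lip_cst1 : unit_lip 0 (fun=> 1 : R).
Proof. by split => // [_|x y]; [rewrite ler01 lexx|rewrite subrr normr0 mul0r]. Qed.

Lemma unit_lipM l l' (f g : R -> R) : unit_lip l f -> unit_lip l' g -> unit_lip (l + l') (fun x => f x * g x).
Proof.
move=> [l0 f01 fl] [l0' g01 gl]; split; first exact: addr_ge0.
  move=> x; have /andP[? ?] := f01 x; have /andP[? ?] := g01 x.
  by rewrite mulr_ge0//= mulr_ile1.
by move=> x y; rewrite mulrDl; apply: prod_dist.
Qed.

Lemma unit_lip_prod (l : R) (f : nat -> R -> R) (Q : pred nat) n :
  (forall k, unit_lip l (f k)) ->
  unit_lip (\sum_(k < n) (if Q k then l else 0)) (fun x => \prod_(k < n) (if Q k then f k x else 1)).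
Proof.
move=> tf; elim: n => [|n IH].
  have -> : (fun x : R => \prod_(k < 0) (if Q k then f k x else 1)) = fun=> 1.
    by apply/funext => x; rewrite big_ord0.
  by rewrite big_ord0; exact: unit_lip_cst1.
have -> : (fun x : R => \prod_(k < n.+1) (if Q k then f k x else 1)) =
    fun x => \prod_(k < n) (if Q k then f k x else 1) * (if Q n then f n x else 1).
  by apply/funext => x; rewrite big_ord_recr.
rewrite big_ord_recr/=; apply: unit_lipM => //.
by case: (Q n) => //; exact: unit_lip_cst1.
Qed.

Lemma unit_lips_iota F (L : nat -> R) k n : (forall i, unit_lip (L i) (F i)) ->
  unit_lips [seq F i | i <- iota k n] (\sum_(k <= i < k + n) L i).
Proof.
move=> H; elim: n k => [|n IH] k; first by rewrite addn0 big_geq.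
rewrite /=; exists (L k), (\sum_(k.+1 <= i < k.+1 + n) L i); split => //.
by rewrite addSn addnS big_ltn// ltnS leq_addr.
Qed.

Lemma prod_by_index (N n : nat) (idx : nat -> nat) (a : nat -> nat -> R) :
  (forall k, (idx k <= N)%N) ->
  \prod_(0 <= i < N.+1) \prod_(k < n) (if idx k == i then a k i else 1) =
  \prod_(k < n) a k (idx k).
Proof.
move=> idxN; rewrite big_mkord exchange_big/=; apply: eq_bigr => k _.
rewrite -big_mkcond/= (big_pred1 (inord (idx k)))/=.
  by rewrite inordK// ltnS.
by move=> i; rewrite /= -val_eqE/= inordK ?ltnS// eq_sym.
Qed.

Lemma sum_by_index (N n : nat) (idx : nat -> nat) (a : R) :
  (forall k, (idx k <= N)%N) ->
  \sum_(0 <= i < N.+1) \sum_(k < n) (if idx k == i then a else 0) = a *+ n.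
Proof.
move=> idxN; rewrite big_mkord exchange_big/= -[in RHS](card_ord n) -sumr_const.
apply: eq_bigr => k _.
rewrite -big_mkcond/= (big_pred1 (inord (idx k)))//.
by move=> i; rewrite /= -val_eqE/= inordK ?ltnS// eq_sym.
Qed.

Lemma prod_close (n : nat) (a b : nat -> R) e : (forall i, 0 <= a i <= 1) ->
  (forall i, 0 <= b i <= 1) -> (forall i, (i < n)%N -> `|a i - b i| <= e) ->
  `|\prod_(i < n) a i - \prod_(i < n) b i| <= n%:R * e.
Proof.
move=> a01 b01; elim: n => [|n IH] H; first by rewrite !big_ord0 subrr normr0 mul0r.
rewrite !big_ord_recr/= -[n.+1%:R]natr1 mulrDl mul1r; apply: prod_dist => //.
- elim: n {IH H} => [|n IH]; first by rewrite big_ord0 ler01 lexx.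
  have /andP[? ?] := a01 n; have /andP[? ?] := IH.
  by rewrite big_ord_recr/= mulr_ge0//= mulr_ile1.
- by apply: IH => i ni; apply: H; exact: ltnW.
- exact: H.
Qed.

Definition grid_index (t : R) N (s : R) := Num.truncn (s * N%:R / t).

Lemma grid_index_itv t N s : 0 < t -> (0 < N)%N -> 0 <= s ->
  (grid_index t N s)%:R * (t / N%:R) <= s < (grid_index t N s)%:R * (t / N%:R) + t / N%:R.
Proof.
move=> t0 N0 s0; have Nn0 : 0 < N%:R :> R by rewrite ltr0n.
have x0 : 0 <= s * N%:R / t by rewrite divr_ge0 ?mulr_ge0// ltW.
have := truncn_itv x0; rewrite -/(grid_index t N s) => /andP[H1 H2].
have E : s = (s * N%:R / t) * (t / N%:R) by field; rewrite !gt_eqF.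
have tN : 0 < t / N%:R by rewrite divr_gt0.
apply/andP; split; first by rewrite [leRHS]E ler_pM2r.
have -> : (grid_index t N s)%:R * (t / N%:R) + t / N%:R = (grid_index t N s).+1%:R * (t / N%:R).
  by rewrite -natr1; ring.
by rewrite [ltLHS]E ltr_pM2r.
Qed.

Lemma grid_index_le t N s : 0 < t -> (0 < N)%N -> 0 <= s <= t -> (grid_index t N s <= N)%N.
Proof.
move=> t0 N0 /andP[s0 st]; have Nn0 : 0 < N%:R :> R by rewrite ltr0n.
rewrite -(ler_nat R); have /andP[H _] := grid_index_itv t0 N0 s0.
have tN : 0 < t / N%:R by rewrite divr_gt0.
rewrite -(ler_pM2r tN); apply: (le_trans H); apply: (le_trans st).
by rewrite mulrC divfK// gt_eqF.
Qed.

Definition grid_functional t N n (s : nat -> R) (f : nat -> R -> R) (g : R -> R) phi :=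
  (\prod_(k < n) f k (2 * grid_max phi 0 (t / N%:R) (grid_index t N (s k)) -
      phi ((grid_index t N (s k))%:R * (t / N%:R)))) * g (phi t).

Definition path_functional t n (s : nat -> R) (f : nat -> R -> R) (g : R -> R) phi :=
  (\prod_(k < n) f k (pitman phi (s k))) * g (phi t).

(** The product of the tests attached to grid time [i]; it is [1] at all but
    finitely many grid times, uniformly in the mesh. *)
Definition index_test t N n (s : nat -> R) (f : nat -> R -> R) i x : R :=
  \prod_(k < n) (if grid_index t N (s k) == i then f k x else 1).

Lemma path_value_grid_functional t N n s f g phi : 0 < t -> (0 < N)%N ->
  (forall k, 0 <= s k <= t) -> phi 0 = 0 ->
  path_value [seq index_test t N n s f i | i <- iota 0 N]
    (pitman_end (index_test t N n s f N) g)
    (fun j => phi (j.+1%:R * (t / N%:R)) - phi (j%:R * (t / N%:R))) 0 0 0 =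
  grid_functional t N n s f g phi.
Proof.
move=> t0 N0 s0 phi0.
have := path_value_grid phi (t / N%:R) (index_test t N n s f) (pitman_end (index_test t N n s f N) g) 0 N.
rewrite /= mul0r phi0 => ->; rewrite add0n.
have Nn0 : N%:R != 0 :> R by rewrite pnatr_eq0 -lt0n.
have -> : N%:R * (t / N%:R) = t by rewrite mulrC divfK.
rewrite /pitman_end mulrA /grid_functional; congr (_ * _).
rewrite -(prod_by_index (N := N) n (idx := fun k => grid_index t N (s k)) (fun k i =>
  f k (2 * grid_max phi 0 (t / N%:R) i - phi (i%:R * (t / N%:R))))); last first.
  by move=> k; exact: grid_index_le.
rewrite [RHS]big_nat_recr//=; congr (_ * _).
by have -> : N%:R * (t / N%:R) = t by rewrite mulrC divfK.
Qed.

Lemma functional_close t N n s f g phi (l e eta : R) : 0 < t -> (0 < N)%N ->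
  (forall k, 0 <= s k <= t) -> (forall k, unit_lip l (f k)) -> (forall x, 0 <= g x <= 1) ->
  unif_cont t phi -> 0 <= e ->
  (forall u v, 0 <= u <= t -> 0 <= v <= t -> `|u - v| <= eta -> `|phi u - phi v| <= e) ->
  t / N%:R <= eta ->
  `|grid_functional t N n s f g phi - path_functional t n s f g phi| <= n%:R * (l * (3 * e)).
Proof.
move=> t0 N0 st tf g01 up e0 mod tN.
have Nn0 : 0 < N%:R :> R by rewrite ltr0n.
have dN : 0 < t / N%:R by rewrite divr_gt0.
rewrite /grid_functional /path_functional -mulrBl normrM.
have /andP[gt0 gt1] := g01 (phi t).
rewrite (ger0_norm gt0).
apply: (@le_trans _ _ (n%:R * (l * (3 * e)) * 1)); last by rewrite mulr1.
apply: ler_pM => //.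
apply: (prod_close (a := fun k => f k (2 * grid_max phi 0 (t / N%:R) (grid_index t N (s k)) -
      phi ((grid_index t N (s k))%:R * (t / N%:R)))) (b := fun k => f k (pitman phi (s k)))).
- by move=> i; have [_ + _] := tf i; exact.
- by move=> i; have [_ + _] := tf i; exact.
move=> k _; have [l0 _ fl] := tf k.
apply: (le_trans (fl _ _)); rewrite ler_wpM2l//.
have /andP[s0 s1] := st k.
have /andP[i1 i2] := grid_index_itv t0 N0 s0.
set i := grid_index t N (s k) in i1 i2 *.
have G1 : `|grid_max phi 0 (t / N%:R) i - path_max phi 0 (s k)| <= e.
  apply: (grid_max_close up mod) => //; rewrite ?add0r//; first exact: ltW.
  by apply: (le_trans (ltW i2)); rewrite lerD2l.
have G2 : `|phi (i%:R * (t / N%:R)) - phi (s k)| <= e.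
  apply: mod => //.
    by rewrite mulr_ge0 ?(ltW dN)//= (le_trans i1).
  rewrite distrC ger0_norm ?subr_ge0//.
  by apply: le_trans tN; rewrite lerBlDl ltW.
rewrite /pitman.
have -> : 2 * grid_max phi 0 (t / N%:R) i - phi (i%:R * (t / N%:R)) -
  (2 * path_max phi 0 (s k) - phi (s k)) =
  2 * (grid_max phi 0 (t / N%:R) i - path_max phi 0 (s k)) -
  (phi (i%:R * (t / N%:R)) - phi (s k)) by ring.
apply: (le_trans (ler_normB _ _)); rewrite normrM ger0_norm//.
have -> : 3 * e = 2 * e + e by ring.
by rewrite lerD// ler_wpM2l.
Qed.

End TestFunctionals.

Lemma dist_chain4 {R : realType} (a a' b b' e : R) :
  `|a - a'| <= e / 4 -> `|b - b'| <= e / 4 -> `|a' - b'| <= e / 2 -> `|a - b| <= e.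
Proof. by rewrite !ler_norml => /andP[? ?] /andP[? ?] /andP[? ?]; apply/andP; split; lra. Qed.

(** * Passage to the limit in the mesh *)

Section Limits.
Context {R : realType} d (T : measurableType d).

Lemma unit_Rintegral_cvg (P : probability T R) (f_ : nat -> T -> R) (f : T -> R) :
  (forall n, measurable_fun setT (f_ n)) -> (forall n w, 0 <= f_ n w <= 1) ->
  (forall w, f_ n w @[n --> \oo] --> f w) ->
  (fun n => \int[P]_w f_ n w) @ \oo --> \int[P]_w f w.
Proof.
move=> mf f01 cf.
have mlim : measurable_fun setT f by apply: measurable_fun_cvg mf _ => w _; exact: cf.
have flim01 w : 0 <= f w <= 1.
  apply/andP; split.
    rewrite -(cvg_lim (@Rhausdorff R) (cf w)); apply: limr_ge; first exact: cvgP (cf w).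
    by apply: nearW => n; have /andP[] := f01 n w.
  rewrite -(cvg_lim (@Rhausdorff R) (cf w)); apply: limr_le; first exact: cvgP (cf w).
  by apply: nearW => n; have /andP[] := f01 n w.
apply: fine_cvg; rewrite fineK; last first.
  by apply: integrable_fin_num => //; exact: (unit_integrable P mlim flim01).
have mfE n : measurable_fun setT (fun w => (f_ n w)%:E) by exact/measurable_EFinP.
have mlE : measurable_fun setT (fun w => (f w)%:E) by exact/measurable_EFinP.
have cE : {ae P, forall w, setT w -> (f_ n w)%:E @[n --> \oo] --> (f w)%:E}.
  by apply: aeW => w _; apply: cvg_EFin; [exact: nearW|exact: cf].
have bE : {ae P, forall w n, setT w -> (`|(f_ n w)%:E| <= 1)%E}.
  apply: aeW => w n _ /=; have /andP[? ?] := f01 n w.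
  by rewrite lee_fin ger0_norm.
have ic : P.-integrable setT (cst 1%E) by exact: finite_measure_integrable_cst.
by have [_ _] := dominated_convergence measurableT mfE mlE cE ic bE.
Qed.

Lemma measurable_grid_max (X : T -> R -> R) a step n :
  (forall k, (k <= n)%N -> measurable_fun setT (fun w => X w (a + k%:R * step))) ->
  measurable_fun setT (fun w => grid_max (X w) a step n).
Proof.
elim: n => [|n IH] H /=; first by have := H 0 isT; rewrite mul0r addr0.
apply: measurable_maxr; last exact: H.
by apply: IH => k kn; apply: H; exact: leqW.
Qed.

End Limits.

Section Convergence.
Context {R : realType}.

Lemma grid_max_cvg t (psi : R -> R) a b : unif_cont t psi -> 0 <= a -> a <= b -> b <= t ->
  grid_max psi a ((b - a) / n%:R) n @[n --> \oo] --> path_max psi a b.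
Proof.
move=> up a0 ab bt; apply/cvgrPdist_le => e e0.
have [eta eta0 mod] := up e e0.
near=> n.
have n0 : (0 < n)%N by near: n; exact: nbhs_infty_gt.
have nn0 : 0 < n%:R :> R by rewrite ltr0n.
have E : a + n%:R * ((b - a) / n%:R) = b by field; rewrite gt_eqF.
rewrite distrC; apply: (grid_max_close up mod) => //; rewrite ?E//.
- by rewrite divr_ge0// subr_ge0.
- rewrite ler_pdivrMr// mulrC -ler_pdivrMr//.
  by near: n; exact: nbhs_infty_ger.
- by rewrite lerDl ltW.
Unshelve. all: by end_near. Qed.

Lemma grid_functional_cvg t n s f g (phi : R -> R) (l : R) : 0 < t ->
  (forall k, 0 <= s k <= t) -> (forall k, unit_lip l (f k)) -> (forall x, 0 <= g x <= 1) ->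
  unif_cont t phi ->
  grid_functional t N n s f g phi @[N --> \oo] --> path_functional t n s f g phi.
Proof.
move=> t0 st tf g01 up; apply/cvgrPdist_le => e e0.
have l0 : 0 <= l by case: (tf 0).
pose e1 := e / (3 * (n%:R * l + 1)).
have D0 : 0 < 3 * (n%:R * l + 1) by rewrite mulr_gt0// ltr_wpDl// mulr_ge0.
have e10 : 0 < e1 by rewrite divr_gt0.
have [eta eta0 mod] := up e1 e10.
near=> N.
have N0 : (0 < N)%N by near: N; exact: nbhs_infty_gt.
have Nn0 : 0 < N%:R :> R by rewrite ltr0n.
rewrite distrC.
apply: (le_trans (functional_close n t0 N0 st tf g01 up (ltW e10) mod _)).
  rewrite ler_pdivrMr// mulrC -ler_pdivrMr//.
  by near: N; exact: nbhs_infty_ger.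
have -> : n%:R * (l * (3 * e1)) = e * (n%:R * l / (n%:R * l + 1)).
  by rewrite /e1; field; rewrite gt_eqF// ltr_wpDl// mulr_ge0.
rewrite ler_piMr ?(ltW e0)// ler_pdivrMr ?mul1r ?lerDl//.
by rewrite ltr_wpDl// mulr_ge0.
Unshelve. all: by end_near. Qed.

Lemma grid_functional_unit t N n s f g (phi : R -> R) (l : R) :
  (forall k, unit_lip l (f k)) -> (forall x, 0 <= g x <= 1) ->
  0 <= grid_functional t N n s f g phi <= 1.
Proof.
move=> tf g01; rewrite /grid_functional; have /andP[? ?] := g01 (phi t).
set p := \prod_(k < n) _.
suff /andP[? ?] : 0 <= p <= 1 by rewrite mulr_ge0//= mulr_ile1.
rewrite /p; elim: n {p} => [|n IH]; first by rewrite big_ord0 ler01 lexx.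
rewrite big_ord_recr/=; have [_ + _] := tf n.
move=> /(_ (2 * grid_max phi 0 (t / N%:R) (grid_index t N (s n)) -
      phi ((grid_index t N (s n))%:R * (t / N%:R)))) /andP[? ?].
by have /andP[? ?] := IH; rewrite mulr_ge0//= mulr_ile1.
Qed.

End Convergence.

Section Symmetry.
Context {R : realType} d (T : measurableType d) (P : probability T R).
Variables (B : R -> {RV P >-> R}).
Hypothesis hB : standard_brownian_motion B.
Variables (t : R).
Hypothesis t0 : 0 < t.

Lemma drifted0 mu w : drifted B mu w 0 = 0.
Proof. by have [B0 _ _ _] := hB; rewrite /drifted B0 mulr0 addr0. Qed.

Lemma drifted_unif_cont mu w : unif_cont t (drifted B mu w).
Proof.
have [_ cB _ _] := hB.
have uB : unif_cont t (fun s => B s w).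
  apply: within_unif_cont; apply: continuous_subspaceW (cB w) => x /=.
  by rewrite !in_itv/= => /andP[->].
apply: unif_contD uB _ => e e0.
have M0 : 0 < `|mu| + 1 by rewrite ltr_wpDl.
exists (e / (`|mu| + 1)); first by rewrite divr_gt0.
move=> u v _ _; rewrite ler_pdivlMr// => H.
rewrite -mulrBr normrM mulrC; apply: le_trans H.
by rewrite ler_wpM2l// lerDl.
Qed.

Lemma drifted_measurable mu s : measurable_fun setT (fun w => drifted B mu w s).
Proof. exact: measurable_funD. Qed.

Lemma grid_functional_measurable mu N n s f g (l lg : R) :
  (forall k, unit_lip l (f k)) -> unit_lip lg g ->
  measurable_fun setT (fun w => grid_functional t N n s f g (drifted B mu w)).
Proof.
move=> tf tg; apply: measurable_funM.
  apply: measurable_prod => k _.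
  apply: (measurable2_pitman (unit_lip_measurable (tf k))); last exact: drifted_measurable.
  by apply: measurable_grid_max => i _; exact: drifted_measurable.
by apply: (measurableT_comp (unit_lip_measurable tg)); exact: drifted_measurable.
Qed.

(** Let the mesh tend to [0] in [grid_symmetry], then [b]. *)
Lemma pitman_test_symmetry mu n s f g (l lg : R) :
  (forall k, 0 <= s k <= t) -> (forall k, unit_lip l (f k)) -> unit_lip lg g ->
  \int[P]_w path_functional t n s f g (drifted B mu w) =
  \int[P]_w path_functional t n s f (fun x => g (- x)) (drifted B (- mu) w).
Proof.
move=> st tf tg.
have tg' := unit_lip_opp tg.
have [_ g01 _] := tg.
have cv m g' : unit_lip lg g' ->
    (fun N => \int[P]_w grid_functional t N n s f g' (drifted B m w)) @ \oo -->
    \int[P]_w path_functional t n s f g' (drifted B m w).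
  move=> tg1; have [_ g101 _] := tg1; apply: unit_Rintegral_cvg.
  - by move=> N; exact: grid_functional_measurable tf tg1.
  - by move=> N w; exact: grid_functional_unit tf g101.
  - by move=> w; apply: (grid_functional_cvg (l := l)) => //; exact: drifted_unif_cont.
have l0 : 0 <= l by case: (tf 0).
have gm m N g' : (0 < N)%N ->
    grid_mean B t N [seq index_test t N n s f i | i <- iota 0 N] (index_test t N n s f N) g' m =
    \int[P]_w grid_functional t N n s f g' (drifted B m w).
  move=> N0; rewrite /grid_mean; apply: eq_Rintegral => w _.
  rewrite -(path_value_grid_functional n f g' t0 N0 st (drifted0 m w)); congr (path_value _ _ _ _ _ _).
  by apply/funext => j; rewrite /incr /drifted /grid_step -natr1; ring.
apply/eqP; rewrite -subr_eq0 -normr_le0; apply/ler_addgt0Pr => e e0; rewrite add0r.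
have [L LE] : exists L : R, L = l *+ n by exists (l *+ n).
have L0 : 0 <= L by rewrite LE mulrn_wge0.
have e3 : 0 < e / 4 by rewrite divr_gt0.
pose b := e / (64 * (L + 1)).
have D0 : 0 < 64 * (L + 1) by rewrite mulr_gt0// ltr_wpDl.
have b0 : 0 < b by rewrite divr_gt0.
have b4 : 0 < b ^+ 4 by rewrite exprn_gt0.
have /cvgrPdist_le /(_ _ e3) C1 := cv mu g tg.
have /cvgrPdist_le /(_ _ e3) C2 := cv (- mu) _ tg'.
near \oo => N.
have N0 : (0 < N)%N by near: N; exact: nbhs_infty_gt.
have Nn0 : 0 < N%:R :> R by rewrite ltr0n.
have H1 : `|\int[P]_w path_functional t n s f g (drifted B mu w) -
   \int[P]_w grid_functional t N n s f g (drifted B mu w)| <= e / 4.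
  by near: N; exact: C1.
have H2 : `|\int[P]_w path_functional t n s f (fun x => g (- x)) (drifted B (- mu) w) -
   \int[P]_w grid_functional t N n s f (fun x => g (- x)) (drifted B (- mu) w)| <= e / 4.
  by near: N; exact: C2.
have tI i : unit_lip (\sum_(k < n) (if grid_index t N (s k) == i then l else 0))
    (index_test t N n s f i).
  exact: (unit_lip_prod (fun k => grid_index t N (s k) == i) n tf).
have mub : `|mu| * grid_step t N <= b.
  rewrite /grid_step mulrA ler_pdivrMr// [leRHS]mulrC -ler_pdivrMr//.
  by near: N; exact: nbhs_infty_ger.
have := grid_symmetry hB t0 N0 b0 mub (unit_lips_iota 0 N tI) _ (tI N) tg.
rewrite size_map size_iota => /(_ erefl).
rewrite !gm// add0n -big_nat_recr//= (sum_by_index n (idx := fun k => grid_index t N (s k))); last by move=> k; exact: grid_index_le.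
rewrite -LE => H3.
have H4 : 16 * b * L <= e / 4.
  have -> : 16 * b * L = e / 4 * (L / (L + 1)).
    by rewrite /b; field; rewrite gt_eqF// ltr_wpDl.
  by rewrite ler_piMr ?(ltW e3)// ler_pdivrMr ?ltr_wpDl// mul1r lerDl.
have H5 : 24 * 33 ^+ 2 * t ^+ 2 / (N%:R * b ^+ 4) <= e / 4.
  rewrite (ler_pdivrMr _ _ (mulr_gt0 Nn0 b4)) [leRHS]mulrCA -(ler_pdivrMr _ _ (mulr_gt0 e3 b4)).
  by near: N; exact: nbhs_infty_ger.
apply: (dist_chain4 H1 H2); apply: (le_trans H3).
by have -> : e / 2 = e / 4 + e / 4 by [field]; exact: lerD.
Unshelve. all: by end_near. Qed.

End Symmetry.

(** * Laws on pairs of a path and a terminal value *)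

Section Cylinders.
Context {R : realType}.

(** As [j] grows these increase to the indicator of [x < a]. *)
Definition ramp (j : nat) (a x : R) : R := Num.min 1 (Num.max 0 (j%:R * (a - x))).

Lemma ramp_unit_lip j a : unit_lip j%:R (ramp j a).
Proof.
split => // [x|x y].
  by rewrite /ramp le_min ler01 le_max lexx/= ge_min lexx.
have H : `|j%:R * (a - x) - j%:R * (a - y)| <= j%:R * `|x - y|.
  have -> : j%:R * (a - x) - j%:R * (a - y) = j%:R * (y - x) by ring.
  by rewrite normrM normr_nat distrC.
apply: le_trans H; rewrite /ramp.
move: (j%:R * (a - x)) (j%:R * (a - y)) => u v.
have clip (w : R) : Num.min 1 (Num.max 0 w) = (if w <= 0 then 0 else (if w <= 1 then w else 1)).
  case: (leP w 0) => w0; first by rewrite (min_idPr ler01).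
  by case: (leP 1 w) => w1; case: (leP w 1) => w1'; lra.
rewrite !clip ler_norml; have h1 := ler_norm (u - v); have h2 := ler_norm (v - u).
rewrite (distrC v u) in h2.
by case: (leP u 0) => ?; case: (leP v 0) => ?; case: (leP u 1) => ?; case: (leP v 1) => ?;
  apply/andP; split; lra.
Qed.

Lemma ramp_cvg a x : ramp j a x @[j --> \oo] --> (if x < a then 1 else 0 : R).
Proof.
case: ifPn => [xa|]; last first.
  rewrite -leNgt => ax; have -> : (fun j => ramp j a x) = fun=> 0; last exact: cvg_cst.
  apply/funext => j; rewrite /ramp (max_idPl _) ?(min_idPr ler01)//.
  by rewrite mulr_ge0_le0// subr_le0.
apply/cvgrPdist_le => e e0; near=> j.
rewrite /ramp (min_idPl _); first by rewrite subrr normr0 ltW.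
rewrite le_max; apply/orP; right.
rewrite -ler_pdivrMr ?subr_gt0//.
by near: j; exact: nbhs_infty_ger.
Unshelve. all: by end_near. Qed.

Lemma prod_cvg n (a : nat -> nat -> R) (b : nat -> R) :
  (forall k, a j k @[j --> \oo] --> b k) ->
  (fun j => \prod_(k < n) a j k) @ \oo --> \prod_(k < n) b k.
Proof.
move=> H; elim: n => [|n IH].
  have -> : (fun j => \prod_(k < 0) a j k) = fun=> 1 by apply/funext => j; rewrite big_ord0.
  by rewrite big_ord0; exact: cvg_cst.
have -> : (fun j => \prod_(k < n.+1) a j k) = fun j => \prod_(k < n) a j k * a j n.
  by apply/funext => j; rewrite big_ord_recr.
by rewrite big_ord_recr/=; apply: cvgM; [exact: IH|exact: H].
Qed.

Lemma prod_indic n (p : nat -> bool) : \prod_(k < n) (if p k then 1 else 0 : R) =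
  if [forall k : 'I_n, p k] then 1 else 0.
Proof.
case: ifPn => [/forallP H|]; first by apply: big1 => k _; rewrite H.
by rewrite negb_forall => /existsP[k /negbTE pk]; rewrite (bigD1 k)//= pk mul0r.
Qed.

Definition path_with_end : Type := ((R -> R) * R)%type.
HB.instance Definition _ := Pointed.on path_with_end.

Definition cylinder n (s a : nat -> R) (b : R) : set path_with_end :=
  [set z | (forall k, (k < n)%N -> z.1 (s k) < a k) /\ z.2 < b].

Definition cylinders (t : R) : set (set path_with_end) :=
  [set C | exists n s a b, (forall k, 0 <= s k <= t) /\ C = cylinder n s a b].

Lemma cylinders_setI t : setI_closed (cylinders t).
Proof.
move=> _ _ [n [s [a [b [st ->]]]]] [n' [s' [a' [b' [st' ->]]]]].
exists (n + n')%N, (fun k => if (k < n)%N then s k else s' (k - n)%N),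
  (fun k => if (k < n)%N then a k else a' (k - n)%N), (Num.min b b'); split.
  by move=> k; case: ifP.
apply/seteqP; split => [z [[H1 H2] [H3 H4]]|z [H1]].
  split; last by rewrite lt_min H2.
  move=> k kn; case: ifPn => [/H1//|]; rewrite -leqNgt => nk.
  by apply: H3; rewrite ltn_subLR.
rewrite lt_min => /andP[H2 H3]; split; split => // k kn.
  by have := H1 k (ltn_addr _ kn); rewrite kn.
by have := H1 (n + k)%N; rewrite /= ltn_add2l (ltnNge (n + k) n) leq_addr/= addKn; exact.
Qed.

Notation OG t := (g_sigma_algebraType (cylinders t)).

Lemma cylinders_cover t : 0 <= t -> exists g : nat -> set path_with_end,
  (forall j, cylinders t (g j)) /\ \bigcup_j g j = setT.
Proof.
move=> t0; exists (fun j => cylinder 0 (fun=> 0) (fun=> 0) j%:R); split.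
  by move=> j; exists 0%N, (fun=> 0), (fun=> 0), j%:R; split => // k; rewrite lexx.
apply/seteqP; split => // z _; exists (Num.bound `|z.2|) => //; split => //.
by rewrite (le_lt_trans (ler_norm _))// archi_boundP.
Qed.

Lemma end_measurable t : 0 <= t -> measurable_fun (setT : set (OG t)) (fun z : OG t => z.2 : R).
Proof.
move=> t0 mD; apply: (measurability _ (RGenInftyO.measurableE R)) => //.
move=> _ [_ [x ->] <-]; rewrite setTI; apply: sub_sigma_algebra.
exists 0%N, (fun=> 0), (fun=> 0), x; split; first by move=> k; rewrite lexx.
apply/seteqP; split => z /=; first by rewrite in_itv.
by case => _; rewrite in_itv.
Qed.

Lemma coordinate_measurable t s : 0 <= s <= t ->
  measurable_fun (setT : set (OG t)) (fun z : OG t => z.1 s : R).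
Proof.
move=> st mD; apply: (measurability _ (RGenInftyO.measurableE R)) => //.
move=> _ [_ [x ->] <-]; rewrite setTI.
have -> : (fun z : OG t => z.1 s : R) @^-1` `]-oo, x[%classic =
    \bigcup_j cylinder 1 (fun=> s) (fun=> x) j%:R.
  apply/seteqP; split => z /=.
    rewrite in_itv/= => H; exists (Num.bound `|z.2|) => //; split => //.
    by rewrite (le_lt_trans (ler_norm _))// archi_boundP.
  by move=> [j _ [/(_ 0 isT) + _]]; rewrite in_itv.
apply: bigcupT_measurable => j; apply: sub_sigma_algebra.
by exists 1%N, (fun=> s), (fun=> x), j%:R.
Qed.

Section law.
Context d (T : measurableType d) (P : probability T R) (t : R).
Hypothesis t0 : 0 <= t.

Definition measurable_coords (Z : T -> path_with_end) :=
  (forall s, 0 <= s <= t -> measurable_fun setT (fun w => (Z w).1 s)) /\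
  measurable_fun setT (fun w => (Z w).2).

Lemma cylinder_preimage Z C : measurable_coords Z -> cylinders t C -> measurable (Z @^-1` C).
Proof.
move=> [m1 m2] [n [s [a [b [st ->]]]]].
have -> : Z @^-1` cylinder n s a b =
   \bigcap_(k < n) [set w | (Z w).1 (s k) < a k] `&` [set w | (Z w).2 < b].
  by apply/seteqP; split => w [H1 H2]; split.
apply: measurableI.
  apply: bigcap_measurableType => k _.
  have := m1 _ (st k) measurableT `]-oo, a k[%classic (measurable_itv _).
  rewrite setTI; congr measurable; apply/seteqP; split => w /=; rewrite in_itv//.
have := m2 measurableT `]-oo, b[%classic (measurable_itv _).
rewrite setTI; congr measurable; apply/seteqP; split => w /=; rewrite in_itv//.
Qed.

Lemma measurable_coords_pair Z : measurable_coords Z -> measurable_fun setT (Z : T -> OG t).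
Proof.
move=> mZ; apply: (measurability _ (erefl : @measurable _ (OG t) = <<s cylinders t >>)).
by move=> _ [C GC <-]; rewrite setTI; exact: cylinder_preimage.
Qed.

(** The pi-lambda theorem, on the pi-system of the lower orthants, whose
    indicators are limits of products of ramps. *)
Lemma law_from_tests (Z1 Z2 : T -> path_with_end) : measurable_coords Z1 -> measurable_coords Z2 ->
  (forall n (s : nat -> R) (f : nat -> R -> R) g (l lg : R), (forall k, 0 <= s k <= t) -> (forall k, unit_lip l (f k)) -> unit_lip lg g ->
    \int[P]_w (\prod_(k < n) f k ((Z1 w).1 (s k)) * g (Z1 w).2) =
    \int[P]_w (\prod_(k < n) f k ((Z2 w).1 (s k)) * g (Z2 w).2)) ->
  forall E, <<s cylinders t >> E -> P (Z1 @^-1` E) = P (Z2 @^-1` E).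
Proof.
move=> m1 m2 H.
have cvg_law Z n (s a : nat -> R) b : measurable_coords Z -> (forall k, 0 <= s k <= t) ->
  (fun j => \int[P]_w (\prod_(k < n) ramp j (a k) ((Z w).1 (s k)) * ramp j b (Z w).2)) @ \oo -->
  fine (P (Z @^-1` cylinder n s a b)).
  move=> mZ st; have [mz1 mz2] := mZ.
  have mC : measurable (Z @^-1` cylinder n s a b).
    by apply: (cylinder_preimage mZ); exists n, s, a, b.
  have -> : fine (P (Z @^-1` cylinder n s a b)) =
      \int[P]_w (\prod_(k < n) (if (Z w).1 (s k) < a k then 1 else 0) *
                 (if (Z w).2 < b then 1 else 0)).
    transitivity (\int[P]_w (\1_(Z @^-1` cylinder n s a b) w)).
      by rewrite /Rintegral integral_indic// setIT.
    apply: eq_Rintegral => w _; rewrite indicE (prod_indic n (fun k => (Z w).1 (s k) < a k)).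
    case: (boolP (w \in _)) => [|].
      rewrite inE => -[H1 ->]; rewrite ifT ?mulr1//.
      by apply/forallP => k; exact: H1.
    rewrite notin_setE => Hn; case: ifPn => [/forallP H1|_]; last by rewrite mul0r.
    rewrite mul1r; case: ifPn => // H2; case: Hn; split => // k kn.
    exact: (H1 (Ordinal kn)).
  have ru j a' x : 0 <= ramp j a' x <= 1 by case: (ramp_unit_lip j a').
  apply: unit_Rintegral_cvg.
  - move=> j; apply: measurable_funM.
      apply: measurable_prod => k _.
      apply: (measurableT_comp (unit_lip_measurable (ramp_unit_lip j (a k)))).
      exact: mz1.
    exact: (measurableT_comp (unit_lip_measurable (ramp_unit_lip j b))).
  - move=> j w; have /andP[? ?] := ru j b (Z w).2.
    suff /andP[? ?] : 0 <= \prod_(k < n) ramp j (a k) ((Z w).1 (s k)) <= 1.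
      by rewrite mulr_ge0//= mulr_ile1.
    elim: n {mC} => [|n IH]; first by rewrite big_ord0 ler01 lexx.
    have /andP[? ?] := ru j (a n) ((Z w).1 (s n)); have /andP[? ?] := IH.
    by rewrite big_ord_recr/= mulr_ge0//= mulr_ile1.
  - move=> w; apply: cvgM; last exact: ramp_cvg.
    apply: (@prod_cvg n (fun j k => ramp j (a k) ((Z w).1 (s k)))
      (fun k => if (Z w).1 (s k) < a k then 1 else 0)) => k.
    exact: ramp_cvg.
have [g [Gg gT]] := cylinders_cover t0.
pose X1 : {mfun T >-> OG t} := HB.pack (Z1 : T -> OG t) (isMeasurableFun.Build _ _ _ _ _ (measurable_coords_pair m1)).
pose X2 : {mfun T >-> OG t} := HB.pack (Z2 : T -> OG t) (isMeasurableFun.Build _ _ _ _ _ (measurable_coords_pair m2)).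
have Gm : cylinders t `<=` (@measurable _ (OG t)) by move=> C GC; exact: sub_sigma_algebra.
move=> E sE.
have := @g_sigma_algebra_measure_unique _ R (OG t) (cylinders t) Gm g Gg gT
  (distribution P X1) (distribution P X2) (@cylinders_setI t) _ _ E sE.
apply.
  move=> C GC; have [n [s [a [b [st CE]]]]] := GC.
  change (P (Z1 @^-1` C) = P (Z2 @^-1` C)).
  have L1 := cvg_law Z1 n s a b m1 st; have L2 := cvg_law Z2 n s a b m2 st.
  have EQ : fine (P (Z1 @^-1` C)) = fine (P (Z2 @^-1` C)).
    rewrite CE -(cvg_lim (@Rhausdorff R) L1) -(cvg_lim (@Rhausdorff R) L2).
    congr (lim (_ @ \oo)); apply/funext => j.
    exact: (H n s (fun k => ramp j (a k)) (ramp j b) _ _ st (fun k => ramp_unit_lip j (a k)) (ramp_unit_lip j b)).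
  have f1 : P (Z1 @^-1` C) \is a fin_num by rewrite fin_num_measure//; exact: cylinder_preimage.
  have f2 : P (Z2 @^-1` C) \is a fin_num by rewrite fin_num_measure//; exact: cylinder_preimage.
  by rewrite -(fineK f1) EQ fineK.
by move=> k; rewrite -ge0_fin_numE// fin_num_measure//; exact: Gm.
Qed.

End law.

End Cylinders.

Lemma dist_minr {R : realType} (c a b : R) : `|Num.min c a - Num.min c b| <= `|a - b|.
Proof.
have h1 := ler_norm (a - b); have h2 := ler_norm (b - a); rewrite (distrC b a) in h2.
by case: (leP c a) => ?; case: (leP c b) => ?; rewrite ler_norml; apply/andP; split; lra.
Qed.

Lemma dist_chain_lt {R : realType} (a b c x e : R) : 0 < e ->
  `|a - b| <= e / 8 -> `|b - c| <= 2 * (e / 8) -> `|x - c| <= e / 8 -> `|a - x| < e.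
Proof.
move=> e0; rewrite !ler_norml ltr_norml => /andP[? ?] /andP[? ?] /andP[? ?].
by apply/andP; split; lra.
Qed.

(** * Borel sets of the path space *)

Section PathApproximation.
Context {R : realType}.
Variable t : R.
Hypothesis t0 : 0 < t.
Notation V := (R * R * R)%type.
Notation OG := (g_sigma_algebraType (cylinders t)).

Definition triple (z : @path_with_end R) (s : R) : V :=
  (from_pitman t z.1 z.2 s, from_pitman t z.1 (- z.2) s, z.1 s).

(** [from_pitman] with the infimum taken over a grid, so that it depends on
    finitely many coordinates. *)
Definition grid_from_pitman n (p : R -> R) (b s : R) : R :=
  2 * Num.min ((p t + b) / 2) (- grid_max (fun u => - p u) s ((t - s) / n%:R) n) - p s.

(** Rounded values of the three paths on a grid. They take countably many
    values, so every set of codes gives a measurable event, whatever the set of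
    paths from which it comes. *)
Definition grid_code n (z : @path_with_end R) : {ffun 'I_n.+1 -> int * int * int} :=
  [ffun k : 'I_n.+1 => (Num.floor (n%:R * grid_from_pitman n z.1 z.2 (k%:R * (t / n%:R))),
            Num.floor (n%:R * grid_from_pitman n z.1 (- z.2) (k%:R * (t / n%:R))),
            Num.floor (n%:R * z.1 (k%:R * (t / n%:R))))].

(** The step path read off a code. *)
Definition grid_path n (c : {ffun 'I_n.+1 -> int * int * int}) (s : R) : V :=
  let v := c (inord (grid_index t n s)) in
  (v.1.1%:~R / n%:R, v.1.2%:~R / n%:R, v.2%:~R / n%:R).

Lemma grid_point_itv n (k : nat) : (k <= n)%N -> 0 <= k%:R * (t / n%:R) <= t.
Proof.
case: n => [|n] kn; first by rewrite invr0 !mulr0 lexx ltW.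
have n0 : 0 < n.+1%:R :> R by rewrite ltr0n.
rewrite mulr_ge0 ?divr_ge0 ?(ltW t0)//= mulrA ler_pdivrMr// mulrC ler_pM2l//.
by rewrite ler_nat.
Qed.

Lemma grid_from_pitman_measurable n (b : OG -> R) s : 0 <= s <= t ->
  measurable_fun setT b ->
  measurable_fun setT (fun z : OG => grid_from_pitman n z.1 (b z) s).
Proof.
move=> st mb; have /andP[s0 s1] := st.
have tt : 0 <= t <= t by rewrite (ltW t0) lexx.
apply: measurable_funB; last exact: coordinate_measurable.
apply: measurable_funM => //; apply: measurable_minr.
  apply: measurable_funM => //; apply: measurable_funD => //; exact: coordinate_measurable.
apply: measurableT_comp => //.
apply: (@measurable_grid_max _ _ OG (fun z u => - z.1 u)) => k kn.
apply: measurableT_comp => //; apply: coordinate_measurable.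
have ts0 : 0 <= t - s by rewrite subr_ge0.
rewrite addr_ge0 ?mulr_ge0 ?divr_ge0//=.
case: n kn => [|n] kn; first by rewrite invr0 !mulr0 addr0.
have n0 : 0 < n.+1%:R :> R by rewrite ltr0n.
have : k%:R * ((t - s) / n.+1%:R) <= t - s.
  by rewrite mulrA ler_pdivrMr// mulrC ler_wpM2l// ler_nat.
by move=> H; rewrite addrC -lerBrDr.
Qed.

Lemma grid_code_measurable n (Q : set {ffun 'I_n.+1 -> int * int * int}) :
  measurable ((fun z : OG => grid_code n z) @^-1` Q).
Proof.
have fl (g : OG -> R) (i : int) : measurable_fun setT g ->
    measurable [set z | Num.floor (g z) = i].
  move=> mg; have := mg measurableT `[i%:~R, (i + 1)%:~R[%classic (measurable_itv _).
  rewrite setTI; congr measurable; apply/seteqP; split => z /=; rewrite in_itv/=.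
    by move=> H; apply: floor_def.
  by move=> <-; rewrite floor_itv.
have sing c : measurable [set z : OG | grid_code n z = c].
  have -> : [set z : OG | grid_code n z = c] = \bigcap_(k in [set: 'I_n.+1])
     ([set z : OG | Num.floor (n%:R * grid_from_pitman n z.1 z.2 (k%:R * (t / n%:R))) = (c k).1.1]
     `&` [set z : OG | Num.floor (n%:R * grid_from_pitman n z.1 (- z.2) (k%:R * (t / n%:R))) = (c k).1.2]
     `&` [set z : OG | Num.floor (n%:R * z.1 (k%:R * (t / n%:R))) = (c k).2]).
    apply/seteqP; split => z.
      by move=> /= <- k _; rewrite /= ffunE.
    move=> H; apply/ffunP => k; rewrite ffunE; have [[-> ->] ->] := H k I.
    by case: (c k) => -[].
  apply: fin_bigcap_measurable => // k _.
  have kt := grid_point_itv (ltn_ord k : (k <= n)%N).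
  have me := end_measurable (ltW t0).
  apply: measurableI; first apply: measurableI; apply: fl; apply: measurable_funM => //.
  - exact: grid_from_pitman_measurable.
  - apply: grid_from_pitman_measurable => //; exact: measurableT_comp.
  - exact: coordinate_measurable.
have -> : (fun z : OG => grid_code n z) @^-1` Q =
   \bigcup_(c : {ffun 'I_n.+1 -> int * int * int}) (if `[<Q c>] then [set z : OG | grid_code n z = c] else set0).
  apply/seteqP; split => z /=.
    by move=> Qz; exists (grid_code n z) => //; rewrite asboolT.
  by move=> [c _]; case: asboolP => //= Qc ->.
apply: countable_bigcupT_measurable; first exact: countableP.
by move=> c; case: asboolP.
Qed.

Lemma unif_cont_from_pitman p b : unif_cont t p -> unif_cont t (from_pitman t p b).
Proof.
move=> up; have U1 := unif_contN (unif_cont_max_after (unif_contN up)).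
have U2 : unif_cont t (fun s => Num.min ((p t + b) / 2) (- path_max (fun u => - p u) s t)).
  by apply: (unif_cont_lip ltr01 U1) => u v; rewrite mul1r; exact: dist_minr.
exact: unif_contD (unif_contM2 U2) (unif_contN up).
Qed.

Lemma floor_close n (x : R) : (0 < n)%N -> `|(Num.floor (n%:R * x))%:~R / n%:R - x| <= n%:R^-1.
Proof.
move=> n0; have nn0 : 0 < n%:R :> R by rewrite ltr0n.
have /andP[f1 f2] := floor_itv (n%:R * x).
have -> : (Num.floor (n%:R * x))%:~R / n%:R - x = ((Num.floor (n%:R * x))%:~R - n%:R * x) / n%:R.
  by field; rewrite gt_eqF.
rewrite normrM normfV (gtr0_norm nn0) ler_piMl ?invr_ge0 ?(ltW nn0)//.
rewrite ler_norml; apply/andP; split; last lra.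
by move: f2; rewrite intrD; lra.
Qed.

Lemma grid_path_cvg z e : unif_cont t z.1 -> 0 < e ->
  \forall n \near \oo, forall s, 0 <= s <= t ->
    ball (triple z s) e (grid_path (grid_code n z) s).
Proof.
move=> up e0.
have e4 : 0 < e / 8 by rewrite divr_gt0.
have [eta1 eta10 mod1] := up _ e4.
have [eta2 eta20 mod2] := unif_cont_from_pitman z.2 up e4.
have [eta3 eta30 mod3] := unif_cont_from_pitman (- z.2) up e4.
near=> n => s st.
have n0 : (0 < n)%N by near: n; exact: nbhs_infty_gt.
have nn0 : 0 < n%:R :> R by rewrite ltr0n.
have dn eta : t / eta <= n%:R -> 0 < eta -> t / n%:R <= eta.
  by move=> H eta0; rewrite ler_pdivrMr// mulrC -ler_pdivrMr.
have d1 : t / n%:R <= eta1 by apply: dn => //; near: n; exact: nbhs_infty_ger.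
have d2 : t / n%:R <= eta2 by apply: dn => //; near: n; exact: nbhs_infty_ger.
have d3 : t / n%:R <= eta3 by apply: dn => //; near: n; exact: nbhs_infty_ger.
have ne : n%:R^-1 <= e / 8.
  rewrite -[n%:R^-1]mul1r ler_pdivrMr// mulrC -ler_pdivrMr//.
  by near: n; exact: nbhs_infty_ger.
have /andP[s0 s1] := st.
set k := grid_index t n s.
have kn : (k <= n)%N by exact: grid_index_le.
have kt := grid_point_itv kn.
have /andP[k1 k2] := grid_index_itv t0 n0 s0.
rewrite -/k in k1 k2.
set r := k%:R * (t / n%:R) in kt k1 k2.
have sr eta : t / n%:R <= eta -> `|s - r| <= eta.
  by rewrite ger0_norm ?subr_ge0//; lra.
have fp b : (forall u v, 0 <= u <= t -> 0 <= v <= t -> `|u - v| <= t / n%:R ->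
      `|from_pitman t z.1 b u - from_pitman t z.1 b v| <= e / 8) ->
    `|from_pitman t z.1 b s - (Num.floor (n%:R * grid_from_pitman n z.1 b r))%:~R / n%:R| < e.
  move=> mod.
  have A1 := mod s r st kt (sr _ (lexx _)).
  have A2 := floor_close (grid_from_pitman n z.1 b r) n0.
  have /andP[r0 r1] := kt.
  have modN u v : 0 <= u <= t -> 0 <= v <= t -> `|u - v| <= eta1 -> `|- z.1 u - - z.1 v| <= e / 8.
    by move=> u0 v0 uv; rewrite -opprD normrN; exact: mod1.
  have A3 : `|grid_max (fun u => - z.1 u) r ((t - r) / n%:R) n - path_max (fun u => - z.1 u) r t| <= e / 8.
    have E : r + n%:R * ((t - r) / n%:R) = t by field; rewrite gt_eqF.
    apply: (grid_max_close (unif_contN up) modN) => //; rewrite ?E//.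
    - by rewrite divr_ge0// subr_ge0.
    - by apply: le_trans d1; rewrite ler_pM2r ?invr_gt0//; lra.
    - by rewrite lerDl ltW.
  have A4 : `|from_pitman t z.1 b r - grid_from_pitman n z.1 b r| <= 2 * (e / 8).
    rewrite /from_pitman /grid_from_pitman.
    move: A3; set a := grid_max _ _ _ _; set a' := path_max _ _ _; set c := _ / 2 => A3.
    have -> : 2 * Num.min c (- a') - z.1 r - (2 * Num.min c (- a) - z.1 r) =
      2 * (Num.min c (- a') - Num.min c (- a)) by ring.
    rewrite normrM ger0_norm// ler_wpM2l//; apply: (le_trans (dist_minr _ _ _)).
    by rewrite -opprD normrN distrC.
  exact: (dist_chain_lt e0 A1 A4 (le_trans A2 ne)).
rewrite /grid_path /grid_code -/k !ffunE /= inordK ?ltnS// -/r.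
split; first split => /=.
- apply: fp => u v u0 v0 uv; apply: mod2 => //; exact: le_trans d2.
- apply: fp => u v u0 v0 uv; apply: mod3 => //; exact: le_trans d3.
- rewrite /=.
  have A1 := mod1 s r st kt (sr _ d1).
  have A2 := floor_close (z.1 r) n0.
  change (`|z.1 s - (Num.floor (n%:R * z.1 r))%:~R / n%:R| < e).
  apply: (dist_chain_lt e0 A1 _ (le_trans A2 ne)).
  by rewrite subrr normr0 mulr_ge0// ltW.
Unshelve. all: by end_near. Qed.

Notation path := {uniform` `[0, t] -> V}.

Definition represents (z : @path_with_end R) (x : path) :=
  [/\ unif_cont t z.1, (forall s, 0 <= s <= t -> x s = triple z s)
    & @path_space R t V x].

(** A path lies in the open set [U] when, for some radius, the balls around all
    its step approximations of high enough index lie in [U]; this condition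
    only involves the codes. *)
Lemma open_represented (U : set path) : open U ->
  exists2 E, <<s cylinders t >> E & forall z x, represents z x -> (U x <-> E z).
Proof.
move=> oU.
pose good n m := [set z : OG | forall g : path,
  (forall s, 0 <= s <= t -> ball (grid_path (grid_code n z) s) m.+1%:R^-1 (g s)) -> U g].
have mgood n m : measurable (good n m).
  exact: (@grid_code_measurable n [set c | forall g : path,
    (forall s, 0 <= s <= t -> ball (grid_path c s) m.+1%:R^-1 (g s)) -> U g]).
exists (\bigcup_m \bigcup_n0 \bigcap_(n in [set n | (n0 <= n)%N]) good n m).
  apply: (@bigcupT_measurable _ OG) => m; apply: bigcupT_measurable => n0.
  by apply: bigcap_measurableType => n _.
move=> z x [uz xz xC]; split.
  move=> Ux; have /uniform_nbhs[E [entE EU]] := open_nbhs_nbhs (conj oU Ux).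
  move: entE; rewrite -entourage_ballE => -[e /= e0 eE].
  have e2 : 0 < e / 2 by rewrite divr_gt0.
  have [n0 _ Hn] := grid_path_cvg uz e2.
  pose m := Num.bound (2 / e).
  have me : m.+1%:R^-1 <= e / 2.
    rewrite -[e / 2]invrK lef_pV2 ?posrE ?ltr0n ?invr_gt0// invf_div.
    apply: (@le_trans _ _ m%:R); last by rewrite ler_nat.
    by apply/ltW/archi_boundP; rewrite divr_ge0// ltW.
  exists m => //; exists n0 => // n /= nn g Hg; apply: EU => s /=; rewrite in_itv/= => st.
  apply: eE => /=; rewrite (splitr e).
  apply: (ball_triangle (y := grid_path (grid_code n z) s)).
    by rewrite (xz s st); exact: Hn.
  exact: le_ball me _ (Hg s st).
move=> [m _ [n0 _ H]].
have m0 : 0 < m.+1%:R^-1 :> R by rewrite invr_gt0 ltr0n.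
have [n1 _ Hn] := grid_path_cvg uz m0.
apply: (H (maxn n0 n1)); first by rewrite /= leq_maxl.
move=> s st; apply: ball_sym; rewrite (xz s st); apply: Hn => //.
by rewrite /= leq_maxr.
Qed.

(** The sets for which this holds form a sigma-algebra on the path space. *)
Lemma borel_represented A : @borel_path_space R t V A ->
  exists2 E, <<s cylinders t >> E & forall z x, represents z x -> (A x <-> E z).
Proof.
move: A; apply: smallest_sub.
  split.
  - by exists set0; [exact: (@measurable0 _ OG)|].
  - move=> A [E sE EA]; exists (~` E); first exact: (@measurableC _ OG).
    move=> z x zx; have [_ _ xC] := zx; have HA := EA z x zx.
    by split => [[_ nA] /HA//|nE]; split => // /HA.
  - move=> F HF; pose E n := sval (cid2 (HF n)).
    have sE n : <<s cylinders t >> (E n) by rewrite /E; case: cid2.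
    have EF n z x : represents z x -> (F n x <-> E n z) by rewrite /E; case: cid2 => ? ? /=; apply.
    exists (\bigcup_n E n); first exact: (@bigcupT_measurable _ OG).
    move=> z x zx; split => -[n _ H]; exists n => //; exact/(EF n z x zx).
move=> _ [U oU <-]; have [E sE EU] := open_represented oU.
exists E => // z x zx; have HU := EU z x zx; have [_ _ xC] := zx.
by split => [[/HU]|/HU].
Qed.

End PathApproximation.

(** * The drifted Brownian path *)

Section DriftedPaths.
Context {R : realType} d (T : measurableType d) (P : probability T R).
Variables (B : R -> {RV P >-> R}).
Hypothesis hB : standard_brownian_motion B.
Variable t : R.
Hypothesis t0 : 0 < t.

Lemma pitman_drifted_measurable mu s : 0 <= s <= t ->
  measurable_fun setT (fun w => pitman (drifted B mu w) s).
Proof.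
move=> /andP[s0 st]; apply: measurable_funB; last exact: drifted_measurable.
apply: measurable_funM => //.
apply: (@measurable_fun_cvg _ _ _ _
  (fun n w => grid_max (drifted B mu w) 0 ((s - 0) / n%:R) n)) => [n|w _].
  by apply: measurable_grid_max => k _; exact: drifted_measurable.
exact: (grid_max_cvg (drifted_unif_cont hB t mu w) (lexx 0) s0 st).
Qed.

Lemma path_space_triple (x y z : R -> R) :
  unif_cont t x -> unif_cont t y -> unif_cont t z ->
  @path_space R t (R * R * R)%type (fun s => (x s, y s, z s)).
Proof.
move=> /unif_cont_within/subspace_continuousP cx.
move=> /unif_cont_within/subspace_continuousP cy.
move=> /unif_cont_within/subspace_continuousP cz.
apply/subspace_continuousP => s st.
exact: (cvg_pair (cvg_pair (cx s st) (cy s st)) (cz s st)).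
Qed.

Lemma represents_path mu w :
  represents (t := t) (pitman (drifted B mu w), drifted B mu w t)
   (fun s => (drifted B mu w s, calM t (drifted B mu w) s, pitman (drifted B mu w) s)).
Proof.
have up := drifted_unif_cont hB t mu w.
split.
- exact: unif_cont_pitman.
- by move=> s st; rewrite /triple/= -path_from_pitman// -calM_from_pitman.
- apply: path_space_triple => //; [exact: unif_cont_calM|exact: unif_cont_pitman].
Qed.

Lemma represents_swapped_path mu w :
  represents (t := t) (pitman (drifted B mu w), - drifted B mu w t)
   (fun s => (calM t (drifted B mu w) s, drifted B mu w s, pitman (drifted B mu w) s)).
Proof.
have up := drifted_unif_cont hB t mu w.
split.
- exact: unif_cont_pitman.
- by move=> s st; rewrite /triple/= opprK -path_from_pitman// -calM_from_pitman.
- apply: path_space_triple => //; [exact: unif_cont_calM|exact: unif_cont_pitman].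
Qed.

Lemma pitman_end_law mu E : <<s cylinders t >> E ->
  P ((fun w => (pitman (drifted B mu w), drifted B mu w t) : @path_with_end R) @^-1` E) =
  P ((fun w => (pitman (drifted B (- mu) w), - drifted B (- mu) w t) : @path_with_end R) @^-1` E).
Proof.
apply: (law_from_tests (ltW t0)).
- split => [s st|]; first exact: pitman_drifted_measurable.
  exact: drifted_measurable.
- split => [s st|]; first exact: pitman_drifted_measurable.
  by apply: measurableT_comp => //; exact: drifted_measurable.
- by move=> n s f g l lg st tf tg; exact: (pitman_test_symmetry hB t0 mu n st tf tg).
Qed.

Lemma pitman_end_preimage_measurable mu (sg : R) E : <<s cylinders t >> E ->
  measurable ((fun w => (pitman (drifted B mu w), sg * drifted B mu w t) : @path_with_end R) @^-1` E).
Proof.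
move=> sE.
have mZ : measurable_coords t (fun w => (pitman (drifted B mu w), sg * drifted B mu w t) : @path_with_end R).
  split => [s st|]; first exact: pitman_drifted_measurable.
  by apply: measurable_funM => //; exact: drifted_measurable.
have := measurable_coords_pair mZ measurableT sE.
by rewrite setTI.
Qed.

End DriftedPaths.

Theorem corollary1p3 (R : realType) (d : measure_display) (T : measurableType d)
    (P : probability T R) (B : R -> {RV P >-> R})
    (hB : standard_brownian_motion B) (t : R) (ht : 0 < t) (mu : R) :
  same_law P (t := t) (V := (R * R * R)%type)
    (fun w s => (drifted B mu w s,
                 calM t (drifted B mu w) s,
                 pitman (drifted B mu w) s))
    (fun w s => (calM t (drifted B (- mu) w) s,
                 drifted B (- mu) w s,
                 pitman (drifted B (- mu) w) s)).
Proof.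
have pre (X : T -> {uniform` `[0, t] -> (R * R * R)%type}) Z A E :
    (forall w, represents (Z w) (X w)) ->
    (forall z x, represents z x -> (A x <-> E z)) -> X @^-1` A = Z @^-1` E.
  by move=> ZX AE; apply/seteqP; split => w; have [H1 H2] := AE _ _ (ZX w).
have R1 := represents_path hB t mu.
have R2 := represents_swapped_path hB t (- mu).
split.
- split => [w|A mA]; first by case: (R1 w).
  have [E sE AE] := borel_represented ht mA.
  rewrite (pre _ _ _ _ R1 AE).
  have := pitman_end_preimage_measurable hB mu 1 sE.
  by congr measurable; apply/seteqP; split => w; rewrite /= mul1r.
- split => [w|A mA]; first by case: (R2 w).
  have [E sE AE] := borel_represented ht mA.
  rewrite (pre _ _ _ _ R2 AE).
  have := pitman_end_preimage_measurable hB (- mu) (- 1) sE.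
  by congr measurable; apply/seteqP; split => w; rewrite /= mulN1r.
- move=> A mA; have [E sE AE] := borel_represented ht mA.
  rewrite (pre _ _ _ _ R1 AE) (pre _ _ _ _ R2 AE).
  exact: pitman_end_law.
Qed.
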